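(* Let $R$ be a principal ideal domain, let $Y$ be a simply connected CW-complex such that $H_*(Y;R)$ is a free graded $R$-module, and suppose that the suspension $\Sigma Y$ has dimension $q+1$. Then there exist two short exact sequences of groups $$\mathrm{Hom}\big(H_{q+1}(\Sigma Y;R),\mathbb T_{q}(H_{<q}(Y;R))\big)\rightarrowtail\mathrm{aut}(A(\Sigma Y))\twoheadrightarrow\mathrm{aut}\big(H_{q+1}(\Sigma Y;R)\big)\times\mathrm{aut}\big(A((\Sigma Y)^{q})\big),$$ $$\mathrm{Hom}\big(H_{q+1}(\Sigma Y;R),\mathbb T_{q}(H_{<q}(Y;R))\big)\rightarrowtail\mathrm{aut}_{*}(A(\Sigma Y))\twoheadrightarrow\mathrm{aut}_{*}\big(A((\Sigma Y)^{q})\big),$$ where $(\Sigma Y)^{q}$ is the $q$-skeleton of $\Sigma Y$.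
   Context: Here $H_*(Y;R)$ is reduced homology, so $H_q(Y;R)\cong H_{q+1}(\Sigma Y;R)$. By the Bott-Samelson theorem, since $H_*(Y;R)$ is free, the tensor algebra with trivial differential $A(\Sigma Y)=(\mathbb T(H_*(Y;R)),0)$ is an Adams-Hilton model of $\Sigma Y$; it has the form $\mathbb T(V_q\oplus V_{\le q-1})$ with $V_k=H_k(Y;R)$. The algebra $A((\Sigma Y)^q)$ denotes the subalgebra $(\mathbb T(V_{\le q-1}),0)=(\mathbb T(H_{<q}(Y;R)),0)$, identified in this setting with the model of the $q$-skeleton. $\mathbb T_q(-)$ is the degree $q$ part of the tensor algebra. $\mathrm{aut}(\mathbb T(V))$ is the group of graded algebra automorphisms of $\mathbb T(V)$, and $\mathrm{aut}_*(\mathbb T(V))$ is the subgroup of automorphisms inducing the identity on the graded module $V$ of indecomposables. *)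

(* Defs.v *)
From HB Require Import structures.
From mathcomp Require Import all_boot all_order all_algebra generic_quotient.
From mathcomp Require Import all_classical reals topology.
From mathcomp Require Import finmap monalg.

Set Implicit Arguments.
Unset Strict Implicit.
Unset Printing Implicit Defensive.

Import Order.TTheory GRing.Theory Num.Theory.
Import numFieldTopology.Exports.

Local Open Scope classical_set_scope.
Local Open Scope ring_scope.
Local Open Scope quotient_scope.

Definition is_PID (R : idomainType) : Prop :=
  forall I : set R,
    I 0 -> (forall x y, I x -> I y -> I (x + y)) ->
    (forall a x, I x -> I (a * x)) ->
  exists a, I = [set b * a | b in setT].

Definition is_free (R : nzRingType) (M : lmodType R) : Prop :=
  exists (B : choiceType) (f : {linear {malg R[B]} -> M}), bijective f.

Record submodule (R : nzRingType) (M : lmodType R) := Submodule {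
  submodule_in :> M -> Prop;
  submodule0 : submodule_in 0;
  submoduleP : forall a x y,
    submodule_in x -> submodule_in y -> submodule_in (a *: x + y) }.

Section SubmoduleType.
Variables (R : nzRingType) (M : lmodType R) (W : submodule M).

Definition submodule_pred : {pred M} := fun x => `[< W x >].

Fact submodule_pred_closed : submod_closed submodule_pred.
Proof.
split; first exact/asboolP/submodule0.
by move=> a x y /asboolP Wx /asboolP Wy; exact/asboolP/submoduleP.
Qed.

HB.instance Definition _ :=
  GRing.isSubmodClosed.Build R M submodule_pred submodule_pred_closed.

Record submod_of := SubmodOf {
  submod_val :> M;
  submod_valP : submod_val \in submodule_pred }.

HB.instance Definition _ := [isSub for submod_val].
HB.instance Definition _ := [Choice of submod_of by <:].
HB.instance Definition _ := [SubChoice_isSubLmodule of submod_of by <:].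

End SubmoduleType.

Section Span.
Variables (R : nzRingType) (M : lmodType R) (S : M -> Prop).

Inductive in_span : M -> Prop :=
| in_span0 : in_span 0
| in_spanD a x y : S x -> in_span y -> in_span (a *: x + y).

Fact in_spanP a x y : in_span x -> in_span y -> in_span (a *: x + y).
Proof.
move=> Sx Sy; elim: Sx => [|b x' y' Sx' _ IH]; first by rewrite scaler0 add0r.
by rewrite scalerDr scalerA -addrA; apply: in_spanD.
Qed.

Definition submodule_span := Submodule in_span0 in_spanP.

End Span.

Section QuotientModule.
Variables (R : nzRingType) (M : lmodType R) (W : submodule M).

Definition quot_rel (x y : M) : bool := `[< W (x - y) >].

Local Lemma submoduleZ a x : W x -> W (a *: x).
Proof.
move=> Wx; rewrite -[_ *: _]addr0.
by apply: submoduleP => //; apply: submodule0.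
Qed.

Local Lemma submoduleD x y : W x -> W y -> W (x + y).
Proof. by move=> Wx Wy; rewrite -[x]scale1r; apply: submoduleP. Qed.

Local Lemma submoduleN x : W x -> W (- x).
Proof. by rewrite -scaleN1r; apply: submoduleZ. Qed.

Fact quot_rel_refl : reflexive quot_rel.
Proof. by move=> x; apply/asboolP; rewrite subrr; apply: submodule0. Qed.

Fact quot_rel_sym : symmetric quot_rel.
Proof.
by move=> x y; apply/asboolP/asboolP => /submoduleN; rewrite opprB.
Qed.

Fact quot_rel_trans : transitive quot_rel.
Proof.
move=> y x z /asboolP Wxy /asboolP Wyz; apply/asboolP.
by rewrite -(subrK y x) -addrA; apply: submoduleD.
Qed.

Canonical quot_equiv :=
  EquivRel quot_rel quot_rel_refl quot_rel_sym quot_rel_trans.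

Definition quot_of := {eq_quot quot_equiv}.

HB.instance Definition _ := Choice.on quot_of.
HB.instance Definition _ := Quotient.on quot_of.

Lemma quot_ofW (K : quot_of -> Prop) :
  (forall x, K (\pi_quot_of x)) -> forall u, K u.
Proof. by move=> H u; rewrite -[u]reprK. Qed.

Lemma quot_eqP x y : \pi_quot_of x = \pi_quot_of y <-> W (x - y).
Proof.
split=> [/eqP|Wxy]; first by rewrite eqmodE => /asboolP.
by apply/eqP; rewrite eqmodE; apply/asboolP.
Qed.

Definition quot_add (u v : quot_of) : quot_of := \pi_quot_of (repr u + repr v).
Definition quot_opp (u : quot_of) : quot_of := \pi_quot_of (- repr u).
Definition quot_scale a (u : quot_of) : quot_of := \pi_quot_of (a *: repr u).

Local Lemma repr_piP x : W (repr (\pi_quot_of x) - x).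
Proof. by apply/quot_eqP; rewrite reprK. Qed.

Lemma quot_addE x y : quot_add (\pi_quot_of x) (\pi_quot_of y) = \pi_quot_of (x + y).
Proof.
by apply/quot_eqP; rewrite opprD addrACA; apply: submoduleD; apply: repr_piP.
Qed.

Lemma quot_oppE x : quot_opp (\pi_quot_of x) = \pi_quot_of (- x).
Proof.
by apply/quot_eqP; rewrite -opprD; apply: submoduleN; apply: repr_piP.
Qed.

Lemma quot_scaleE a x : quot_scale a (\pi_quot_of x) = \pi_quot_of (a *: x).
Proof.
by apply/quot_eqP; rewrite -scalerBr; apply: submoduleZ; apply: repr_piP.
Qed.

Fact quot_addA : associative quot_add.
Proof.
by elim/quot_ofW=> x; elim/quot_ofW=> y; elim/quot_ofW=> z; rewrite !quot_addE addrA.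
Qed.

Fact quot_addC : commutative quot_add.
Proof. by elim/quot_ofW=> x; elim/quot_ofW=> y; rewrite !quot_addE addrC. Qed.

Fact quot_add0 : left_id (\pi_quot_of 0) quot_add.
Proof. by elim/quot_ofW=> x; rewrite quot_addE add0r. Qed.

Fact quot_addN : left_inverse (\pi_quot_of 0) quot_opp quot_add.
Proof. by elim/quot_ofW=> x; rewrite quot_oppE quot_addE addNr. Qed.

HB.instance Definition _ :=
  GRing.isZmodule.Build quot_of quot_addA quot_addC quot_add0 quot_addN.

Fact quot_scaleA a b u :
  quot_scale a (quot_scale b u) = quot_scale (a * b) u.
Proof. by elim/quot_ofW: u => x; rewrite !quot_scaleE scalerA. Qed.

Fact quot_scale1 : left_id 1 quot_scale.
Proof. by elim/quot_ofW=> x; rewrite quot_scaleE scale1r. Qed.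

Fact quot_scaleDr : right_distributive quot_scale +%R.
Proof.
move=> a; elim/quot_ofW=> x; elim/quot_ofW=> y.
by rewrite [LHS](congr1 (quot_scale a) (quot_addE x y)) !quot_scaleE
   scalerDr -quot_addE.
Qed.

Fact quot_scaleDl u : {morph quot_scale^~ u : a b / a + b}.
Proof.
elim/quot_ofW: u => x a b.
by rewrite /= !quot_scaleE scalerDl -quot_addE.
Qed.

HB.instance Definition _ := GRing.Zmodule_isLmodule.Build R quot_of
  quot_scaleA quot_scale1 quot_scaleDr quot_scaleDl.

End QuotientModule.

Section HomModule.
Variables (R : comNzRingType) (M N : lmodType R).

Definition is_linear (f : M -> N) : Prop :=
  forall a x y, f (a *: x + y) = a *: f x + f y.

Lemma is_linear_0 f : is_linear f -> f 0 = 0.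
Proof. by move=> fL; have := fL (-1) 0 0; rewrite !scaleN1r oppr0 addr0 addNr. Qed.

Fact is_linear0 : is_linear 0.
Proof. by move=> a x y; rewrite /= scaler0 addr0. Qed.

Fact is_linearP a (f g : M -> N) :
  is_linear f -> is_linear g -> is_linear (a *: f + g).
Proof.
move=> fL gL b x y; rewrite !fctE fL gL !scalerDr !scalerA mulrC.
by rewrite addrACA.
Qed.

(* Hom(M, N), as a submodule of the module of all functions M -> N. *)
Definition lin_hom : lmodType R := submod_of (Submodule is_linear0 is_linearP).

End HomModule.

Record mapclass (T : Type) := MapClass {
  mapclass_in :> (T -> T) -> Prop;
  mapclass_id : mapclass_in id;
  mapclass_comp : forall f g,
    mapclass_in f -> mapclass_in g -> mapclass_in (f \o g) }.

Section Aut.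
Variables (T : Type) (P : mapclass T).

(* The invertible elements of the monoid P of self-maps of T. *)
Record aut := Aut {
  aut_fun :> T -> T;
  aut_inv : T -> T;
  aut_funK : cancel aut_fun aut_inv;
  aut_invK : cancel aut_inv aut_fun;
  aut_funP : P aut_fun;
  aut_invP : P aut_inv }.

HB.instance Definition _ := gen_eqMixin aut.
HB.instance Definition _ := gen_choiceMixin aut.

Lemma aut_eq (f g : aut) : f =1 g -> f = g.
Proof.
case: f g => [f f' fK f'K Pf Pf'] [g g' gK g'K Pg Pg'] /= fg.
have e : f = g by apply/funext.
have e' : f' = g'.
  by apply/funext => x; rewrite -{1}[x]g'K -fg fK.
rewrite {}e {}e' in fK f'K Pf Pf' *.
by congr Aut; exact: Prop_irrelevance.
Qed.

Definition aut_one := Aut (fun _ => erefl) (fun _ => erefl)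
  (mapclass_id P) (mapclass_id P).

Definition aut_opp (f : aut) :=
  Aut (aut_invK f) (aut_funK f) (aut_invP f) (aut_funP f).

Definition aut_mul (f g : aut) :=
  Aut (can_comp (aut_funK f) (aut_funK g)) (can_comp (aut_invK g) (aut_invK f))
    (mapclass_comp (aut_funP f) (aut_funP g))
    (mapclass_comp (aut_invP g) (aut_invP f)).

Fact aut_mulA : associative aut_mul.
Proof. by move=> f g h; apply: aut_eq. Qed.
Fact aut_mul1 : left_id aut_one aut_mul.
Proof. by move=> f; apply: aut_eq. Qed.
Fact aut_mulr1 : right_id aut_one aut_mul.
Proof. by move=> f; apply: aut_eq. Qed.
Fact aut_mulV : left_inverse aut_one aut_opp aut_mul.
Proof. by move=> f; apply: aut_eq => x /=; rewrite aut_funK. Qed.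
Fact aut_mulrV : right_inverse aut_one aut_opp aut_mul.
Proof. by move=> f; apply: aut_eq => x /=; rewrite aut_invK. Qed.

HB.instance Definition _ :=
  isGroup.Build aut aut_mulA aut_mul1 aut_mulr1 aut_mulV aut_mulrV.

End Aut.

Section ModuleAut.
Variables (R : comNzRingType) (M : lmodType R).

Fact is_linear_id : is_linear (@id M). Proof. by []. Qed.
Fact is_linear_comp (f g : M -> M) :
  is_linear f -> is_linear g -> is_linear (f \o g).
Proof. by move=> fL gL a x y /=; rewrite gL fL. Qed.

Definition module_aut : groupType := aut (MapClass is_linear_id is_linear_comp).

End ModuleAut.

Definition short_exact (A : zmodType) (G Q : groupType)
    (i : A -> G) (p : G -> Q) : Prop :=
  [/\ {morph i : x y / x + y >-> (x * y)%g},
      {morph p : g h / (g * h)%g},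
      injective i,
      (forall g, p g = 1%g <-> exists x, i x = g) &
      (forall u, exists g, p g = u)].

Section TensorAlgebra.
Variables (R : comNzRingType) (V : nat -> lmodType R).

(* T(V) is presented as the R-algebra generated by the elements of the V n,
   subject to the linearity of each map V n -> T(V). *)
Inductive tterm :=
| TScal of R
| TGen n of V n
| TAdd of tterm & tterm
| TMul of tterm & tterm.

HB.instance Definition _ := gen_eqMixin tterm.
HB.instance Definition _ := gen_choiceMixin tterm.

Inductive tcong : tterm -> tterm -> Prop :=
| tc_refl x : tcong x x
| tc_sym x y : tcong x y -> tcong y x
| tc_trans x y z : tcong x y -> tcong y z -> tcong x z
| tc_add x x' y y' :
    tcong x x' -> tcong y y' -> tcong (TAdd x y) (TAdd x' y')
| tc_mul x x' y y' :
    tcong x x' -> tcong y y' -> tcong (TMul x y) (TMul x' y')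
| tc_addA x y z : tcong (TAdd x (TAdd y z)) (TAdd (TAdd x y) z)
| tc_addC x y : tcong (TAdd x y) (TAdd y x)
| tc_add0 x : tcong (TAdd (TScal 0) x) x
| tc_addN x : tcong (TAdd (TMul (TScal (-1)) x) x) (TScal 0)
| tc_mulA x y z : tcong (TMul x (TMul y z)) (TMul (TMul x y) z)
| tc_mul1 x : tcong (TMul (TScal 1) x) x
| tc_mulDl x y z : tcong (TMul (TAdd x y) z) (TAdd (TMul x z) (TMul y z))
| tc_mulDr x y z : tcong (TMul x (TAdd y z)) (TAdd (TMul x y) (TMul x z))
| tc_scalD a b : tcong (TScal (a + b)) (TAdd (TScal a) (TScal b))
| tc_scalM a b : tcong (TScal (a * b)) (TMul (TScal a) (TScal b))
| tc_scalC a x : tcong (TMul (TScal a) x) (TMul x (TScal a))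
| tc_gen n a (v w : V n) :
    tcong (TGen (a *: v + w)) (TAdd (TMul (TScal a) (TGen v)) (TGen w)).

Definition tcongb x y : bool := `[< tcong x y >].

Fact tcongb_refl : reflexive tcongb.
Proof. by move=> x; apply/asboolP; apply: tc_refl. Qed.
Fact tcongb_sym : symmetric tcongb.
Proof. by move=> x y; apply/asboolP/asboolP; apply: tc_sym. Qed.
Fact tcongb_trans : transitive tcongb.
Proof.
by move=> y x z /asboolP ? /asboolP ?; apply/asboolP; apply: tc_trans; eassumption.
Qed.

Canonical tcong_equiv := EquivRel tcongb tcongb_refl tcongb_sym tcongb_trans.

Definition tens := {eq_quot tcong_equiv}.

HB.instance Definition _ := Choice.on tens.
HB.instance Definition _ := Quotient.on tens.

Lemma tensW (K : tens -> Prop) :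
  (forall x, K (\pi_tens x)) -> forall u, K u.
Proof. by move=> H u; rewrite -[u]reprK. Qed.

Lemma tens_eqP x y : \pi_tens x = \pi_tens y <-> tcong x y.
Proof.
split=> [/eqP|Wxy]; first by rewrite eqmodE => /asboolP.
by apply/eqP; rewrite eqmodE; apply/asboolP.
Qed.

Definition tens_add (u v : tens) : tens := \pi_tens (TAdd (repr u) (repr v)).
Definition tens_mul (u v : tens) : tens := \pi_tens (TMul (repr u) (repr v)).
Definition tens_scal (a : R) : tens := \pi_tens (TScal a).
Definition tens_opp (u : tens) : tens := tens_mul (tens_scal (-1)) u.

Local Lemma tens_reprP x : tcong (repr (\pi_tens x)) x.
Proof. by apply/tens_eqP; rewrite reprK. Qed.

Lemma tens_addE x y : tens_add (\pi_tens x) (\pi_tens y) = \pi_tens (TAdd x y).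
Proof. by apply/tens_eqP; apply: tc_add; apply: tens_reprP. Qed.

Lemma tens_mulE x y : tens_mul (\pi_tens x) (\pi_tens y) = \pi_tens (TMul x y).
Proof. by apply/tens_eqP; apply: tc_mul; apply: tens_reprP. Qed.

Lemma tens_addA : associative tens_add.
Proof.
elim/tensW=> x; elim/tensW=> y; elim/tensW=> z.
by rewrite !tens_addE; apply/tens_eqP/tc_addA.
Qed.

Lemma tens_addC : commutative tens_add.
Proof.
by elim/tensW=> x; elim/tensW=> y; rewrite !tens_addE; apply/tens_eqP/tc_addC.
Qed.

Lemma tens_add0 : left_id (tens_scal 0) tens_add.
Proof. by elim/tensW=> x; rewrite !tens_addE; apply/tens_eqP/tc_add0. Qed.

Lemma tens_addN : left_inverse (tens_scal 0) tens_opp tens_add.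
Proof.
elim/tensW=> x; rewrite /tens_opp tens_mulE tens_addE.
exact/tens_eqP/tc_addN.
Qed.

HB.instance Definition _ :=
  GRing.isZmodule.Build tens tens_addA tens_addC tens_add0 tens_addN.

Lemma tens_mulA : associative tens_mul.
Proof.
elim/tensW=> x; elim/tensW=> y; elim/tensW=> z.
by rewrite !tens_mulE; apply/tens_eqP/tc_mulA.
Qed.

Lemma tens_mul1 : left_id (tens_scal 1) tens_mul.
Proof. by elim/tensW=> x; rewrite !tens_mulE; apply/tens_eqP/tc_mul1. Qed.

Lemma tens_scalC a u : tens_mul (tens_scal a) u = tens_mul u (tens_scal a).
Proof. by elim/tensW: u=> x; rewrite !tens_mulE; apply/tens_eqP/tc_scalC. Qed.

Lemma tens_mulr1 : right_id (tens_scal 1) tens_mul.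
Proof. by move=> u; rewrite -tens_scalC tens_mul1. Qed.

Lemma tens_mulDl : left_distributive tens_mul +%R.
Proof.
elim/tensW=> x; elim/tensW=> y; elim/tensW=> z.
rewrite -[_ + _]/(tens_add _ _) -[RHS]/(tens_add _ _).
by rewrite !(tens_addE, tens_mulE); apply/tens_eqP/tc_mulDl.
Qed.

Lemma tens_mulDr : right_distributive tens_mul +%R.
Proof.
elim/tensW=> x; elim/tensW=> y; elim/tensW=> z.
rewrite -[_ + _]/(tens_add _ _) -[RHS]/(tens_add _ _).
by rewrite !(tens_addE, tens_mulE); apply/tens_eqP/tc_mulDr.
Qed.

(* 1 <> 0 holds because sending all the generators to 0 respects tcong. *)
Fixpoint tterm_aug (x : tterm) : R :=
  match x with
  | TScal a => a
  | TGen _ _ => 0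
  | TAdd x y => tterm_aug x + tterm_aug y
  | TMul x y => tterm_aug x * tterm_aug y
  end.

Lemma tterm_aug_cong x y : tcong x y -> tterm_aug x = tterm_aug y.
Proof.
elim=> //= {x y}; try by move=> *; congruence.
- by move=> *; rewrite addrA.
- by move=> *; rewrite addrC.
- by move=> *; rewrite add0r.
- by move=> *; rewrite mulN1r addNr.
- by move=> *; rewrite mulrA.
- by move=> *; rewrite mul1r.
- by move=> *; rewrite mulrDl.
- by move=> *; rewrite mulrDr.
- by move=> *; rewrite mulrC.
- by move=> *; rewrite mulr0 addr0.
Qed.

Lemma tens_1neq0 : tens_scal 1 != 0.
Proof.
apply/eqP => /tens_eqP /tterm_aug_cong /= /eqP; apply/negP.
exact: oner_neq0.
Qed.

HB.instance Definition _ := GRing.Zmodule_isNzRing.Build tens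
  tens_mulA tens_mul1 tens_mulr1 tens_mulDl tens_mulDr tens_1neq0.

Definition tens_scale a (u : tens) : tens := tens_mul (tens_scal a) u.

Lemma tens_scalM a b : tens_scal (a * b) = tens_scal a * tens_scal b.
Proof. by rewrite -[RHS]/(tens_mul _ _) tens_mulE; apply/tens_eqP/tc_scalM. Qed.

Lemma tens_scalD a b : tens_scal (a + b) = tens_scal a + tens_scal b.
Proof. by rewrite -[RHS]/(tens_add _ _) tens_addE; apply/tens_eqP/tc_scalD. Qed.

Fact tens_scaleA a b u : tens_scale a (tens_scale b u) = tens_scale (a * b) u.
Proof. by rewrite /tens_scale tens_scalM -tens_mulA. Qed.

Fact tens_scale1 : left_id 1 tens_scale.
Proof. exact: tens_mul1. Qed.

Fact tens_scaleDr : right_distributive tens_scale +%R.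
Proof. by move=> a u v; apply: tens_mulDr. Qed.

Fact tens_scaleDl u : {morph tens_scale^~ u : a b / a + b}.
Proof. by move=> a b /=; rewrite /tens_scale tens_scalD -tens_mulDl. Qed.

HB.instance Definition _ := GRing.Zmodule_isLmodule.Build R tens
  tens_scaleA tens_scale1 tens_scaleDr tens_scaleDl.

Fact tens_scaleAl a (u v : tens) : a *: (u * v) = a *: u * v.
Proof. exact: tens_mulA. Qed.

HB.instance Definition _ := GRing.Lmodule_isLalgebra.Build R tens tens_scaleAl.

Fact tens_scaleAr a (u v : tens) : a *: (u * v) = u * (a *: v).
Proof.
rewrite -[LHS]/(tens_mul (tens_scal a) (tens_mul u v)).
by rewrite tens_mulA tens_scalC -tens_mulA.
Qed.

HB.instance Definition _ :=
  GRing.Lalgebra_isAlgebra.Build R tens tens_scaleAr.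

Definition tens_gen n (v : V n) : tens := \pi_tens (TGen v).

Fact tens_gen_is_linear n : is_linear (@tens_gen n).
Proof.
by move=> a v w; rewrite /tens_gen ((tens_eqP _ _).2 (tc_gen a v w)) -tens_addE
  -tens_mulE.
Qed.

Section UniversalProperty.
Variables (A : algType R) (f : forall n, V n -> A).
Hypothesis f_linear : forall n, is_linear (@f n).

Fixpoint tterm_lift (x : tterm) : A :=
  match x with
  | TScal a => a%:A
  | TGen n v => f v
  | TAdd x y => tterm_lift x + tterm_lift y
  | TMul x y => tterm_lift x * tterm_lift y
  end.

Lemma tterm_lift_cong x y : tcong x y -> tterm_lift x = tterm_lift y.
Proof.
elim=> //= {x y}; try by move=> *; congruence.
- by move=> *; rewrite addrA.
- by move=> *; rewrite addrC.
- by move=> *; rewrite scale0r add0r.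
- by move=> *; rewrite scaleN1r mulN1r scale0r addNr.
- by move=> *; rewrite mulrA.
- by move=> *; rewrite scale1r mul1r.
- by move=> *; rewrite mulrDl.
- by move=> *; rewrite mulrDr.
- by move=> *; rewrite scalerDl.
- by move=> *; rewrite mulr_algl scalerA.
- by move=> *; rewrite mulr_algl mulr_algr.
- by move=> *; rewrite f_linear mulr_algl.
Qed.

Definition tens_lift (u : tens) : A := tterm_lift (repr u).

Lemma tens_lift_pi x : tens_lift (\pi_tens x) = tterm_lift x.
Proof. exact/tterm_lift_cong/tens_reprP. Qed.

Lemma tens_lift_linear : is_linear tens_lift.
Proof.
move=> a; elim/tensW=> x; elim/tensW=> y; rewrite -[_ *: _ + _]
  /(tens_add (tens_mul (tens_scal a) _) _) tens_mulE tens_addE.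
by rewrite !tens_lift_pi /= mulr_algl.
Qed.

Lemma tens_lift_monoid : monoid_morphism tens_lift.
Proof.
split; first by rewrite -[1]/(tens_scal 1) tens_lift_pi /= scale1r.
elim/tensW=> x; elim/tensW=> y; rewrite -[_ * _]/(tens_mul _ _) tens_mulE.
by rewrite !tens_lift_pi.
Qed.

Lemma tens_lift_gen n (v : V n) : tens_lift (tens_gen v) = f v.
Proof. exact: tens_lift_pi. Qed.

Lemma tens_lift_unique (g : tens -> A) :
    is_linear g -> monoid_morphism g ->
    (forall n (v : V n), g (tens_gen v) = f v) ->
  g =1 tens_lift.
Proof.
move=> gL [g1 gM] gV; elim/tensW=> x; rewrite tens_lift_pi.
have g0 := is_linear_0 gL.
elim: x => [a|n v|x IHx y IHy|x IHx y IHy] /=.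
- have -> : \pi_tens (TScal a) = a *: 1 + 0.
    by rewrite addr0 -[RHS]/(tens_mul _ _) tens_mulr1.
  by rewrite gL g1 g0 addr0.
- exact: gV.
- have -> : \pi_tens (TAdd x y) = 1 *: \pi_tens x + \pi_tens y.
    by rewrite scale1r -[RHS]/(tens_add _ _) tens_addE.
  by rewrite gL IHx IHy scale1r.
- have -> : \pi_tens (TMul x y) = \pi_tens x * \pi_tens y.
    by rewrite -[RHS]/(tens_mul _ _) tens_mulE.
  by rewrite gM IHx IHy.
Qed.

End UniversalProperty.

(* The grading of T(V): the least family of submodules which contains the
   scalars in degree 0 and V n in degree n and which is multiplicative. *)
Inductive homog : nat -> tens -> Prop :=
| homog_scal a : homog 0 a%:A
| homog_gen n (v : V n) : homog n (tens_gen v)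
| homog_add n x y : homog n x -> homog n y -> homog n (x + y)
| homog_mul m n x y : homog m x -> homog n y -> homog (m + n) (x * y).

Fact homog0 n : homog n 0.
Proof.
by rewrite -(is_linear_0 (tens_gen_is_linear (n := n))); apply: homog_gen.
Qed.

Fact homogP n a x y : homog n x -> homog n y -> homog n (a *: x + y).
Proof.
move=> hx hy; apply: homog_add => //; rewrite -mulr_algl.
exact: (homog_mul (homog_scal a)).
Qed.

Definition tens_deg n := Submodule (homog0 n) (@homogP n).

(* The augmentation ideal A+ (positive degrees) and the submodule A+ . A+ of
   decomposables; A+ / A+ . A+ is the module of indecomposables. *)
Definition tens_pos := submodule_span (fun x => exists n, homog n.+1 x).

Definition tens_decomp :=
  submodule_span (fun z => exists x y, [/\ tens_pos x, tens_pos y & z = x * y]).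

Definition graded_alg_morph (f : tens -> tens) : Prop :=
  [/\ is_linear f, monoid_morphism f & forall n x, homog n x -> homog n (f x)].

Fact graded_alg_morph_id : graded_alg_morph id.
Proof. by split. Qed.

Fact graded_alg_morph_comp f g :
  graded_alg_morph f -> graded_alg_morph g -> graded_alg_morph (f \o g).
Proof.
move=> [fL [f1 fM] fH] [gL [g1 gM] gH]; split.
- exact: is_linear_comp.
- by split=> [|x y] /=; rewrite ?g1 ?gM.
- by move=> n x /gH /fH.
Qed.

(* For the trivial differential these are also the automorphisms of T(V) as a
   differential graded algebra. *)
Definition tens_aut : groupType :=
  aut (MapClass graded_alg_morph_id graded_alg_morph_comp).

(* f induces the identity on the indecomposables A+ / A+ . A+. *)
Definition graded_alg_morph_star (f : tens -> tens) : Prop :=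
  graded_alg_morph f /\ forall x, tens_pos x -> tens_decomp (f x - x).

Fact graded_alg_morph_star_id : graded_alg_morph_star id.
Proof.
split; first exact: graded_alg_morph_id.
by move=> x _; rewrite subrr; apply: submodule0.
Qed.

Fact graded_alg_morph_star_comp f g :
  graded_alg_morph_star f -> graded_alg_morph_star g ->
  graded_alg_morph_star (f \o g).
Proof.
move=> [fG fQ] [gG gQ]; split; first exact: graded_alg_morph_comp.
move=> x px /=; rewrite -[_ - x](subrKA (g x)) -[_ - g x]scale1r.
apply: in_spanP; last exact: gQ.
apply: fQ; case: gG => gL _ gH.
have g0 := is_linear_0 gL.
elim: px => [|a y z [n hy] _ IH]; first by rewrite g0; apply: in_span0.
by rewrite gL; apply: in_spanD IH; exists n; apply: gH.
Qed.

Definition tens_aut_star : groupType :=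
  aut (MapClass graded_alg_morph_star_id graded_alg_morph_star_comp).

End TensorAlgebra.

(* The graded module V_{<q}; the subalgebra of T(V) generated by the V n with
   n < q is T(V_{<q}). *)
Definition below (R : comNzRingType) (V : nat -> lmodType R) (q : nat) :
    nat -> lmodType R :=
  fun n => if (n < q)%N then V n else 'rV[R]_0.

Section Simplices.
Variable RR : realType.

Definition std_simplex (n : nat) : set 'rV[RR]_n.+1 :=
  [set x | (forall i, 0 <= x ord0 i) /\ \sum_i x ord0 i = 1].
Arguments std_simplex : clear implicits.

Definition coface_row n (i : 'I_n.+2) (x : 'rV[RR]_n.+1) : 'rV[RR]_n.+2 :=
  \row_j oapp (x ord0) 0 (unlift i j).

Fact coface_row_in n (i : 'I_n.+2) (x : std_simplex n) :
  std_simplex n.+1 (coface_row i (set_val x)).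
Proof.
have [x0 x1] : std_simplex n (set_val x) by exact: set_valP.
split=> [j|].
  by rewrite mxE; case: unliftP => [k _|_] //=.
rewrite (bigD1_ord i) //= mxE unlift_none add0r -x1.
by apply: eq_bigr => k _; rewrite mxE liftK.
Qed.

Definition coface_fun n (i : 'I_n.+2) (x : std_simplex n) :
    std_simplex n.+1 :=
  SigSub (mem_set (coface_row_in i x)).

Fact coface_row_continuous n (i : 'I_n.+2) : continuous (@coface_row n i).
Proof.
move=> x U [P /= PU sPU].
exists (fun _ j => P ord0 (lift i j)) => [k j|y yP] /=.
  by rewrite ord1; have := PU ord0 (lift i j); rewrite mxE liftK.
apply: sPU => k j; rewrite ord1 !mxE.
case: unliftP => [l ->|->] /=; first exact: yP.
by have := nbhs_singleton (PU ord0 i); rewrite mxE unlift_none.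
Qed.

Fact coface_continuous n (i : 'I_n.+2) : continuous (@coface_fun n i).
Proof.
apply: continuous_comp_initial => x.
apply: (@continuous_comp _ _ _ set_val (@coface_row n i)).
  exact: initial_continuous.
exact: coface_row_continuous.
Qed.

Definition coface n (i : 'I_n.+2) :
    continuousType (std_simplex n) (std_simplex n.+1) :=
  mkcts (@coface_continuous n i).

End Simplices.
Arguments std_simplex RR n : clear implicits.

Section LinearExtension.
Variables (R : nzRingType) (B : choiceType) (M : lmodType R) (f : B -> M).

Definition malg_lift (c : {malg R[B]}) : M := \sum_(b <- msupp c) c@_b *: f b.

Fact malg_lift_is_linear a c d :
  malg_lift (a *: c + d) = a *: malg_lift c + malg_lift d.
Proof.
have wide (S : {fset B}) e : (msupp e `<=` S)%fset ->
    malg_lift e = \sum_(b <- S) e@_b *: f b.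
  move=> eS; rewrite /malg_lift (big_fset_incl _ eS) //= => b _ /mcoeff_outdom ->.
  by rewrite scale0r.
pose S := (msupp c `|` msupp d `|` msupp (a *: c + d))%fset.
rewrite !(wide S) ?scaler_sumr -?big_split.
- by apply: eq_bigr => b _ /=; rewrite mcoeffD mcoeffZ scalerDl scalerA.
- by rewrite /S -fsetUA fsubsetU // fsubsetUl orbT.
- by rewrite /S -fsetUA fsubsetUl.
- by rewrite fsubsetUr.
Qed.

End LinearExtension.

Section Homology.
Variables (RR : realType) (R : comNzRingType) (X : topologicalType).

Definition sing_simplex n : choiceType := continuousType (std_simplex RR n) X.

Definition chains n : lmodType R := {malg R[sing_simplex n]}.

Definition face n (i : 'I_n.+2) (s : sing_simplex n.+1) : sing_simplex n :=
  s \o coface RR i.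

Definition boundary n : chains n.+1 -> chains n :=
  malg_lift (fun s => \sum_(i < n.+2) (-1) ^+ i *: << face i s >>).

(* Degree 0 of the augmented chain complex; this makes the homology reduced. *)
Definition augmentation : chains 0 -> R^o := malg_lift (fun => 1).

Definition is_cycle n : chains n -> Prop :=
  match n with
  | 0 => fun c => augmentation c = 0
  | m.+1 => fun c => boundary c = 0
  end.

Fact is_cycle0 n : is_cycle (0 : chains n).
Proof. by case: n => [|n]; apply: is_linear_0; apply: malg_lift_is_linear. Qed.

Fact is_cycleP n a (c d : chains n) :
  is_cycle c -> is_cycle d -> is_cycle (a *: c + d).
Proof.
by case: n c d => [|n] c d /= c0 d0;
  rewrite [LHS]malg_lift_is_linear [malg_lift _ c]c0 [malg_lift _ d]d0
    scaler0 addr0.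
Qed.

Definition cycles n : lmodType R :=
  submod_of (Submodule (@is_cycle0 n) (@is_cycleP n)).

Definition is_boundary n (z : cycles n) : Prop :=
  exists c, boundary c = submod_val z.

Fact is_boundary0 n : is_boundary (0 : cycles n).
Proof. by exists 0; apply: is_linear_0; apply: malg_lift_is_linear. Qed.

Fact is_boundaryP n a (y z : cycles n) :
  is_boundary y -> is_boundary z -> is_boundary (a *: y + z).
Proof.
move=> [c cy] [d dz]; exists (a *: c + d).
by rewrite [LHS]malg_lift_is_linear [malg_lift _ c]cy [malg_lift _ d]dz.
Qed.

Definition reduced_homology n : lmodType R :=
  quot_of (Submodule (@is_boundary0 n) (@is_boundaryP n)).

End Homology.

Section Spaces.
Variable RR : realType.

Definition simply_connected (X : topologicalType) : Prop :=
  [/\ exists x : X, True,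
      forall x y : X, exists f : RR -> X,
        [/\ {within `[0, 1], continuous f}, f 0 = x & f 1 = y] &
      forall f : RR -> X, {within `[0, 1], continuous f} -> f 0 = f 1 ->
        exists h : RR * RR -> X,
          [/\ {within `[0, 1] `*` `[0, 1], continuous h},
              {in `[0, 1], forall s, h (s, 0) = f s /\ h (s, 1) = f 0} &
              {in `[0, 1], forall t, h (0, t) = f 0 /\ h (1, t) = f 0}]].

Definition disk (n : nat) : set 'rV[RR]_n :=
  [set x | \sum_i x ord0 i ^+ 2 <= 1].
Arguments disk : clear implicits.

Definition disk_interior n (x : disk n) : Prop :=
  \sum_i (set_val x) ord0 i ^+ 2 < 1.

Record cw_structure (X : topologicalType) := CWStructure {
  cw_hausdorff : hausdorff_space X;
  cw_cell : nat -> Type;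
  cw_char : forall n, cw_cell n -> disk n -> X;
  cw_char_continuous : forall n (e : cw_cell n), continuous (cw_char e);
  (* X is the disjoint union of the open cells, each of which is the injective
     image of the interior of a disk. *)
  cw_cover : forall x : X,
    exists n (e : cw_cell n) (u : disk n), disk_interior u /\ cw_char e u = x;
  cw_disjoint : forall m n (e : cw_cell m) (f : cw_cell n)
      (u : disk m) (v : disk n),
    disk_interior u -> disk_interior v -> cw_char e u = cw_char f v ->
    existT (fun k => cw_cell k * disk k)%type m (e, u) = existT _ n (f, v);
  cw_closure_finite : forall n (e : cw_cell n),
    exists k (c : 'I_k -> {m : nat & cw_cell m}),
      forall u : disk n, ~ disk_interior u ->
      exists j (v : disk (tag (c j))),
        [/\ (tag (c j) < n)%N, disk_interior v &
            cw_char e u = cw_char (tagged (c j)) v];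
  cw_weak : forall A : set X,
    (forall n (e : cw_cell n), closed (cw_char e @^-1` A)) -> closed A }.

Definition cw_complex (X : topologicalType) : Prop := inhabited (cw_structure X).

(* All the CW structures of a space have the same dimension. *)
Definition has_dimension (X : topologicalType) (d : nat) : Prop :=
  exists K : cw_structure X,
    (forall n, cw_cell K n -> (n <= d)%N) /\ inhabited (cw_cell K d).

Section Suspension.
Variable X : topologicalType.

Definition cylinder : topologicalType := (X * `[0 : RR, 1]%classic)%type.

Definition susp_rel (a b : cylinder) : bool :=
  [|| a == b, (set_val a.2 == 0) && (set_val b.2 == 0)
    | (set_val a.2 == 1) && (set_val b.2 == 1)].

Fact susp_rel_refl : reflexive susp_rel.
Proof. by move=> a; rewrite /susp_rel eqxx. Qed.

Fact susp_rel_sym : symmetric susp_rel.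
Proof.
by move=> a b; rewrite /susp_rel eq_sym; congr [|| _, _ | _]; rewrite andbC.
Qed.

Fact susp_rel_trans : transitive susp_rel.
Proof.
move=> b a c /or3P[/eqP->//|/andP[a0 b0]|/andP[a1 b1]].
- case/or3P=> [/eqP<-|/andP[_ c0]|/andP[b1 _]].
  + by rewrite /susp_rel a0 b0 orbT.
  + by rewrite /susp_rel a0 c0 orbT.
  + by move: b1; rewrite (eqP b0) eq_sym oner_eq0.
- case/or3P=> [/eqP<-|/andP[b0 _]|/andP[_ c1]].
  + by rewrite /susp_rel a1 b1 !orbT.
  + by move: b1; rewrite (eqP b0) eq_sym oner_eq0.
  + by rewrite /susp_rel a1 c1 !orbT.
Qed.

Canonical susp_equiv :=
  EquivRel susp_rel susp_rel_refl susp_rel_sym susp_rel_trans.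

(* The unreduced suspension, which needs no base point; for a CW complex it is
   homotopy equivalent to the reduced one. *)
Definition suspension : topologicalType :=
  quotient_topology {eq_quot susp_equiv}.

End Suspension.

End Spaces.

(* Main.v *)
Require Import Defs.
From HB Require Import structures.
From mathcomp Require Import all_boot all_order all_algebra generic_quotient.
From mathcomp Require Import finmap monalg.
From mathcomp Require Import all_classical reals topology normedtype sequences realfun.
From mathcomp Require Import ring lra.

Set Implicit Arguments.
Unset Strict Implicit.
Unset Printing Implicit Defensive.

Import Order.TTheory GRing.Theory Num.Theory.
Import numFieldTopology.Exports.
Import numFieldNormedType.Exports.

Local Open Scope classical_set_scope.
Local Open Scope ring_scope.

(** The theorem has an algebraic and a topological half.

The algebra is elementary linear algebra of graded endomorphisms. Let [V] be
concentrated in the degrees 1, ..., q. For degree reasons, an element of degree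
[q] of T(V) is the sum of a generator of degree [q] and of an element of
T(V_{<q}) ([homog_split]). A graded algebra endomorphism of T(V) therefore
preserves T(V_{<q}) and is a block triangular matrix: it is determined by its
restriction to T(V_{<q}), by a linear endomorphism of [V q], and by a linear map
from [V q] to the degree [q] part of T(V_{<q}); conversely any such triple comes
from an endomorphism ([endo_ext], [assemble]). The diagonal entries form the
quotient group and the unipotent matrices, called shears, the kernel
([aut_short_exact]). Acting trivially on the indecomposables forces the entry on
[V q] to be the identity, and holds for every shear
([aut_star_short_exact]).

The topology has to show that [V], the reduced singular homology of [Y], is as
described: it vanishes in degree 0 because [Y] is path connected
([homology0_connected]); its degree [q] part is the top homology of the
suspension ([suspension_iso]); and it vanishes above [q], because by the same
isomorphism this is the homology of the suspension above its dimension, which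
vanishes for any CW complex ([homology_above_dimension]).

Both facts on homology are proved on the level of chains, without relative
homology or long exact sequences. The two tools are the prism operator of a
homotopy and barycentric subdivision, which makes a chain subordinate to an open
cover ([small_chains]). All operators are first defined on formal affine
simplices, that is on sequences of vertices, where everything is built from the
cone operator, and are then transported to singular simplices by naturality. A
simplex is indexed by its number of vertices, so that the empty simplex provides
the augmentation and reduced homology needs no special case.

The suspension is covered by the two open cones, which contract to the poles,
and whose intersection retracts to the middle copy of [Y]. A cycle of the
suspension thus splits into two chains with a common boundary in [Y], and
[susp_class] relates the cycle to that boundary.

For the vanishing theorem ([skel_bounds]), a cycle of the [k]-skeleton is
subdivided until each simplex either avoids the middle third of all [k]-cells or
lies inside one open [k]-cell. The part inside a cell has its boundary in an
annulus; in the degrees at hand this boundary also bounds in the annulus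
([punctured_bounds], itself an induction with Mayer-Vietoris), so that this part
can be replaced by a chain in the annulus. What remains is pushed by radial
expansion into the lower skeleton. *)

(** * Free modules *)

Section FreeModule.
Variable R : nzRingType.

(** Free modules are kept abstract: only the universal property [linext] and the
    supports are used, and unfolding them would only slow unification down. *)
Definition fm (B : choiceType) : lmodType R := {malg R[B]}.

Section Basis.
Variable B : choiceType.

Definition bas (b : B) : fm B := mkmalgU b 1.
Definition fcoef (c : fm B) (b : B) : R := mcoeff b (c : {malg R[B]}).

Section Lift.
Variables (M : lmodType R) (f : B -> M).
Definition linext_fun : fm B -> M := malg_lift f.
HB.instance Definition _ :=
  GRing.isLinear.Build R (fm B) M *:%R linext_fun (malg_lift_is_linear f).
Definition linext : {linear fm B -> M} := linext_fun.
End Lift.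

Lemma fcoef0 b : fcoef 0 b = 0. Proof. exact: mcoeff0. Qed.
Lemma fcoefD c d b : fcoef (c + d) b = fcoef c b + fcoef d b.
Proof. exact: mcoeffD. Qed.
Lemma fcoefN c b : fcoef (- c) b = - fcoef c b. Proof. exact: mcoeffN. Qed.
Lemma fcoefZ a c b : fcoef (a *: c) b = a * fcoef c b. Proof. exact: mcoeffZ. Qed.
Lemma fcoef_bas b b' : fcoef (bas b) b' = (b == b')%:R.
Proof. exact: mcoeffU. Qed.
Lemma fcoefP c d : (forall b, fcoef c b = fcoef d b) -> c = d.
Proof. by move=> h; apply/malgP. Qed.

Definition supp (c : fm B) : seq B := msupp (c : {malg R[B]}).

Lemma suppE c b : (b \in supp c) = (fcoef c b != 0).
Proof. by rewrite /fcoef mcoeff_neq0. Qed.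

Lemma supp_uniq c : uniq (supp c). Proof. exact: fset_uniq. Qed.

Lemma fm_expand c : c = \sum_(b <- supp c) fcoef c b *: bas b.
Proof.
rewrite [LHS](monalgE (c : {malg R[B]})) [LHS]/=; apply: eq_bigr => b _.
by apply/fcoefP => b'; rewrite fcoefZ fcoef_bas /fcoef mcoeffU mulrnAr mulr1.
Qed.

Lemma linext_bas (M : lmodType R) (f : B -> M) b : linext f (bas b) = f b.
Proof.
rewrite /= /linext_fun /malg_lift /bas msuppU oner_eq0 big_seq_fset1.
by rewrite mcoeffUU scale1r.
Qed.

Lemma linextE (M : lmodType R) (f : B -> M) c : linext f c = \sum_(b <- supp c) fcoef c b *: f b.
Proof. by []. Qed.

End Basis.
End FreeModule.

Arguments bas {R B} b : simpl never.
Arguments linext {R B M} f : simpl never.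
Arguments fcoef {R B} c b : simpl never.
Arguments supp {R B} c : simpl never.
Global Opaque fm bas fcoef linext supp.

Section Supports.
Variables (R : nzRingType) (B : choiceType).
Implicit Types c d : fm R B.

(** Supports are tracked by predicates on the basis, so that a chain in a
    subspace stays a chain of the ambient space. *)
Definition on (P : B -> Prop) c := forall b, b \in supp c -> P b.

Lemma on0 P : on P 0. Proof. by move=> b; rewrite suppE fcoef0 eqxx. Qed.

Lemma onD P c d : on P c -> on P d -> on P (c + d).
Proof.
move=> Pc Pd b; rewrite suppE fcoefD.
have [-> h|nc _] := eqVneq (fcoef c b) 0; last by apply: Pc; rewrite suppE.
by apply: Pd; rewrite suppE; rewrite add0r in h.
Qed.

Lemma onN P c : on P c -> on P (- c).
Proof. by move=> Pc b; rewrite suppE fcoefN oppr_eq0 -suppE; apply: Pc. Qed.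

Lemma onB P c d : on P c -> on P d -> on P (c - d).
Proof. by move=> Pc Pd; exact: onD Pc (onN Pd). Qed.

Lemma onZ P a c : on P c -> on P (a *: c).
Proof.
move=> Pc b; rewrite suppE fcoefZ => h; apply: Pc.
by rewrite suppE; apply: contraTneq h => ->; rewrite mulr0 eqxx.
Qed.

Lemma on_bas (P : B -> Prop) b : P b -> on P (bas b).
Proof. by move=> Pb b'; rewrite suppE fcoef_bas; case: (eqVneq b b') => [<-|_] //; rewrite eqxx. Qed.

Lemma on_sum P I (r : seq I) (Q : pred I) (F : I -> fm R B) :
  (forall i, Q i -> on P (F i)) -> on P (\sum_(i <- r | Q i) F i).
Proof. by move=> PF; elim/big_ind: _ => //; [apply: on0|apply: onD]. Qed.

Lemma sub_on (P Q : B -> Prop) c : (forall b, P b -> Q b) -> on P c -> on Q c.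
Proof. by move=> PQ Pc b /Pc /PQ. Qed.

Lemma on_and (P Q : B -> Prop) c : on P c -> on Q c -> on (fun b => P b /\ Q b) c.
Proof. by move=> Pc Qc b bc; split; [apply: Pc|apply: Qc]. Qed.

Lemma on_False c : on (fun _ => False) c -> c = 0.
Proof.
move=> h; apply/fcoefP => b; rewrite fcoef0.
by have [//|nc] := eqVneq (fcoef c b) 0; case: (h b); rewrite suppE.
Qed.

(** Chain identities that need a hypothesis on the simplices, such as the
    continuity of a map along them, are proved on the basis and extended by this. *)
Lemma eq_on (M : lmodType R) (f g : {linear fm R B -> M}) P c :
  (forall b, P b -> f (bas b) = g (bas b)) -> on P c -> f c = g c.
Proof.
move=> fg Pc; rewrite [c]fm_expand !linear_sum !big_seq.
by apply: eq_bigr => b /Pc Pb; rewrite !linearZ /= fg.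
Qed.

Lemma fm_ext (M : lmodType R) (f g : {linear fm R B -> M}) :
  (forall b, f (bas b) = g (bas b)) -> f =1 g.
Proof. by move=> fg c; apply: (@eq_on _ f g (fun _ => True)) => // b _. Qed.

Definition restr (P : B -> Prop) : {linear fm R B -> fm R B} :=
  linext (fun b => if `[< P b >] then bas b else 0).

Lemma on_restr P c : on P (restr P c).
Proof.
rewrite /restr linextE; apply: on_sum => b _; apply: onZ.
by case: asboolP => [Pb|_]; [exact: on_bas|exact: on0].
Qed.

Lemma fcoef_restr P c b : fcoef (restr P c) b = if `[< P b >] then fcoef c b else 0.
Proof.
have fcoef_sum (r : seq B) (F : B -> fm R B) :
    fcoef (\sum_(i <- r) F i) b = \sum_(i <- r) fcoef (F i) b.
  by elim: r => [|i r IH]; rewrite ?big_nil ?fcoef0 // !big_cons fcoefD IH.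
rewrite [in RHS](fm_expand c) /restr linextE !fcoef_sum.
case: asboolP => Pb; last first.
  rewrite big1 // => b' _; rewrite fcoefZ; case: asboolP => [Pb'|_]; last first.
    by rewrite fcoef0 mulr0.
  by rewrite fcoef_bas; case: eqVneq => [e|]; [case: Pb; rewrite -e|rewrite mulr0].
apply: eq_bigr => b' _; rewrite !fcoefZ; case: asboolP => // nP.
by rewrite fcoef0 fcoef_bas; case: eqVneq => // e; case: nP; rewrite e.
Qed.

End Supports.

Lemma on_linext (R : nzRingType) (B B' : choiceType) (f : B -> fm R B') P Q
    (c : fm R B) :
  on P c -> (forall b, P b -> on Q (f b)) -> on Q (linext f c).
Proof.
move=> Pc PQ; rewrite linextE big_seq.
by apply: on_sum => b /Pc /PQ; apply: onZ.
Qed.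

(** * Formal affine simplices *)

(** An affine simplex is encoded by the sequence of its vertices. The operators
    are locked because unfolding them would expose the free module. *)

HB.lock Definition cone (R : nzRingType) (D : choiceType) (x : D) :
  {linear fm R (seq D) -> fm R (seq D)} := linext (fun s => bas (x :: s)).

(** The faces through the first vertex are the cones over the faces of the opposite
    face; hence the recursion. *)
Fixpoint dseq_rec (R : nzRingType) (D : choiceType) (s : seq D) : fm R (seq D) :=
  if s is x :: s' then bas s' - cone R x (dseq_rec R s') else 0.
HB.lock Definition dseq (R : nzRingType) (D : choiceType) (s : seq D) := dseq_rec R s.
HB.lock Definition dform (R : nzRingType) (D : choiceType) :
  {linear fm R (seq D) -> fm R (seq D)} := linext (dseq R (D:=D)).

Section Formal.
Variables (R : nzRingType) (D : choiceType).
Implicit Types (s : seq D) (c : fm R (seq D)).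
Local Notation cone := (@cone R D).
Local Notation dseq := (@dseq R D).
Local Notation dform := (@dform R D).

Lemma coneU x s : cone x (bas s) = bas (x :: s).
Proof. by rewrite unlock linext_bas. Qed.

Lemma dseq_nil : dseq [::] = 0.
Proof. by rewrite unlock. Qed.

Lemma dseq_cons x s : dseq (x :: s) = bas s - cone x (dseq s).
Proof. by rewrite !dseq.unlock. Qed.

Lemma dformU s : dform (bas s) = dseq s.
Proof. by rewrite unlock linext_bas. Qed.

(** Coning is a contracting homotopy. Each operator below is defined by coning
    off the boundary that it ought to have, so that its boundary formula reduces,
    through this identity, to the formula one dimension below. *)
Lemma dform_cone x c : dform (cone x c) = c - cone x (dform c).
Proof.
apply: (fm_ext (f := dform \o cone x) (g := idfun \- (cone x \o dform))) => s.
by rewrite /= coneU !dformU dseq_cons.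
Qed.

Lemma dform_dseq s : dform (dseq s) = 0.
Proof.
elim: s => [|x s IH]; first by rewrite dseq_nil linear0.
by rewrite dseq_cons linearB /= dformU dform_cone IH linear0 subr0 subrr.
Qed.

Lemma dform_dform c : dform (dform c) = 0.
Proof.
apply: (fm_ext (f := dform \o dform) (g := \0)) => s /=.
by rewrite dformU dform_dseq.
Qed.

Lemma on_cone (P Q : seq D -> Prop) x c :
  on P c -> (forall s, P s -> Q (x :: s)) -> on Q (cone x c).
Proof.
by move=> Pc PQ; rewrite unlock; apply: on_linext Pc _ => s /PQ; apply: on_bas.
Qed.

Lemma on_dseq s : on (fun t => (size t).+1 = size s /\ {subset t <= s}) (dseq s).
Proof.
elim: s => [|x s IH]; first by rewrite dseq_nil; exact: on0.
rewrite dseq_cons.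
apply: onB; first by apply: on_bas; split=> // y ys; rewrite inE ys orbT.
apply: on_cone IH _ => t [/= <- ts]; split=> // y; rewrite !inE.
by case/orP=> [->//|/ts ->]; rewrite orbT.
Qed.

End Formal.

HB.lock Definition mapf (R : nzRingType) (D E : choiceType) (f : D -> E) :
  {linear fm R (seq D) -> fm R (seq E)} := linext (fun s => bas (map f s)).

Section FormalMap.
Variables (R : nzRingType) (D E : choiceType) (f : D -> E).
Local Notation mapf := (@mapf R D E f).

Lemma mapfU s : mapf (bas s) = bas (map f s).
Proof. by rewrite unlock linext_bas. Qed.

Lemma mapf_cone x c : mapf (cone R x c) = cone R (f x) (mapf c).
Proof.
apply: (fm_ext (f := mapf \o cone R x) (g := cone R (f x) \o mapf)) => s.
by rewrite /= coneU !mapfU coneU.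
Qed.

Lemma mapf_dseq s : mapf (dseq R s) = dseq R (map f s).
Proof.
elim: s => [|x s IH]; first by rewrite !dseq_nil linear0.
by rewrite /= !dseq_cons linearB /= mapfU mapf_cone IH.
Qed.

End FormalMap.

(** Reconciles the recursive boundary with the one of singular simplices. *)
Lemma dseq_sum (R : nzRingType) (D : choiceType) n (p : 'I_n.+1 -> D) :
  dseq R (map p (enum 'I_n.+1)) =
  \sum_(i < n.+1) (-1) ^+ i *: bas (map (p \o lift i) (enum 'I_n)).
Proof.
elim: n p => [|n IH] p.
  rewrite enum_ordSl /= big_ord1 expr0 scale1r.
  have -> : enum 'I_0 = [::] by apply: size0nil; rewrite size_enum_ord.
  by rewrite /= dseq_cons dseq_nil linear0 subr0.
rewrite enum_ordSl [LHS]/= dseq_cons -map_comp IH [RHS]big_ord_recl expr0 scale1r.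
congr (_ + _); rewrite [cone R _ _]linear_sum -sumrN; apply: eq_bigr => i _ /=.
rewrite linearZ /= coneU -scaleNr exprS mulN1r; congr (_ *: bas _).
rewrite [in RHS]enum_ordSl /= -map_comp.
congr cons; first by congr p; apply: ord_inj; rewrite /= /bump /=.
by apply: eq_map => j /=; congr p; apply: ord_inj; rewrite /= /bump !add1n ltnS !addnS.
Qed.

(** ** Barycentric subdivision *)

(** The subdivision of a simplex is the cone, from its barycentre, over the
    subdivision of its boundary. The recursion is on the dimension [n], since it
    passes through a linear extension and is not structural. *)
Fixpoint sd_rec (R : nzRingType) (D : choiceType) (bary : D -> seq D -> D)
    n (s : seq D) : fm R (seq D) :=
  if s is x :: s' then
    if n is n'.+1 then
      cone R (bary x s') (linext (sd_rec R bary n') (dseq R s)) else 0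
  else bas [::].
HB.lock Definition sd_seq (R : nzRingType) (D : choiceType)
  (bary : D -> seq D -> D) (s : seq D) := sd_rec R bary (size s) s.
HB.lock Definition sd_form (R : nzRingType) (D : choiceType)
  (bary : D -> seq D -> D) : {linear fm R (seq D) -> fm R (seq D)} :=
  linext (sd_seq R bary).

(** The chain homotopy between subdivision and the identity. *)
Fixpoint th_rec (R : nzRingType) (D : choiceType) (bary : D -> seq D -> D)
    n (s : seq D) : fm R (seq D) :=
  if s is x :: s' then
    if n is n'.+1 then
      cone R (bary x s') (bas s - linext (th_rec R bary n') (dseq R s)) else 0
  else 0.
HB.lock Definition th_seq (R : nzRingType) (D : choiceType)
  (bary : D -> seq D -> D) (s : seq D) := th_rec R bary (size s) s.
HB.lock Definition th_form (R : nzRingType) (D : choiceType)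
  (bary : D -> seq D -> D) : {linear fm R (seq D) -> fm R (seq D)} :=
  linext (th_seq R bary).

Section Subdivision.
Variables (R : nzRingType) (D : choiceType) (bary : D -> seq D -> D).
Local Notation A := (fm R (seq D)).
Local Notation dform := (@dform R D).
Local Notation dseq := (@dseq R D).
Local Notation sd_seq := (@sd_seq R D bary).
Local Notation sd_form := (@sd_form R D bary).
Local Notation th_seq := (@th_seq R D bary).
Local Notation th_form := (@th_form R D bary).

Lemma sd_formU s : sd_form (bas s) = sd_seq s.
Proof. by rewrite unlock linext_bas. Qed.

Lemma sd_nil : sd_seq [::] = bas [::].
Proof. by rewrite unlock. Qed.

Lemma sd_cons x s : sd_seq (x :: s) = cone R (bary x s) (sd_form (dseq (x :: s))).
Proof.
rewrite sd_seq.unlock /=; congr (cone R _ _).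
apply: (eq_on (f := linext (sd_rec R bary (size s))) (g := sd_form) _ (@on_dseq R D (x :: s))).
by move=> t [[/= <-] _]; rewrite sd_formU linext_bas unlock.
Qed.

(** Induction along the recursion shared by the operators below: a simplex may
    be assumed to have the property on all its faces. *)
Lemma face_ind (K : seq D -> Prop) :
  K [::] -> (forall x s, on K (dseq (x :: s)) -> K (x :: s)) -> forall s, K s.
Proof.
move=> K0 KS s; have [n] := ubnP (size s).
elim: n s => // n IH [|x s] // /ltnSE hs; apply: KS => t /on_dseq[[ht] _].
by apply: IH; rewrite ht.
Qed.

Lemma on_sd_size s : on (fun t => size t = size s) (sd_seq s).
Proof.
elim/face_ind: s => [|x s IH]; first by rewrite sd_nil; apply: on_bas.
rewrite sd_cons; apply: (@on_cone _ _ (fun t => size t = size s)); last by move=> t /= ->.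
rewrite sd_form.unlock; apply: on_linext (on_and (@on_dseq R D (x :: s)) IH) _.
by move=> u [[[us] _] h]; rewrite -us.
Qed.

Lemma dform_sd c : dform (sd_form c) = sd_form (dform c).
Proof.
apply: (fm_ext (f := dform \o sd_form) (g := sd_form \o dform)).
apply: face_ind => [|x s IH].
  by rewrite /= sd_formU sd_nil !dformU dseq_nil linear0.
have e : dform (sd_form (dseq (x :: s))) = sd_form (dform (dseq (x :: s))).
  exact: (eq_on (f := dform \o sd_form) (g := sd_form \o dform) _ IH).
rewrite /= sd_formU sd_cons dform_cone dformU e.
by rewrite dform_dseq !linear0 addr0.
Qed.

Lemma th_formU s : th_form (bas s) = th_seq s.
Proof. by rewrite unlock linext_bas. Qed.

Lemma th_nil : th_seq [::] = 0.
Proof. by rewrite unlock. Qed.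

Lemma th_cons x s :
  th_seq (x :: s) = cone R (bary x s) (bas (x :: s) - th_form (dseq (x :: s))).
Proof.
rewrite th_seq.unlock /=; congr (cone R _ (_ - _)).
apply: (eq_on (f := linext (th_rec R bary (size s))) (g := th_form) _ (@on_dseq R D (x :: s))).
by move=> t [[/= <-] _]; rewrite th_formU linext_bas unlock.
Qed.

Lemma dform_th c : dform (th_form c) = c - sd_form c - th_form (dform c).
Proof.
apply: (fm_ext (f := dform \o th_form)
  (g := idfun \- sd_form \- (th_form \o dform))).
apply: face_ind => [|x s IH].
  by rewrite /= sd_formU th_formU dformU dseq_nil sd_nil th_nil !linear0 subrr addr0.
have e : dform (th_form (dseq (x :: s))) = dseq (x :: s) -
    sd_form (dseq (x :: s)) - th_form (dform (dseq (x :: s))).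
  exact: (eq_on (f := dform \o th_form)
    (g := idfun \- sd_form \- (th_form \o dform)) _ IH).
rewrite /= sd_formU th_formU sd_cons th_cons dform_cone linearB dformU e.
by rewrite dform_dseq linear0 subr0 subKr addrAC.
Qed.

End Subdivision.

Section SubdivisionMap.
Variables (R : nzRingType) (D E : choiceType).
Variables (baryD : D -> seq D -> D) (baryE : E -> seq E -> E) (f : D -> E).
Hypothesis f_bary : forall x s, f (baryD x s) = baryE (f x) (map f s).

Lemma mapf_sd c : mapf R f (sd_form R baryD c) = sd_form R baryE (mapf R f c).
Proof.
apply: (fm_ext (f := mapf R f \o sd_form R baryD) (g := sd_form R baryE \o mapf R f)).
apply: (@face_ind R) => [|x s IH].
  by rewrite /= mapfU !sd_formU !sd_nil mapfU.
have e : mapf R f (sd_form R baryD (dseq R (x :: s))) =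
    sd_form R baryE (mapf R f (dseq R (x :: s))).
  exact: (eq_on (f := mapf R f \o sd_form R baryD)
    (g := sd_form R baryE \o mapf R f) _ IH).
by rewrite /= mapfU !sd_formU !sd_cons mapf_cone f_bary e mapf_dseq.
Qed.

Lemma mapf_th c : mapf R f (th_form R baryD c) = th_form R baryE (mapf R f c).
Proof.
apply: (fm_ext (f := mapf R f \o th_form R baryD) (g := th_form R baryE \o mapf R f)).
apply: (@face_ind R) => [|x s IH].
  by rewrite /= mapfU !th_formU !th_nil linear0.
have e : mapf R f (th_form R baryD (dseq R (x :: s))) =
    th_form R baryE (mapf R f (dseq R (x :: s))).
  exact: (eq_on (f := mapf R f \o th_form R baryD)
    (g := th_form R baryE \o mapf R f) _ IH).
by rewrite /= mapfU !th_formU !th_cons mapf_cone f_bary linearB mapfU e mapf_dseq.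
Qed.

End SubdivisionMap.

(** ** The prism operator *)

(** The triangulated prism over [x :: s]: the join of the bottom vertex [(x, a)]
    with the whole top face, and the cone from that vertex over the prism of the
    face opposite to [x]. *)
Fixpoint pr_rec (R : nzRingType) (D P : choiceType) (a b : P) (s : seq D) :
    fm R (seq (prod D P)) :=
  if s is x :: s' then
    bas ((x, a) :: map (fun x => (x, b)) s) - cone R (x, a) (pr_rec R a b s')
  else 0.
HB.lock Definition pr_form (R : nzRingType) (D P : choiceType) (a b : P) :
  {linear fm R (seq D) -> fm R (seq (prod D P))} := linext (pr_rec R a b).

Section Prism.
Variables (R : nzRingType) (D P : choiceType) (a b : P).
Local Notation pr_form := (@pr_form R D P a b).
Local Notation at_ p := (map (fun x : D => (x, p))).
Local Notation DP := (prod D P).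

Lemma pr_nil : pr_form (bas [::]) = 0.
Proof. by rewrite unlock linext_bas. Qed.

Lemma pr_cons x s : pr_form (bas (x :: s)) =
  bas ((x, a) :: (x, b) :: at_ b s) - cone R (x, a) (pr_form (bas s)).
Proof. by rewrite unlock !linext_bas. Qed.

Lemma pr_cone x c : pr_form (cone R x c) =
  cone R (x, a) (cone R (x, b) (mapf R (fun x => (x, b)) c)) - cone R (x, a) (pr_form c).
Proof.
apply: (fm_ext (f := pr_form \o cone R x) (g := (cone R (x, a) \o (cone R (x, b) \o
  mapf R (fun x => (x, b)))) \- (cone R (x, a) \o pr_form))) => s /=.
by rewrite coneU pr_cons mapfU !coneU.
Qed.

Lemma dform_pr c : dform R DP (pr_form c) =
  mapf R (fun x => (x, b)) c - mapf R (fun x => (x, a)) c - pr_form (dform R D c).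
Proof.
apply: (fm_ext (f := dform R DP \o pr_form)
 (g := mapf R (fun x => (x, b)) \- mapf R (fun x => (x, a)) \- (pr_form \o dform R D))).
elim=> [|x s] /=; first by rewrite !mapfU pr_nil dformU dseq_nil !linear0 subrr addr0.
rewrite !mapfU !dformU pr_cons => IH.
rewrite linearB dformU !dseq_cons dform_cone IH !linearB /= !coneU pr_cone.
rewrite -mapf_dseq !opprK.
(* The faces containing the bottom vertex and all of the top of the opposite face
   cancel in pairs. *)
rewrite [LHS](AC (1*2*(1*3)) ((2*5)*(1*6*(4*(3*7))))).
by rewrite /= addNr add0r.
Qed.

End Prism.

Lemma mapf_pr (R : nzRingType) (D E P : choiceType) (a b : P) (f : D -> E) c :
  mapf R (fun p : prod D P => (f p.1, p.2)) (pr_form R _ a b c) = pr_form R _ a b (mapf R f c).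
Proof.
apply: (fm_ext (f := mapf R (fun p : prod D P => (f p.1, p.2)) \o pr_form R _ a b)
  (g := pr_form R _ a b \o mapf R f)).
elim=> [|x s] /=; first by rewrite mapfU !pr_nil linear0.
rewrite !mapfU /= !pr_cons => IH; rewrite linearB /= mapfU mapf_cone /= IH.
by rewrite -!map_comp.
Qed.

(** * Singular chains *)

Section Topology.
Variable RR : realType.

Lemma row_continuous (T : topologicalType) n (f : T -> 'rV[RR]_n) :
  (forall j, continuous (fun x => f x ord0 j)) -> continuous f.
Proof.
move=> fc x U [P /= PU sPU].
have : \forall y \near x, forall j, P ord0 j (f y ord0 j).
  by apply: filter_forall => j; apply: fc; apply: PU.
by apply: filterS => y hy; apply: sPU => i j; rewrite ord1.
Qed.

Lemma sum_continuous (T : topologicalType) (I : Type) (r : seq I) (Q : pred I)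
    (f : I -> T -> RR) :
  (forall i, continuous (f i)) -> continuous (fun x => \sum_(i <- r | Q i) f i x).
Proof.
move=> fc; apply: continuous_big => [|i _]; last exact: fc.
exact: add_continuous.
Qed.

Section RealFunctions.
Variables (T : topologicalType) (f g : T -> RR).
Hypotheses (fc : continuous f) (gc : continuous g).

Lemma mulr_cts : continuous (fun x => f x * g x).
Proof. by move=> x; apply: cvgM; [exact: fc|exact: gc]. Qed.

Lemma addr_cts : continuous (fun x => f x + g x).
Proof. by move=> x; apply: cvgD; [exact: fc|exact: gc]. Qed.

Lemma subr_cts : continuous (fun x => f x - g x).
Proof. by move=> x; apply: cvgB; [exact: fc|exact: gc]. Qed.

Lemma maxr_cts : continuous (fun x => Num.max (f x) (g x)).
Proof. exact: max_fun_continuous. Qed.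

Lemma minr_cts : continuous (fun x => Num.min (f x) (g x)).
Proof. exact: min_fun_continuous. Qed.

Lemma invr_cts : (forall x, f x != 0) -> continuous (fun x => (f x)^-1).
Proof. by move=> f0 x; apply: cvgV; [exact: f0|exact: fc]. Qed.

Lemma cst_cts (r : RR) : continuous (fun _ : T => r).
Proof. by move=> x; apply: cvg_cst. Qed.

End RealFunctions.

Lemma coord_cts n (T : topologicalType) (f : T -> 'rV[RR]_n) i :
  continuous f -> continuous (fun x => f x ord0 i).
Proof.
move=> fc x; apply: (@continuous_comp _ _ _ f (fun v : 'rV[RR]_n => v ord0 i)); first exact: fc.
exact: coord_continuous.
Qed.

Lemma mulmx_continuous n m (M : 'M[RR]_(n, m)) :
  continuous (fun x : 'rV[RR]_n => x *m M).
Proof.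
apply: row_continuous => j.
have -> : (fun x : 'rV[RR]_n => (x *m M) ord0 j) = (fun x => \sum_i x ord0 i * M i j).
  by apply/funext => x; rewrite mxE.
apply: sum_continuous => i; apply: mulr_cts; last exact: cst_cts.
exact: coord_continuous.
Qed.

Lemma set_val_continuous (T : topologicalType) (A : set T) :
  continuous (set_val : A -> T).
Proof. exact: initial_continuous. Qed.

Lemma to_sub_continuous (S T : topologicalType) (A : set T) (f : S -> A) :
  continuous (set_val \o f) -> continuous f.
Proof. exact: continuous_comp_initial. Qed.

(** ** Simplices, including the empty one *)

(** Counting vertices instead of dimensions makes the reduced chain complex
    uniform, its bottom term being spanned by the map from the empty simplex. *)
Definition simp k : set 'rV[RR]_k :=
  [set x | (forall i, 0 <= x ord0 i) /\ \sum_i x ord0 i = 1].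

Arguments simp : clear implicits.

Lemma simp_ge0 k (x : simp k) i : 0 <= set_val x ord0 i.
Proof. by have [] : simp k (set_val x) by exact: set_valP. Qed.

Lemma simp_sum k (x : simp k) : \sum_i set_val x ord0 i = 1.
Proof. by have [] : simp k (set_val x) by exact: set_valP. Qed.

Definition mk_simp k (x : 'rV[RR]_k) (h : simp k x) : simp k := SigSub (mem_set h).

Lemma mk_simpK k (x : 'rV[RR]_k) (h : simp k x) : set_val (mk_simp h) = x.
Proof. by []. Qed.

Lemma simp_inj k (x y : simp k) : set_val x = set_val y -> x = y.
Proof. exact: val_inj. Qed.

Definition cof_row k (i : 'I_k.+1) (x : 'rV[RR]_k) : 'rV[RR]_k.+1 :=
  \row_j oapp (x ord0) 0 (unlift i j).

Fact cof_in k (i : 'I_k.+1) (x : simp k) : simp k.+1 (cof_row i (set_val x)).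
Proof.
split=> [j|].
  by rewrite mxE; case: unliftP => [l _|_] //=; apply: simp_ge0.
rewrite (bigD1_ord i) //= mxE unlift_none add0r -(simp_sum x).
by apply: eq_bigr => l _; rewrite mxE liftK.
Qed.

Definition cof k (i : 'I_k.+1) (x : simp k) : simp k.+1 := mk_simp (cof_in i x).

Lemma cof_continuous k (i : 'I_k.+1) : continuous (cof i).
Proof.
apply: to_sub_continuous.
apply: row_continuous => j.
have -> : (fun x : simp k => (set_val \o cof i) x ord0 j) =
    (fun x : simp k => oapp (set_val x ord0) 0 (unlift i j)).
  by apply/funext => x; rewrite /= mxE.
case: unliftP => [l _|_] /=; last exact: cst_cts.
exact/coord_cts/set_val_continuous.
Qed.

Fact vertex_in k (i : 'I_k) : simp k (delta_mx 0 i : 'rV[RR]_k).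
Proof.
split=> [j|]; first by rewrite mxE ler0n.
rewrite (bigD1 i) //= mxE !eqxx big1 ?addr0 // => j /negPf ji.
by rewrite mxE ji andbF.
Qed.

Definition vertex k (i : 'I_k) : simp k := mk_simp (vertex_in i).

Lemma cof_vertex k (i : 'I_k.+1) j : cof i (vertex j) = vertex (lift i j).
Proof.
apply/simp_inj/rowP => l; rewrite !mxE eqxx /=.
case: unliftP => [m ->|->] /=; first by rewrite mxE eqxx /= (inj_eq lift_inj).
by rewrite (negPf (neq_lift _ _)).
Qed.

(** ** Convex combinations *)

(** What is needed of a convex set to realise its formal affine simplices. *)
Record cvx := Cvx {
  pt :> topologicalType;
  comb : forall k, ('I_k -> pt) -> simp k -> pt;
  comb_continuous : forall k (p : 'I_k -> pt), continuous (comb p);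
  comb_cof : forall k (i : 'I_k.+1) (p : 'I_k.+1 -> pt) (t : simp k),
    comb p (cof i t) = comb (p \o lift i) t }.

Lemma cof_sum k (i : 'I_k.+1) (x : simp k) (f : 'I_k.+1 -> RR) :
  \sum_j set_val (cof i x) ord0 j * f j = \sum_j set_val x ord0 j * f (lift i j).
Proof.
rewrite (bigD1_ord i) //= mxE unlift_none mul0r add0r.
by apply: eq_bigr => j _; rewrite mxE liftK.
Qed.

Section SimplexConvex.
Variable n : nat.

Fact simp_comb_in k (p : 'I_k -> simp n) (t : simp k) :
  simp n (set_val t *m \matrix_(i, j) set_val (p i) ord0 j).
Proof.
split=> [j|].
  rewrite mxE; apply: sumr_ge0 => i _; rewrite mxE; apply: mulr_ge0; exact: simp_ge0.
under eq_bigr do rewrite mxE; rewrite exchange_big /= -(simp_sum t).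
apply: eq_bigr => i _; under eq_bigr do rewrite mxE.
by rewrite -mulr_sumr simp_sum mulr1.
Qed.

Definition simp_comb k (p : 'I_k -> simp n) (t : simp k) : simp n :=
  mk_simp (simp_comb_in p t).

Lemma simp_combE k (p : 'I_k -> simp n) t j :
  set_val (simp_comb p t) ord0 j = \sum_i set_val t ord0 i * set_val (p i) ord0 j.
Proof. by rewrite mxE; apply: eq_bigr => i _; rewrite mxE. Qed.

Fact simp_comb_continuous k (p : 'I_k -> simp n) : continuous (simp_comb p).
Proof.
apply: to_sub_continuous => x.
exact: (continuous_comp (@set_val_continuous _ _ x) (@mulmx_continuous _ _ _ _)).
Qed.

Fact simp_comb_cof k (i : 'I_k.+1) (p : 'I_k.+1 -> simp n) (t : simp k) :
  simp_comb p (cof i t) = simp_comb (p \o lift i) t.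
Proof.
apply/simp_inj/rowP => j; rewrite !simp_combE.
exact: (cof_sum i t (fun l => set_val (p l) ord0 j)).
Qed.

Definition simp_cvx := Cvx simp_comb_continuous simp_comb_cof.

Lemma simp_comb_vertex (t : simp n) : simp_comb (@vertex n) t = t.
Proof.
apply/simp_inj/rowP => j; rewrite simp_combE (bigD1 j) //= mxE !eqxx mulr1.
by rewrite big1 ?addr0 // => i /negPf ij; rewrite mxE [j == i]eq_sym ij andbF mulr0.
Qed.

End SimplexConvex.

Lemma simp_combA n k l (p : 'I_k -> simp n) (u : 'I_l -> simp k) (t : simp l) :
  simp_comb p (simp_comb u t) = simp_comb (simp_comb p \o u) t.
Proof.
apply/simp_inj; rewrite /simp_comb !mk_simpK -mulmxA; congr (_ *m _).
by apply/matrixP => i j; rewrite !mxE; apply: eq_bigr => m _; rewrite !mxE.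
Qed.

Lemma cof_comb n k (i : 'I_n.+1) (p : 'I_k -> simp n) (t : simp k) :
  cof i (simp_comb p t) = simp_comb (cof i \o p) t.
Proof.
apply/simp_inj/rowP => j; rewrite simp_combE mxE.
case: unliftP => [m ->|->] /=.
  by rewrite simp_combE; apply: eq_bigr => l _; rewrite mxE liftK.
by rewrite big1 // => l _; rewrite mxE unlift_none mulr0.
Qed.

Definition real_comb k (p : 'I_k -> RR) (t : simp k) : RR :=
  \sum_i set_val t ord0 i * p i.

Fact real_comb_continuous k (p : 'I_k -> RR) : continuous (real_comb p).
Proof.
apply: sum_continuous => i; apply: mulr_cts; last exact: cst_cts.
exact/coord_cts/set_val_continuous.
Qed.

Fact real_comb_cof k (i : 'I_k.+1) (p : 'I_k.+1 -> RR) (t : simp k) :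
  real_comb p (cof i t) = real_comb (p \o lift i) t.
Proof. exact: cof_sum. Qed.

Definition real_cvx := Cvx real_comb_continuous real_comb_cof.

Lemma pair_cts (S T U : topologicalType) (f : S -> T) (g : S -> U) :
  continuous f -> continuous g -> continuous (fun x => (f x, g x)).
Proof. by move=> fc gc x; apply: cvg_pair; [exact: fc|exact: gc]. Qed.

Lemma fst_cts (S T : topologicalType) : continuous (@fst S T).
Proof. by move=> x; apply: cvg_fst. Qed.
Lemma snd_cts (S T : topologicalType) : continuous (@snd S T).
Proof. by move=> x; apply: cvg_snd. Qed.

Section Product.
Variables C D : cvx.
Definition prod_comb k (p : 'I_k -> C * D) (t : simp k) : C * D :=
  (comb (fst \o p) t, comb (snd \o p) t).
Fact prod_comb_continuous k (p : 'I_k -> C * D) : continuous (prod_comb p).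
Proof. by apply: pair_cts; apply: comb_continuous. Qed.
Fact prod_comb_cof k (i : 'I_k.+1) (p : 'I_k.+1 -> C * D) (t : simp k) :
  prod_comb p (cof i t) = prod_comb (p \o lift i) t.
Proof. by rewrite /prod_comb !comb_cof. Qed.
Definition prod_cvx := Cvx prod_comb_continuous prod_comb_cof.
End Product.

(** ** Chains *)

Variable R : nzRingType.

Definition Ch k (X : topologicalType) : lmodType R := fm R (continuousType (simp k) X).

(** A map that is not continuous is sent to the zero chain, so that chains can
    be pushed along maps that are continuous on part of the space only. *)
Definition sx (X : topologicalType) k (g : simp k -> X) : Ch k X :=
  if pselect (continuous g) is left h then bas (mkcts h : continuousType _ _) else 0.

Section Chains.
Variable X : topologicalType.

Lemma sxE k (s : continuousType (simp k) X) : sx s = bas s.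
Proof.
rewrite /sx; case: pselect => [h|[]]; last exact: cts_fun.
by congr bas; apply/continuousEP.
Qed.

Lemma sx_cts k (g : simp k -> X) : continuous g ->
  exists2 s : continuousType (simp k) X, sx g = bas s & s =1 g.
Proof. by move=> h; exists (mkcts h : continuousType _ _) => //; rewrite -sxE. Qed.

Definition bd k : {linear Ch k.+1 X -> Ch k X} :=
  linext (fun s : continuousType (simp k.+1) X =>
    \sum_(i < k.+1) (-1) ^+ i *: sx (s \o cof i)).

Lemma bdU k (s : continuousType (simp k.+1) X) :
  bd k (bas s) = \sum_(i < k.+1) (-1) ^+ i *: sx (s \o cof i).
Proof. exact: linext_bas. Qed.

Lemma bd_sx k (g : simp k.+1 -> X) : continuous g ->
  bd k (sx g) = \sum_(i < k.+1) (-1) ^+ i *: sx (g \o cof i).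
Proof. by case/sx_cts => s -> /funext <-; rewrite bdU. Qed.

End Chains.

(** Formal simplices with a number of vertices other than [k] are sent to zero,
    which spares carrying the size in the type of formal simplices. *)
Definition realize (X : topologicalType) (D : cvx) k (F : D -> X) :
    {linear fm R (seq D) -> Ch k X} :=
  linext (fun s => if insub s is Some t then sx (F \o comb (tnth (t : k.-tuple D))) else 0).

Section Realize.
Variables (X : topologicalType) (D : cvx).
Implicit Types F : D -> X.

Lemma realize_fun k F (p : 'I_k -> D) :
  realize k F (bas (map p (enum 'I_k))) = sx (F \o comb p).
Proof.
have h : size (map p (enum 'I_k)) == k by rewrite size_map size_enum_ord.
rewrite /realize linext_bas (insubT (fun s => size s == k) h).
congr (sx (F \o comb _)); apply/funext => i.
rewrite (tnth_nth (p i)) /= (nth_map i) ?size_enum_ord //; congr p.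
by apply: ord_inj; rewrite nth_enum_ord.
Qed.

Lemma realize_size k F s : size s != k -> realize k F (bas s) = 0.
Proof. by move=> h; rewrite /realize linext_bas insubF //; apply/negbTE. Qed.

Lemma seq_fun (T : Type) k (s : seq T) : size s = k ->
  exists p : 'I_k -> T, s = map p (enum 'I_k).
Proof.
move=> /eqP h; exists (tnth (Tuple h)).
by rewrite map_tnth_enum.
Qed.

Lemma bd_realize k F c : continuous F -> bd X k (realize k.+1 F c) = realize k F (dform R D c).
Proof.
move=> Fc; apply: (fm_ext (f := bd X k \o realize k.+1 F) (g := realize k F \o dform R D)) => s /=.
rewrite dformU; have [/seq_fun[p ->]|ns] := eqVneq (size s) k.+1; last first.
  rewrite realize_size // linear0; apply/esym.
  rewrite (eq_on (g := \0) _ (@on_dseq R D s)) //= => t [ht _].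
  by apply: realize_size; apply: contraNneq ns => <-; rewrite ht.
rewrite realize_fun bd_sx; last first.
  by move=> x; apply: continuous_comp; [exact: comb_continuous|exact: Fc].
rewrite dseq_sum linear_sum; apply: eq_bigr => i _.
rewrite linearZ /= realize_fun; congr (_ *: sx _).
by apply/funext => t /=; rewrite comb_cof.
Qed.

End Realize.

Lemma realize_map (X : topologicalType) (D E : cvx) (F : D -> X) (f : E -> D) k c :
  (forall l (p : 'I_l -> E) t, f (comb p t) = comb (f \o p) t) ->
  realize k F (mapf R f c) = realize k (F \o f) c.
Proof.
move=> fcomb; apply: (fm_ext (f := realize k F \o mapf R f) (g := realize k (F \o f))) => s /=.
rewrite mapfU; have [/seq_fun[p ->]|ns] := eqVneq (size s) k; last first.
  by rewrite !realize_size ?size_map.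
rewrite -map_comp !realize_fun; congr sx.
by apply/funext => t /=; rewrite fcomb.
Qed.

End Topology.

Arguments simp {RR} k.
Arguments bd {RR R X} k.
Arguments realize {RR} R {X D} k F.
Arguments sx {RR} R {X k} g.
Arguments pr_form R {D P} a b.

Section Operators.
Variables (RR : realType) (R : nzRingType).
Local Notation simp := (@simp RR).
Local Notation Ch := (@Ch RR R).
Local Notation simplex k X := (continuousType (simp k) X).
Implicit Types X Y Z : topologicalType.

Definition chain_in X k (U : X -> Prop) (c : Ch k X) :=
  on (fun s : simplex k X => forall t, U (s t)) c.

Lemma chain_in_sx X k (U : X -> Prop) (g : simp k -> X) :
  (forall t, U (g t)) -> chain_in U (sx R g).
Proof.
rewrite /sx /chain_in => Ug; case: pselect => h; last exact: on0.
exact: on_bas.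
Qed.

Lemma chain_in_bd X k (U : X -> Prop) (c : Ch k.+1 X) : chain_in U c -> chain_in U (bd k c).
Proof.
move=> Uc; apply: on_linext Uc _ => s Us.
by apply: on_sum => i _; apply: onZ; apply: chain_in_sx => t; apply: Us.
Qed.

Lemma chain_in_realize X (D : cvx RR) (F : D -> X) k (U : X -> Prop) c :
  (forall y, U (F y)) -> chain_in U (realize R k F c).
Proof.
move=> UF; rewrite /chain_in /realize.
apply: (@on_linext _ _ _ _ (fun _ => True)) => // s _.
by case: insub => [t|]; [apply: chain_in_sx => x; apply: UF|apply: on0].
Qed.

(** ** Maps *)

Definition push X Z (f : X -> Z) k : {linear Ch k X -> Ch k Z} :=
  linext (fun s : simplex k X => sx R (f \o s)).

Lemma pushU X Z (f : X -> Z) k (s : simplex k X) : push f k (bas s) = sx R (f \o s).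
Proof. exact: linext_bas. Qed.

Lemma push_sx X Z (f : X -> Z) k (g : simp k -> X) : continuous g ->
  push f k (sx R g) = sx R (f \o g).
Proof. by move=> /(sx_cts R)[s -> /funext <-]; rewrite pushU. Qed.

(** Continuity is only required along the singular simplices of [U]: this is all
    that chains can see, and it avoids putting a topology on [U]. *)
Definition cts_on X Z (U : X -> Prop) (f : X -> Z) :=
  forall k (s : simplex k X), (forall t, U (s t)) -> continuous (f \o s).

Lemma continuous_cts_on X Z (U : X -> Prop) (f : X -> Z) : continuous f -> cts_on U f.
Proof.
by move=> fc k s _ x; apply: continuous_comp; [exact: cts_fun|exact: fc].
Qed.

Lemma cts_comp X Y Z (f : X -> Y) (g : Y -> Z) :
  continuous f -> continuous g -> continuous (g \o f).
Proof. by move=> fc gc x; apply: continuous_comp; [exact: fc|exact: gc]. Qed.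

Lemma bd_push X Z (U : X -> Prop) (f : X -> Z) k (c : Ch k.+1 X) :
  cts_on U f -> chain_in U c -> bd k (push f k.+1 c) = push f k (bd k c).
Proof.
move=> fU; apply: (eq_on (f := bd k \o push f k.+1) (g := push f k \o bd k)).
move=> s Us /=; rewrite pushU bdU bd_sx; last exact: fU.
rewrite linear_sum; apply: eq_bigr => i _; rewrite linearZ /= push_sx //.
by apply: cts_comp; [exact: cof_continuous|exact: cts_fun].
Qed.

Lemma chain_in_push X Z (U : X -> Prop) (U' : Z -> Prop) (f : X -> Z) k (c : Ch k X) :
  chain_in U c -> (forall x, U x -> U' (f x)) -> chain_in U' (push f k c).
Proof.
move=> Uc UU'; apply: on_linext Uc _ => s Us.
by apply: chain_in_sx => t; apply: UU'.
Qed.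

Lemma eq_push X Z (U : X -> Prop) (f g : X -> Z) k (c : Ch k X) :
  chain_in U c -> (forall x, U x -> f x = g x) -> push f k c = push g k c.
Proof.
move=> Uc fg; apply: eq_on Uc => s Us; rewrite !pushU.
by congr sx; apply/funext => t /=; apply: fg.
Qed.

Lemma push_id X k (c : Ch k X) : push id k c = c.
Proof. by apply: (fm_ext (f := push id k) (g := idfun)) => s; rewrite pushU sxE. Qed.

Lemma push_comp X Y Z (U : X -> Prop) (f : X -> Y) (g : Y -> Z) k (c : Ch k X) :
  cts_on U f -> chain_in U c -> push g k (push f k c) = push (g \o f) k c.
Proof.
move=> fU; apply: (eq_on (f := push g k \o push f k) (g := push (g \o f) k)).
by move=> s Us /=; rewrite !pushU push_sx //; apply: fU.
Qed.

(** ** Subdivision *)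

Fact unif_in n : simp n.+1 (\row_(j < n.+1) (n.+1%:R^-1 : RR)).
Proof.
split=> [i|]; first by rewrite mxE invr_ge0 ler0n.
under eq_bigr do rewrite mxE.
by rewrite sumr_const card_ord -[LHS]mulr_natr mulVf ?pnatr_eq0.
Qed.
Definition unif n : simp n.+1 := mk_simp (unif_in n).

Definition cbary_n (D : cvx RR) n (x : D) (s : seq D) : D :=
  comb (fun i : 'I_n.+1 => nth x (x :: s) i) (unif n).
Definition cbary (D : cvx RR) (x : D) (s : seq D) : D := cbary_n (size s) x s.

Lemma cbary_map (D E : cvx RR) (f : D -> E) x s :
  (forall l (p : 'I_l -> D) t, f (comb p t) = comb (f \o p) t) ->
  f (cbary x s) = cbary (f x) (map f s).
Proof.
move=> fc; rewrite /cbary /cbary_n fc size_map; congr comb.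
by apply/funext => i /=; rewrite -[f x :: _]/(map f (x :: s)) (nth_map x).
Qed.

Definition verts k : seq (simp_cvx RR k) := map (@vertex RR k) (enum 'I_k).

Lemma bas_face k (i : 'I_k.+1) :
  bas (map (@vertex RR k.+1 \o lift i) (enum 'I_k)) =
  mapf R (D := simp_cvx RR k) (E := simp_cvx RR k.+1) (cof i) (bas (verts k)).
Proof.
rewrite mapfU; congr bas; rewrite -[RHS]map_comp.
by apply: eq_map => j /=; rewrite cof_vertex.
Qed.

Section NaturalOperator.
(** An operator on formal simplices commuting with affine maps acts on
    singular chains, through its value on the vertices of the simplex. *)
Variable Th : forall n, {linear fm R (seq (simp_cvx RR n)) -> fm R (seq (simp_cvx RR n))}.
Hypothesis Th_map : forall n m (f : simp_cvx RR n -> simp_cvx RR m) c,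
  (forall l (p : 'I_l -> simp_cvx RR n) t, f (comb p t) = comb (f \o p) t) ->
  mapf R f (Th n c) = Th m (mapf R f c).

Definition natop X k l : {linear Ch k X -> Ch l X} :=
  linext (fun s : simplex k X => realize R (D := simp_cvx RR k) l s (Th k (bas (verts k)))).

Lemma natopU X k l (s : simplex k X) :
  natop X k l (bas s) = realize R (D := simp_cvx RR k) l s (Th k (bas (verts k))).
Proof. exact: linext_bas. Qed.

Lemma natop_sx X k l (g : simp k -> X) : continuous g ->
  natop X k l (sx R g) = realize R (D := simp_cvx RR k) l g (Th k (bas (verts k))).
Proof. by move=> /(sx_cts R)[s -> /funext <-]; rewrite natopU. Qed.

(** Naturality for the cofaces is what identifies the operator on a face of [s]
    with the operator on the formal face, realised along [s]. *)
Lemma natop_bd X k l (s : simplex k.+1 X) :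
  natop X k l (bd k (bas s)) =
  realize R (D := simp_cvx RR k.+1) l s (Th k.+1 (dseq R (verts k.+1))).
Proof.
rewrite bdU linear_sum dseq_sum !linear_sum; apply: eq_bigr => i _.
rewrite !linearZ /= natop_sx; last first.
  by apply: cts_comp; [exact: cof_continuous|exact: cts_fun].
have cofc l' (p : 'I_l' -> simp_cvx RR k) t :
    cof i (comb p t) = comb (c := simp_cvx RR k.+1) (cof i \o p) t by exact: cof_comb.
by rewrite bas_face -(Th_map _ cofc) realize_map.
Qed.

Lemma natop_realize X n k l (F : simp_cvx RR n -> X) c : continuous F ->
  on (fun s => size s = k) c -> natop X k l (realize R k F c) = realize R l F (Th n c).
Proof.
move=> Fc; apply: (eq_on (f := natop X k l \o realize R k F) (g := realize R l F \o Th n)).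
move=> s /seq_fun[p ->] /=; rewrite realize_fun natop_sx; last first.
  by apply: cts_comp Fc; exact: comb_continuous.
rewrite -realize_map; last by move=> l' p' t; apply: simp_combA.
rewrite Th_map; last by move=> l' p' t; apply: simp_combA.
rewrite mapfU; congr (realize _ _ _ (Th _ (bas _))); rewrite -[LHS]map_comp.
apply: eq_map => i /=; apply/simp_inj/rowP => j; rewrite simp_combE.
rewrite (bigD1 i) //= mxE !eqxx mul1r big1 ?addr0 // => m /negPf mi.
by rewrite mxE mi andbF mul0r.
Qed.

Lemma chain_in_natop X k l (U : X -> Prop) (c : Ch k X) : chain_in U c -> chain_in U (natop X k l c).
Proof. by move=> Uc; apply: on_linext Uc _ => s Us; apply: chain_in_realize. Qed.

Lemma natop_push X Z (U : X -> Prop) (f : X -> Z) k l (c : Ch k X) :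
  cts_on U f -> chain_in U c -> push f l (natop X k l c) = natop Z k l (push f k c).
Proof.
move=> fU; apply: (eq_on (f := push f l \o natop X k l) (g := natop Z k l \o push f k)).
move=> s Us /=; rewrite pushU natopU natop_sx; last exact: fU.
have e (d : fm R (seq (simp_cvx RR k))) :
    push f l (realize R (D := simp_cvx RR k) l s d) = realize R (D := simp_cvx RR k) l (f \o s) d.
  apply: (fm_ext (f := push f l \o realize R (D := simp_cvx RR k) l s)
    (g := realize R (D := simp_cvx RR k) l (f \o s))) => t /=.
  have [/seq_fun[p ->]|ns] := eqVneq (size t) l; last first.
    by rewrite !realize_size // linear0.
  rewrite !realize_fun push_sx //.
  by apply: cts_comp; [exact: comb_continuous|exact: cts_fun].
exact: e.
Qed.

End NaturalOperator.

Lemma sd_map n m (f : simp_cvx RR n -> simp_cvx RR m) c :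
  (forall l (p : 'I_l -> simp_cvx RR n) t, f (comb p t) = comb (f \o p) t) ->
  mapf R f (sd_form R (@cbary (simp_cvx RR n)) c) =
  sd_form R (@cbary (simp_cvx RR m)) (mapf R f c).
Proof. by move=> fc; apply: mapf_sd => x s; apply: cbary_map. Qed.

Lemma th_map n m (f : simp_cvx RR n -> simp_cvx RR m) c :
  (forall l (p : 'I_l -> simp_cvx RR n) t, f (comb p t) = comb (f \o p) t) ->
  mapf R f (th_form R (@cbary (simp_cvx RR n)) c) =
  th_form R (@cbary (simp_cvx RR m)) (mapf R f c).
Proof. by move=> fc; apply: mapf_th => x s; apply: cbary_map. Qed.

Definition sd X k := natop (fun n => sd_form R (@cbary (simp_cvx RR n))) X k k.
Definition th X k := natop (fun n => th_form R (@cbary (simp_cvx RR n))) X k k.+1.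

Lemma realize_verts X k (s : simplex k X) :
  realize R (D := simp_cvx RR k) k s (bas (verts k)) = bas s.
Proof.
rewrite realize_fun -sxE; congr sx.
by apply/funext => t /=; rewrite simp_comb_vertex.
Qed.

Lemma bd_sd X k (c : Ch k.+1 X) : bd k (sd X k.+1 c) = sd X k (bd k c).
Proof.
apply: (fm_ext (f := bd k \o sd X k.+1) (g := sd X k \o bd k)) => s.
rewrite /= /sd natop_bd; last exact: sd_map.
by rewrite natopU bd_realize ?dform_sd ?dformU //; exact: cts_fun.
Qed.

Lemma bd_th X k (c : Ch k.+1 X) :
  bd k.+1 (th X k.+1 c) = c - sd X k.+1 c - th X k (bd k c).
Proof.
apply: (fm_ext (f := bd k.+1 \o th X k.+1)
  (g := idfun \- sd X k.+1 \- (th X k \o bd k))) => s.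
rewrite /= /th natop_bd; last exact: th_map.
rewrite natopU bd_realize; last exact: cts_fun.
by rewrite dform_th !linearB dformU /= realize_verts /sd natopU.
Qed.

(** ** Homotopies *)

Section Homotopy.
Variables (X Z : topologicalType) (h : X -> RR -> Z).

(** The time parameter of a homotopy ranges over all reals, although only the
    times between 0 and 1 matter: the line is a convex set without side condition. *)
Definition hmap k (s : simp k -> X) (p : prod_cvx (simp_cvx RR k) (real_cvx RR)) : Z :=
  h (s p.1) p.2.

Definition prism k : {linear Ch k X -> Ch k.+1 Z} :=
  linext (fun s : simplex k X => realize R k.+1 (hmap s) (pr_form R 0 1 (bas (verts k)))).

Definition homotopy_on (U : X -> Prop) :=
  forall k (s : simplex k X), (forall t, U (s t)) -> continuous (hmap s).

Lemma prismU k (s : simplex k X) :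
  prism k (bas s) = realize R k.+1 (hmap s) (pr_form R 0 1 (bas (verts k))).
Proof. exact: linext_bas. Qed.

Lemma prism_sx k (g : simp k -> X) : continuous g ->
  prism k (sx R g) = realize R k.+1 (hmap g) (pr_form R 0 1 (bas (verts k))).
Proof. by move=> /(sx_cts R)[s -> /funext <-]; rewrite prismU. Qed.

Lemma prism_bd k (s : simplex k.+1 X) :
  prism k (bd k (bas s)) =
  realize R k.+1 (hmap s) (pr_form R 0 1 (dseq R (verts k.+1))).
Proof.
rewrite bdU linear_sum dseq_sum !linear_sum; apply: eq_bigr => i _.
rewrite !linearZ /= prism_sx; last first.
  by apply: cts_comp; [exact: cof_continuous|exact: cts_fun].
rewrite bas_face.
rewrite -mapf_pr.
rewrite (@realize_map _ _ _ (prod_cvx (simp_cvx RR k.+1) (real_cvx RR))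
  (prod_cvx (simp_cvx RR k) (real_cvx RR))) //.
by move=> l p t; congr (_, _); apply: cof_comb.
Qed.

Lemma realize_end k (s : simplex k X) (r : RR) :
  realize R k (hmap s) (mapf R (fun x => (x, r)) (bas (verts k))) = sx R (h^~ r \o s).
Proof.
rewrite mapfU /verts.
have -> : map (fun x => (x, r)) (map (@vertex RR k) (enum 'I_k)) =
  map (fun i => (vertex RR i, r)) (enum 'I_k) by rewrite -[LHS]map_comp.
rewrite (@realize_fun RR R Z (prod_cvx (simp_cvx RR k) (real_cvx RR))); congr sx; apply/funext => t /=.
rewrite /hmap /=; congr (h (s _) _); first exact: simp_comb_vertex.
by rewrite /real_comb /= -mulr_suml simp_sum mul1r.
Qed.

Lemma bd_prism U k (c : Ch k.+1 X) : homotopy_on U -> chain_in U c ->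
  bd k.+1 (prism k.+1 c) =
  push (h^~ 1) k.+1 c - push (h^~ 0) k.+1 c - prism k (bd k c).
Proof.
move=> hU; apply: (eq_on (f := bd k.+1 \o prism k.+1)
  (g := push (h^~ 1) k.+1 \- push (h^~ 0) k.+1 \- (prism k \o bd k))).
move=> s Us; rewrite /= prism_bd prismU bd_realize; last exact: hU.
by rewrite dform_pr !linearB /= dformU !realize_end !pushU.
Qed.

Lemma chain_in_prism (U : X -> Prop) (U' : Z -> Prop) k (c : Ch k X) :
  chain_in U c -> (forall x r, U x -> U' (h x r)) -> chain_in U' (prism k c).
Proof.
by move=> Uc UU'; apply: on_linext Uc _ => s Us; apply: chain_in_realize => y; apply: UU'.
Qed.

End Homotopy.

End Operators.

Arguments push {RR R X Z} f k.
Arguments sd {RR R X} k.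
Arguments th {RR R X} k.
Arguments prism {RR R X Z} h k.

(** * Small simplices *)

Section Small.
Variables (RR : realType) (R : nzRingType).
Local Notation simp := (@simp RR).
Local Notation Ch := (@Ch RR R).
Local Notation simplex k X := (continuousType (simp k) X).
Implicit Types X Y Z : topologicalType.

(** ** Lebesgue numbers and meshes *)

Lemma compact_sub (T : topologicalType) (K : set T) : compact K -> compact [set: K].
Proof.
move=> cK F PF _.
have [|x [Kx clx]] := cK (set_val @ F) _.
  by apply: (@filterS _ F _ setT); [move=> y _; exact: set_valP|exact: filterT].
exists (SigSub (mem_set Kx) : K); split=> // A B FA [_ [[O oO <-] /= Ox] OB].
have [||_ [[y Ay <-] Oy]] := clx (set_val @` A) O.
- by apply: (@filterS _ F _ A) => // y Ay; exists y.
- by apply: open_nbhs_nbhs; split.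
by exists y; split=> //; apply: OB.
Qed.

Lemma closed_fge (T : topologicalType) (f : T -> RR) a :
  continuous f -> closed [set x | a <= f x].
Proof.
move=> fc; rewrite (_ : mkset _ = f @^-1` [set y | a <= y]) //.
by apply: preimage_closed; [move=> x _; exact: fc|exact: closed_ge].
Qed.

Lemma closed_fle (T : topologicalType) (f : T -> RR) a :
  continuous f -> closed [set x | f x <= a].
Proof.
move=> fc; rewrite (_ : mkset _ = f @^-1` [set y | y <= a]) //.
by apply: preimage_closed; [move=> x _; exact: fc|exact: closed_le].
Qed.

Lemma simp_compact k : compact [set: simp k].
Proof.
apply: compact_sub; apply: (subclosed_compact _
  (@rV_compact _ _ (fun=> `[0 : RR, 1]%classic) (fun=> @segment_compact _ _ _))).
  rewrite (_ : simp k = \bigcap_i [set x : 'rV[RR]_k | 0 <= x ord0 i] `&`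
    ([set x : 'rV[RR]_k | \sum_i x ord0 i <= 1] `&` [set x : 'rV[RR]_k | 1 <= \sum_i x ord0 i])).
    have c : continuous (fun x : 'rV[RR]_k => \sum_i x ord0 i).
      by apply: sum_continuous => i; exact: coord_continuous.
    apply: closedI; last by apply: closedI; [apply: closed_fle|apply: closed_fge].
    by apply: closed_bigI => i _; apply: closed_fge; exact: coord_continuous.
  apply/seteqP; split=> x.
    by move=> [x0 x1]; split=> [i _|]; [exact: x0|rewrite /= x1; split].
  move=> [x0 [/= x1 x1']]; split=> [i|]; first exact: x0.
  by apply/eqP; rewrite eq_le x1 x1'.
move=> x [x0 x1] i /=; rewrite in_itv /= x0 -x1 (bigD1 i) //= lerDl.
by apply: sumr_ge0.
Qed.

Definition dist k (x y : simp k) : RR := `|set_val x - set_val y|.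

Lemma dist_sym k (x y : simp k) : dist x y = dist y x.
Proof. exact: distrC. Qed.

Lemma dist_xx k (x : simp k) : dist x x = 0.
Proof. by rewrite /dist subrr normr0. Qed.

Lemma rowBE k (a b : 'rV[RR]_k) j : (a - b) ord0 j = a ord0 j - b ord0 j.
Proof. by rewrite !mxE. Qed.

(** The distance to a fixed point is convex; all the estimates on barycentres
    follow. *)
Lemma dist_comb k n (p : 'I_n -> simp k) (t : simp n) z :
  dist z (simp_comb p t) <= \sum_i set_val t ord0 i * dist z (p i).
Proof.
rewrite /dist.
have -> : set_val z - set_val (simp_comb p t) =
    \sum_i set_val t ord0 i *: (set_val z - set_val (p i)).
  apply/rowP => j; rewrite [LHS]rowBE simp_combE summxE.
  under [RHS]eq_bigr do rewrite !mxE mulrBr.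
  by rewrite sumrB -mulr_suml simp_sum mul1r.
apply: le_trans (ler_norm_sum _ _ _) _; apply: ler_sum => i _.
by rewrite normrZ ger0_norm // simp_ge0.
Qed.

(** The only property of the points of the convex hull of [s] that is used to
    estimate diameters. *)
Definition near_hull k (s : seq (simp k)) p :=
  forall z r, (forall y, y \in s -> dist z y <= r) -> dist z p <= r.

Lemma near_hull_comb k n (p : 'I_n -> simp k) (t : simp n) z r :
  (forall i, dist z (p i) <= r) -> dist z (simp_comb p t) <= r.
Proof.
move=> hr; apply: le_trans (dist_comb _ _ _) _.
rewrite -[r in _ <= r]mul1r -(simp_sum t) mulr_suml.
by apply: ler_sum => i _; apply: ler_wpM2l (hr i); apply: simp_ge0.
Qed.

Definition mesh_le k d (s : seq (simp k)) :=
  forall x y, x \in s -> y \in s -> dist x y <= d.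

Lemma bary_hull k (x : simp k) s : near_hull (x :: s) (cbary (D := simp_cvx RR k) x s).
Proof.
move=> z r h; apply: near_hull_comb => i; apply: h.
by rewrite mem_nth.
Qed.

(** The barycentre of at most [n.+1] points is the average of distances at most
    [d], one of which is zero. *)
Lemma bary_dist k n d (x : simp k) s y : 0 <= d -> (size s <= n)%N ->
  mesh_le d (x :: s) -> y \in x :: s ->
  dist y (cbary (D := simp_cvx RR k) x s) <= n%:R / n.+1%:R * d.
Proof.
move=> d0 sn ms ys; set m := size s.
have [j jm yj] : exists2 j : 'I_m.+1, true & y = nth x (x :: s) j.
  have h : (index y (x :: s) < m.+1)%N by rewrite index_mem.
  by exists (Ordinal h) => //=; rewrite nth_index.
apply: le_trans (dist_comb _ _ _) _.
rewrite (bigD1 j) //= -yj dist_xx mulr0 add0r.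
apply: (@le_trans _ _ (\sum_(i < m.+1 | i != j) m.+1%:R^-1 * d)).
  apply: ler_sum => i _; rewrite mxE; apply: ler_wpM2l; first by rewrite invr_ge0 ler0n.
  by apply: ms => //; rewrite mem_nth.
rewrite sumr_const cardC1 card_ord /= -[leLHS]mulr_natr [leLHS]mulrAC.
apply: (ler_wpM2r d0).
rewrite mulrC ler_pdivlMr ?ltr0n // mulrAC ler_pdivrMr ?ltr0n //.
by rewrite -!natrM ler_nat !mulnS [(m * n)%N]mulnC leq_add2r.
Qed.

Section Mesh.
Variables (k n : nat).
Local Notation sdf := (sd_form R (@cbary RR (simp_cvx RR k))).
Let rho : RR := n%:R / n.+1%:R.

Lemma on_sd d s : 0 <= d -> (size s <= n.+1)%N -> mesh_le d s ->
  on (fun t => [/\ size t = size s, mesh_le (rho * d) t &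
                   forall p, p \in t -> near_hull s p]) (sdf (bas s)).
Proof.
move=> d0; elim/(@face_ind R): s => [|x s IH] hs ms.
  by rewrite sd_formU sd_nil; apply: on_bas; split.
rewrite sd_formU sd_cons.
apply: (@on_cone _ _ (fun t => [/\ size t = size s, mesh_le (rho * d) t &
   forall p, p \in t -> near_hull (x :: s) p])).
  rewrite sd_form.unlock; apply: (on_linext (on_and (@on_dseq R _ (x :: s)) IH)).
  move=> u [[[us] ux] IHu].
  have mu : mesh_le d u by move=> a b au bu; apply: ms; apply: ux.
  have hu : (size u <= n.+1)%N by rewrite us ltnW.
  move: (IHu hu mu); rewrite sd_formU; apply: sub_on => t [ht mt Ht].
  split; [by rewrite ht us|by []|move=> p /Ht hp z r hr].
  by apply: hp => y /ux; apply: hr.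
move=> t [ht mt Ht]; split=> [|a b|p]; first by rewrite /= ht.
  have b_dist p : p \in t -> dist (cbary (D := simp_cvx RR k) x s) p <= rho * d.
    move=> /Ht; apply => y ys; rewrite dist_sym.
    exact: bary_dist.
  rewrite !inE => /orP[/eqP->|ta] /orP[/eqP->|tb].
  - by rewrite dist_xx mulr_ge0 // divr_ge0 ?ler0n.
  - exact: b_dist.
  - by rewrite dist_sym; exact: b_dist.
  - exact: mt.
by rewrite inE => /orP[/eqP->|/Ht//]; exact: bary_hull.
Qed.

Lemma on_iter_sd d s N : 0 <= d -> (size s <= n.+1)%N -> mesh_le d s ->
  on (fun t => size t = size s /\ mesh_le (rho ^+ N * d) t) (iter N sdf (bas s)).
Proof.
move=> d0 hs ms; elim: N => [|N IH] /=.
  by apply: on_bas; split=> //; rewrite expr0 mul1r.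
rewrite {1}sd_form.unlock; apply: on_linext IH _ => u [us mu].
rewrite -sd_formU.
have := @on_sd (rho ^+ N * d) u; rewrite us => /(_ _ hs mu).
have r0 : 0 <= rho ^+ N * d by rewrite mulr_ge0 // exprn_ge0 // divr_ge0 ?ler0n.
by move=> /(_ r0); apply: sub_on => t [-> mt _]; rewrite exprS -mulrA.
Qed.

Lemma rho_cvg (e : RR) d : 0 < e -> 0 <= d -> exists N, rho ^+ N * d < e.
Proof.
move=> e0 d0; have r1 : `|rho| < 1.
  rewrite ger0_norm ?divr_ge0 ?ler0n //.
  by rewrite ltr_pdivrMr ?ltr0n // mul1r ltr_nat.
have d1 : 0 < d + 1 by rewrite ltr_wpDl.
have /cvgrPdist_lt /(_ (e / (d + 1)) _)[|N _ /(_ N) /= /(_ (leqnn _))] := cvg_expr r1.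
  by rewrite divr_gt0.
rewrite sub0r normrN ltr_pdivlMr // => h; exists N; apply: le_lt_trans h.
by rewrite ler_pM ?exprn_ge0 ?divr_ge0 ?ler0n ?ler_norm // lerDl.
Qed.

End Mesh.

(** Compactness is used in the form that a property holding near every point at
    small enough scales holds uniformly at some scale. *)
Lemma lebesgue_number X (I : Type) (U : I -> set X) k (f : simp k -> X) :
  continuous f -> (forall i, open (U i)) -> (forall t, exists i, U i (f t)) ->
  exists2 e : RR, 0 < e & forall x, exists i, forall y, dist x y < e -> U i (f y).
Proof.
move=> fc oU cU.
have := @simp_compact k; rewrite compact_near_coveringP.
move=> /(_ RR (0^'+) (fun e x => exists i, forall y, dist x y < e -> U i (f y)) _).
case=> [x _|e e0 he].
  have [i Ui] := cU x.
  have : nbhs x (f @^-1` U i) by apply: fc; apply: open_nbhs_nbhs.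
  rewrite -nbhs_ballE => -[d /= d0 db].
  exists ([set y | dist x y < d / 2], [set e | e < d / 2]).
    split=> /=; last by apply: nbhs_right_lt; rewrite divr_gt0.
    rewrite -nbhs_ballE; exists (d / 2); first by rewrite /= divr_gt0.
    by move=> y; rewrite -initial_ballE -ball_normE.
  move=> [y r] /= [xy re]; exists i => z yz; apply: db.
  rewrite -initial_ballE -ball_normE /=.
  rewrite (splitr d); apply: le_lt_trans (ltrD xy (lt_trans yz re)).
  by rewrite -(subrKA (set_val y)); apply: ler_normD.
exists (e / 2); first by rewrite divr_gt0.
move=> x; apply: (he (e / 2)) => //=; last by rewrite divr_gt0.
by rewrite sub0r normrN gtr0_norm ?divr_gt0 // ltr_pdivrMr // ltr_pMr // ltr1n.
Qed.

End Small.

(** ** Chains subordinate to an open cover *)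

Section Homological.
Variables (RR : realType) (R : nzRingType).
Local Notation simp := (@simp RR).
Local Notation Ch := (@Ch RR R).
Local Notation simplex k X := (continuousType (simp k) X).
Implicit Types X Y Z : topologicalType.

Fixpoint sdN X k N : {linear Ch k X -> Ch k X} :=
  if N is N'.+1 then (sd k \o sdN X k N' : {linear Ch k X -> Ch k X}) else idfun.
Arguments sdN {X k} N.

Lemma bd_sdN X k N (c : Ch k.+1 X) : bd k (sdN N c) = sdN N (bd k c).
Proof. by elim: N => //= N IH; rewrite bd_sd IH. Qed.

Lemma chain_in_sdN X k N (U : X -> Prop) (c : Ch k X) : chain_in U c -> chain_in U (sdN N c).
Proof. by move=> Uc; elim: N => //= N IH; apply: chain_in_natop. Qed.

Lemma sdN_push X Z (U : X -> Prop) (f : X -> Z) k N (c : Ch k X) :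
  cts_on RR U f -> chain_in U c -> push f k (sdN N c) = sdN N (push f k c).
Proof.
move=> fU Uc; elim: N => //= N <-.
exact: natop_push fU (chain_in_sdN Uc).
Qed.

(** The homotopy [th] joins each subdivision of the cycle to the next one, without
    leaving [U]. *)
Lemma sdN_hlg X k N (U : X -> Prop) (c : Ch k.+1 X) : bd k c = 0 -> chain_in U c ->
  exists2 e, chain_in U e & c - sdN N c = bd k.+1 e.
Proof.
move=> bc Uc; elim: N => [|N [e Ue he]] /=.
  by exists 0; [exact: on0|rewrite subrr linear0].
exists (e + th k.+1 (sdN N c)).
  apply: onD; first exact: Ue.
  by apply: chain_in_natop; apply: chain_in_sdN.
by rewrite linearD /= -he bd_th bd_sdN bc !linear0 addr0 addrA subrK.
Qed.

Section Cover.
Variables (X : topologicalType) (I : Type) (U : I -> set X).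
Hypothesis oU : forall i, open (U i).

Definition small k (c : Ch k X) :=
  on (fun s : simplex k X => exists i, forall t, U i (s t)) c.

Lemma small_sd k (c : Ch k X) : small c -> small (sd k c).
Proof.
move=> sc; apply: on_linext sc _ => s [i Us].
apply: (sub_on (P := fun s' : simplex k X => forall t, U i (s' t))) => [s' Us'|].
  by exists i.
exact: chain_in_realize.
Qed.

Lemma small_sdN k (c : Ch k X) N M : (N <= M)%N -> small (sdN N c) -> small (sdN M c).
Proof.
move=> /subnK <- sc; elim: (M - N)%N => //= n IH.
exact: small_sd.
Qed.

Lemma sdN_simplex k N (s : simplex k X) :
  sdN N (bas s) = realize R (D := simp_cvx RR k) k s
    (iter N (sd_form R (@cbary RR (simp_cvx RR k))) (bas (verts RR k))).
Proof.
elim: N => [|N IH] /=; first by rewrite realize_verts.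
rewrite IH /sd natop_realize //; [exact: sd_map|exact: cts_fun|].
have hs : size (verts RR k) = k by rewrite size_map size_enum_ord.
elim: N {IH} => [|N IH] /=; first by apply: on_bas.
rewrite {1}sd_form.unlock; apply: on_linext IH _ => u us.
by apply: (sub_on _ (@on_sd_size R _ _ u)) => t ->.
Qed.

Lemma small_simplex k (s : simplex k.+1 X) :
  (forall t, exists i, U i (s t)) -> exists N, small (sdN N (bas s)).
Proof.
move=> cs; have [e e0 he] := lebesgue_number (@cts_fun _ _ s) oU cs.
have [d d0 hd] : exists2 d : RR, 0 <= d & mesh_le d (verts RR k.+1).
  exists (\sum_(x <- verts RR k.+1) \sum_(y <- verts RR k.+1) dist x y).
    by apply: sumr_ge0 => x _; apply: sumr_ge0 => y _; apply: normr_ge0.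
  have le_sum r (F : simp k.+1 -> RR) x : (forall y, 0 <= F y) -> x \in r ->
      F x <= \sum_(y <- r) F y.
    move=> F0 xr; rewrite (perm_big _ (perm_to_rem xr)) big_cons lerDl.
    by apply: sumr_ge0.
  move=> x y xv yv; apply: le_trans (le_sum _ (dist x) y _ yv) _ => [z|].
    exact: normr_ge0.
  apply: (le_sum _ (fun x => \sum_(y <- verts RR k.+1) dist x y) x _ xv) => z.
  by apply: sumr_ge0 => w _; apply: normr_ge0.
have [N hN] := rho_cvg k e0 d0.
exists N; rewrite sdN_simplex.
have hs : (size (verts RR k.+1) <= k.+1)%N by rewrite size_map size_enum_ord.
rewrite /small /realize.
apply: (on_linext (@on_iter_sd RR R k.+1 k d (verts RR k.+1) N d0 hs hd)) => t [ts mt].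
case: insubP => [u _ ut|_]; last exact: on0.
have [i hi] := he (tnth u ord0).
have Ut : chain_in (U i) (sx R (s \o comb (c := simp_cvx RR k.+1) (tnth u))).
  apply: chain_in_sx => w; apply: hi; apply: le_lt_trans hN.
  by apply: near_hull_comb => j; apply: mt; rewrite -ut mem_tnth.
by apply: sub_on Ut => s' Us'; exists i.
Qed.

(** Each simplex becomes small after finitely many subdivisions, by the Lebesgue
    number lemma, and stays small afterwards; a chain has finitely many simplices. *)
Lemma small_chains k (c : Ch k.+1 X) :
  chain_in (fun x => exists i, U i x) c -> exists N, small (sdN N c).
Proof.
move=> cc.
have [N hN] : exists N, forall s, s \in supp c -> small (sdN N (bas s)).
  have: {subset supp c <= supp c} by [].
  elim: {1 3}(supp c) => [|s r IH] hr; first by exists 0%N.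
  have [N hN] := IH (fun x xr => hr x (mem_behead (s := s :: r) xr)).
  have [M hM] := small_simplex (cc s (hr s (mem_head _ _))).
  exists (maxn N M) => s'; rewrite inE => /orP[/eqP->|/hN h].
    exact: small_sdN (leq_maxr _ _) hM.
  exact: small_sdN (leq_maxl _ _) h.
exists N; rewrite (fm_expand c) linear_sum big_seq; apply: on_sum => s sc.
by rewrite linearZ; apply: onZ; apply: hN.
Qed.

End Cover.

Lemma split_on (B : choiceType) (P Q : B -> Prop) (c : fm R B) :
  on (fun b => P b \/ Q b) c ->
  exists u w, [/\ c = u + w, on P u & on Q w].
Proof.
move=> h; exists (restr R P c), (c - restr R P c); split.
- by rewrite addrC subrK.
- exact: on_restr.
- move=> b; rewrite suppE fcoefD fcoefN fcoef_restr.
  case: asboolP => Pb; first by rewrite subrr eqxx.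
  by rewrite subr0 -suppE => /h[].
Qed.

(** The open sets [oU] and [oW] of the ambient space cover [S]; the conclusion is
    about their traces on [S], so that covers of subspaces can be treated too. *)
Lemma small2 X (S U W : X -> Prop) (oU oW : set X) k (c : Ch k.+1 X) :
  open oU -> open oW -> (forall x, S x -> oU x \/ oW x) ->
  (forall x, S x -> oU x -> U x) -> (forall x, S x -> oW x -> W x) -> chain_in S c ->
  exists N u w, [/\ sdN N c = u + w, chain_in U u & chain_in W w].
Proof.
move=> opU opW cov UU WW Sc.
have [||N sN] := @small_chains X bool (fun b => if b then oU else oW) _ k c.
- by case.
- apply: sub_on Sc => s Ss t; case: (cov _ (Ss t)) => h; [by exists true|by exists false].
have [|u [w [e Uu Ww]]] := @split_on _ (fun s : simplex k.+1 X => forall t, U (s t))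
   (fun s => forall t, W (s t)) (sdN N c); last by exists N, u, w.
apply: sub_on (on_and sN (chain_in_sdN Sc)) => s [[[] h] Ss].
  by left=> t; apply: UU.
by right=> t; apply: WW.
Qed.

(** This fails for the chains on the empty simplex, which lie in every set. *)
Lemma chain_in_False X k (c : Ch k.+1 X) : chain_in (fun _ => False) c -> c = 0.
Proof. by move=> h; apply: on_False => s /h; apply; apply: unif. Qed.

(** On the constant simplices at a point, the boundary is alternately the identity
    and zero, starting with the identity onto the empty simplex. *)
Lemma point_bounds X (p : X) k (c : Ch k.+1 X) :
  bd k c = 0 -> chain_in (eq p) c -> exists2 e, chain_in (eq p) e & c = bd k.+1 e.
Proof.
pose K l : Ch l X := sx R (cst p).
have bK l : bd l (K l.+1) = (odd l.+1)%:R *: K l.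
  rewrite bd_sx; last exact: cst_continuous.
  transitivity (\sum_(i < l.+1) (-1) ^+ i *: K l); first by apply: eq_bigr.
  rewrite -scaler_suml; congr (_ *: _).
  elim: l => [|l IH]; first by rewrite big_ord1 expr0.
  rewrite big_ord_recr IH -[(-1) ^+ _]signr_odd !oddS.
  by case: (odd l); rewrite /= ?(expr0, expr1, mulr0n, mulr1n) ?add0r ?subrr.
move=> + pc; have [a ->] : exists a, c = a *: K k.+1.
  exists (\sum_(s <- supp c) fcoef c s).
  rewrite {1}(fm_expand c) scaler_suml !big_seq; apply: eq_bigr => s /pc ps.
  by rewrite -(sxE R s); congr (_ *: sx R _); apply/funext => t /=; rewrite -ps.
rewrite linearZ /= bK; case: (boolP (odd k.+1)) => ok h; last first.
  exists (a *: K k.+2); first by apply: onZ; apply: chain_in_sx.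
  by rewrite linearZ /= bK oddS ok scale1r.
move: h; rewrite scale1r => h; exists 0; first exact: on0.
have [s es _] := sx_cts R (@cst_continuous (simp k) X p).
move: h; rewrite /K es => /(congr1 (fun d => fcoef d s)).
rewrite fcoefZ fcoef_bas eqxx mulr1 fcoef0 => ->.
by rewrite scale0r linear0.
Qed.

(** The prism of a contraction joins the cycle to a chain at the point [p], and
    this chain bounds. *)
Lemma contract_bounds X (U U' : X -> Prop) (h : X -> RR -> X) p k (c : Ch k.+1 X) :
  homotopy_on h U -> (forall x r, U x -> U' (h x r)) ->
  (forall x, U x -> h x 0 = x) -> (forall x, U x -> h x 1 = p) -> U' p ->
  bd k c = 0 -> chain_in U c -> exists2 e, chain_in U' e & c = bd k.+1 e.
Proof.
move=> hU UU' h0 h1 U'p bc Uc.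
have cst1 : cts_on RR U (h^~ 1).
  move=> l s Us; rewrite (_ : _ \o _ = cst p); first exact: cst_continuous.
  by apply/funext => t /=; rewrite h1.
have e1 : bd k (push (h^~ 1) k.+1 c) = 0 by rewrite (bd_push cst1 Uc) bc linear0.
have [|e pe ee] := point_bounds (p := p) e1.
  by apply: chain_in_push Uc _ => x /h1.
exists (e - prism h k.+1 c).
  apply: onB; first by apply: sub_on pe => s ps t; rewrite -ps.
  exact: chain_in_prism Uc UU'.
rewrite linearB /= -ee (bd_prism hU Uc) bc linear0 subr0.
by rewrite (eq_push Uc h0) push_id subKr.
Qed.

End Homological.

Arguments sdN {RR R X k} N.

(** * Mayer-Vietoris and punctured spaces *)

Section MayerVietoris.
Variables (RR : realType) (R : nzRingType).
Local Notation simp := (@simp RR).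
Local Notation Ch := (@Ch RR R).
Local Notation simplex k X := (continuousType (simp k) X).
Implicit Types X Y Z : topologicalType.

Lemma bd_bd X k (c : Ch k.+2 X) : bd k (bd k.+1 c) = 0.
Proof.
apply: (fm_ext (f := bd k \o bd k.+1) (g := \0)) => s /=.
have scts : continuous (s : simp_cvx RR k.+2 -> X) by exact: cts_fun.
by rewrite -(realize_verts R s) !bd_realize // dform_dform linear0.
Qed.

(** Exactness of the Mayer-Vietoris sequence at the homology of [S]: a cycle is
    subdivided into a chain in [U] and a chain in [W], whose common boundary is a
    cycle in the intersection; filling it turns both parts into cycles. *)
Lemma mv_bounds X (S U W : X -> Prop) (oU oW : set X) k :
  open oU -> open oW -> (forall x, S x -> oU x \/ oW x) ->
  (forall x, S x -> oU x -> U x) -> (forall x, S x -> oW x -> W x) ->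
  (forall x, U x -> S x) -> (forall x, W x -> S x) ->
  (forall c : Ch k.+2 X, bd _ c = 0 -> chain_in U c -> exists2 e, chain_in S e & c = bd _ e) ->
  (forall c : Ch k.+2 X, bd _ c = 0 -> chain_in W c -> exists2 e, chain_in S e & c = bd _ e) ->
  (forall c : Ch k.+1 X, bd _ c = 0 -> chain_in (fun x => U x /\ W x) c ->
     exists2 e, chain_in (fun x => U x /\ W x) e & c = bd _ e) ->
  forall c : Ch k.+2 X, bd _ c = 0 -> chain_in S c -> exists2 e, chain_in S e & c = bd _ e.
Proof.
move=> opU opW cov UU WW US WS HU HW HUW c bc Sc.
have [N [u [w [e Uu Ww]]]] := small2 opU opW cov UU WW Sc.
have [e0 Se0 he0] := sdN_hlg N bc Sc.
have bw : bd _ w = - bd _ u.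
  by apply/eqP; rewrite -addr_eq0 addrC -linearD /= -e bd_sdN bc linear0.
have [v UWv hv] : exists2 v, chain_in (fun x => U x /\ W x) v & bd _ u = bd k.+1 v.
  apply: HUW; first exact: bd_bd.
  have h1 := chain_in_bd Uu; have h2 : chain_in W (bd _ u).
    by rewrite -[bd _ u]opprK -bw; apply: onN; apply: chain_in_bd.
  by apply: sub_on (on_and h1 h2) => s [a b] t.
have Uv : chain_in U v by apply: sub_on UWv => s h t; have [] := h t.
have Wv : chain_in W v by apply: sub_on UWv => s h t; have [] := h t.
have [|//|e1 Se1 he1] := HU (u - v); first by rewrite linearB /= hv subrr.
  exact: onB.
have [|//|e2 Se2 he2] := HW (w + v); first by rewrite linearD /= bw hv addNr.
  exact: onD.
exists (e0 + (e1 + e2)); first by apply: onD => //; apply: onD.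
rewrite !linearD /= -he0 -he1 -he2.
by rewrite [X in _ + X]addrACA addNr addr0 -e subrK.
Qed.

(** Clamping time to the unit interval defines homotopies for all real times. *)
Definition clamp (r : RR) : RR := Num.max 0 (Num.min 1 r).

Lemma clamp_ge0 r : 0 <= clamp r. Proof. by rewrite le_max lexx. Qed.
Lemma clamp_le1 r : clamp r <= 1.
Proof. by rewrite ge_max ler01 ge_min lexx. Qed.
Lemma clamp0 : clamp 0 = 0.
Proof. by rewrite /clamp (min_idPr ler01) maxxx. Qed.
Lemma clamp1 : clamp 1 = 1.
Proof. by rewrite /clamp minxx (max_idPr ler01). Qed.
Lemma clamp_continuous : continuous clamp.
Proof.
apply: maxr_cts; first exact: cst_cts.
by apply: minr_cts; [exact: cst_cts|move=> x; exact: cvg_id].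
Qed.

Lemma clamp_cts (T : topologicalType) (f : T -> RR) :
  continuous f -> continuous (fun x => clamp (f x)).
Proof. by move=> fc; apply: cts_comp fc clamp_continuous. Qed.

Section Punctured.
Variable N : nat.
Local Notation E := 'rV[RR]_N.

Definition slide (y : E) (x : E) (r : RR) : E :=
  (1 - clamp r) *: x + clamp r *: y.

Lemma slideE y x r i : slide y x r ord0 i =
  (1 - clamp r) * x ord0 i + clamp r * y ord0 i.
Proof. by rewrite !mxE. Qed.

Lemma slide0 y x : slide y x 0 = x.
Proof. by rewrite /slide clamp0 subr0 scale1r scale0r addr0. Qed.

Lemma slide1 y x : slide y x 1 = y.
Proof. by rewrite /slide clamp1 subrr scale1r scale0r add0r. Qed.

Lemma slide_homotopy y U : homotopy_on (slide y) U.
Proof.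
move=> k s _; apply: row_continuous => i.
have -> : (fun p : prod_cvx (simp_cvx RR k) (real_cvx RR) => hmap (slide y) s p ord0 i) =
    (fun p => (1 - clamp p.2) * s p.1 ord0 i + clamp p.2 * y ord0 i).
  by apply/funext => p; rewrite /hmap slideE.
have c2 : continuous (fun p : prod_cvx (simp_cvx RR k) (real_cvx RR) => clamp p.2).
  by apply: clamp_cts; exact: snd_cts.
apply: addr_cts; apply: mulr_cts => //; last exact: cst_cts.
  by apply: subr_cts => //; exact: cst_cts.
by apply: coord_cts; apply: cts_comp; [exact: fst_cts|exact: cts_fun].
Qed.

(** The complement of a linear subspace of codimension [j]. *)
Definition nonzero_below j (x : E) : Prop := exists2 i : 'I_N, (i < j)%N & x ord0 i != 0.

Lemma nonzero_belowS j (x : E) (i : 'I_N) : i = j :> nat ->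
  nonzero_below j.+1 x <-> nonzero_below j x \/ x ord0 i != 0.
Proof.
move=> ij; split=> [[l lj xl]|[[l lj xl]|xi]]; last by exists i; rewrite ?ij.
  have [e|e] := eqVneq l i; [by right; rewrite -e|left; exists l => //].
  by rewrite ltn_neqAle -ij (inj_eq val_inj) e -ltnS ij.
by exists l => //; apply: ltnW.
Qed.

Lemma open_nonzero_below j : open (nonzero_below j : set E).
Proof.
rewrite (_ : nonzero_below j = \bigcup_(i in [set i : 'I_N | (i < j)%N])
    [set x : E | x ord0 i != 0]); last first.
  by apply/seteqP; split=> x [i ij xi]; exists i.
apply: bigcup_open => i _.
apply: (@open_comp _ _ (fun x : E => x ord0 i) [set y | y != 0]).
  by move=> x _; exact: coord_continuous.
exact: open_neq.
Qed.

(** The complement of a subspace of codimension [j.+1] is covered by the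
    complements of two closed half spaces of a subspace of codimension [j]. These
    are star-shaped, and intersect in the complement of the whole subspace of
    codimension [j], which is treated by induction. *)
Lemma punctured_bounds j d (c : Ch d.+1 E) : (j <= N)%N -> (j <= d)%N ->
  bd _ c = 0 -> chain_in (nonzero_below j) c ->
  exists2 e, chain_in (nonzero_below j) e & c = bd _ e.
Proof.
elim: j d c => [|j IH] d c jN jd bc Sc.
  exists 0; first exact: on0.
  by rewrite linear0; apply: chain_in_False; apply: sub_on Sc => s h t; have [] := h t.
case: d jd c bc Sc => // d; rewrite ltnS => jd.
pose i := Ordinal jN; have ij : i = j :> nat by [].
pose half (a : RR) : set E := [set x | nonzero_below j x \/ 0 < a * x ord0 i].
have ohalf a : open (half a).
  rewrite (_ : half a = nonzero_below j `|` [set x | 0 < a * x ord0 i]) //.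
  apply: openU; first exact: open_nonzero_below.
  apply: (@open_comp _ _ (fun x : E => a * x ord0 i) [set y | 0 < y]).
    by move=> x _; apply: mulr_cts; [exact: cst_cts|exact: coord_continuous].
  exact: open_gt.
have halfS a x : half a x -> nonzero_below j.+1 x.
  rewrite (nonzero_belowS _ ij) => -[|h]; [by left|right].
  by apply: contraTneq h => ->; rewrite mulr0 ltxx.
have hb a : a * a = 1 -> forall c : Ch d.+2 E, bd _ c = 0 -> chain_in (half a) c ->
    exists2 e, chain_in (nonzero_below j.+1) e & c = bd _ e.
  move=> a1 c bc hc; pose y : E := a *: delta_mx 0 i.
  have yE l : y ord0 l = a * (l == i)%:R by rewrite !mxE eqxx.
  have hy : half a y by right; rewrite yE eqxx mulr1 a1.
  apply: (contract_bounds (h := slide y) (p := y) _ _ _ _ _ bc hc).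
  - exact: slide_homotopy.
  - move=> x r hx; apply: (halfS a).
    have [e|r1] := eqVneq (clamp r) 1.
      by rewrite /slide e subrr scale0r scale1r add0r.
    have {}r1 : 0 < 1 - clamp r by rewrite subr_gt0 lt_neqAle r1 clamp_le1.
    case: hx => [[l lj xl]|hx]; [left; exists l => //|right] => /=.
      have /negPf li : l != i by apply: contraTneq lj => ->; rewrite -leqNgt.
      by rewrite slideE yE li !mulr0 addr0 mulf_neq0 // gt_eqF.
    rewrite slideE yE eqxx mulr1 mulrDr mulrCA [a * (_ * a)]mulrCA a1 mulr1.
    by apply: ltr_pwDl; [rewrite mulr_gt0|exact: clamp_ge0].
  - by move=> x _; exact: slide0.
  - by move=> x _; exact: slide1.
  - exact: halfS hy.
apply: (mv_bounds (ohalf 1) (ohalf (-1)) _ (fun _ _ h => h) (fun _ _ h => h)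
  (halfS 1) (halfS (-1)) (hb 1 _) (hb (-1) _)); rewrite ?mulrNN ?mulr1 //.
  move=> x; rewrite (nonzero_belowS _ ij) => -[h|]; first by left; left.
  by rewrite neq_lt => /orP[h|h]; [right; right; rewrite mulN1r oppr_gt0|left; right; rewrite mul1r].
have hI x : (half 1 x /\ half (-1) x) <-> nonzero_below j x.
  split=> [[[//|h1] [//|]]|h]; last by split; left.
  by rewrite mulN1r oppr_gt0 => h2; move: h1; rewrite mul1r => /(lt_trans h2); rewrite ltxx.
move=> c' bc' hc'; have [|e he ->] := IH _ c' (ltnW jN) jd bc'.
  by apply: sub_on hc' => s h t; apply/hI.
by exists e => //; apply: sub_on he => s h t; apply/hI.
Qed.

End Punctured.
End MayerVietoris.

(** * Homotopies on quotient and weak topologies *)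

Section Tube.
Variables (RR : realType).
Implicit Types X Y Z T : topologicalType.

(** The topology of [S] being determined by the maps [phi], so is that of the
    product of [S] with a line, because a line is locally compact: the points of
    [S] at which a compact interval of times is not sent into a given open set
    form a closed set, by the tube lemma in each [D i]. *)
Lemma tube_continuous X Z T (I : Type) (D : I -> topologicalType)
    (phi : forall i, D i -> X) (S : set X) (F : X -> RR -> Z) (f : T -> X) :
  (forall i u, S (phi i u)) -> (forall x, S x -> exists i u, phi i u = x) ->
  (forall B : set X, B `<=` S -> (forall i, closed (phi i @^-1` B)) -> closed B) ->
  (forall i, continuous (fun p : D i * RR => F (phi i p.1) p.2)) ->
  continuous f -> (forall t, S (f t)) ->
  continuous (fun p : T * RR => F (f p.1) p.2).
Proof.
move=> phiS Sphi wk Fc fc fS [t0 r0] O /= NO.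
rewrite nbhsE in NO; case: NO => O' [oO' O'x] O'O.
have [i [u0 u0E]] := Sphi _ (fS t0).
have [e e0 he] : exists2 e : RR, 0 < e &
    forall r, r \in `[r0 - e, r0 + e] -> O' (F (f t0) r).
  have : nbhs (u0, r0) ((fun p : D i * RR => F (phi i p.1) p.2) @^-1` O').
    by apply: Fc; rewrite /= u0E; apply: open_nbhs_nbhs.
  move=> [[A B] /= [nA nB] AB].
  move: nB; rewrite -nbhs_ballE => -[d /= d0 dB].
  exists (d / 2); first by rewrite divr_gt0.
  move=> r; rewrite in_itv /= -ler_distlC => rd.
  rewrite -u0E; apply: (AB (u0, r)); split=> /=; first exact: nbhs_singleton.
  apply: dB; rewrite -ball_normE /=; apply: le_lt_trans rd _.
  by rewrite ltr_pdivrMr // ltr_pMr // ltr1n.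
pose B : set X := [set x | S x /\ exists2 r, r \in `[r0 - e, r0 + e] & ~ O' (F x r)].
have cB : closed B.
  apply: wk => [x []//|j].
  rewrite -openC openE => u nBu.
  have : \forall u' \near u, `[r0 - e, r0 + e] `<=` [set r | O' (F (phi j u') r)].
    have := @segment_compact _ (r0 - e) (r0 + e); rewrite compact_near_coveringP.
    apply => r rJ.
    have : nbhs (u, r) ((fun p : D j * RR => F (phi j p.1) p.2) @^-1` O').
      apply: Fc => /=; apply: open_nbhs_nbhs; split=> //.
      by apply: contrapT => nO; apply: nBu; split=> //; exists r.
    move=> [[A B'] /= [nA nB'] AB]; exists (B', A) => // -[r' u'] /= [B'r Au].
    exact: (AB (u', r')).
  apply: filterS => u' h [_ [r rJ]]; apply; exact: h.
have : nbhs (t0, r0) ([set t | ~ B (f t)] `*` `[r0 - e, r0 + e]%classic).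
  exists ([set t | ~ B (f t)], `[r0 - e, r0 + e]%classic) => //=; split.
    apply: (open_nbhs_nbhs (A := f @^-1` (~` B))); split.
      by apply: open_comp => [x _|]; [exact: fc|rewrite openC].
    by move=> [_ [r rJ]]; apply; apply: he.
  rewrite -nbhs_ballE; exists e => // r; rewrite -ball_normE /= => h.
  by rewrite in_itv /= -ler_distlC ltW.
apply: filterS => -[t r] /= [nB rJ]; apply: O'O.
by apply: contrapT => nO; apply: nB; split=> //; exists r.
Qed.

End Tube.

Local Open Scope quotient_scope.

(** * The suspension *)

Section Suspension.
Variables (RR : realType) (R : nzRingType) (Y : topologicalType).
Local Notation simp := (@simp RR).
Local Notation Ch := (@Ch RR R).
Local Notation simplex k X := (continuousType (simp k) X).
Local Notation I01 := (`[0 : RR, 1]%classic).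
Local Notation cyl := (cylinder RR Y).
Local Notation X := (suspension RR Y).

Definition proj (a : cyl) : X := \pi_X a.

Lemma proj_continuous : continuous proj.
Proof. exact: pi_continuous. Qed.

Lemma projP (a b : cyl) : proj a = proj b <-> susp_rel a b.
Proof. by split=> [/eqmodP|h]; last apply/eqmodP. Qed.

Lemma proj_repr (x : X) : proj (repr x) = x. Proof. exact: reprK. Qed.

Lemma repr_proj (a : cyl) : susp_rel (repr (proj a)) a.
Proof. by apply/projP; rewrite proj_repr. Qed.

Definition height (x : X) : RR := set_val (repr x).2.

Lemma height_proj a : height (proj a) = set_val a.2.
Proof.
have := repr_proj a; rewrite /height; set b := repr _.
by case/or3P => [/eqP ->|/andP[/eqP-> /eqP->]|/andP[/eqP-> /eqP->]].
Qed.

Lemma I01P (t : I01) : 0 <= set_val t <= 1.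
Proof. by have := set_valP t; rewrite /= in_itv. Qed.

Lemma height_ge0 x : 0 <= height x. Proof. by have /andP[] := I01P (repr x).2. Qed.
Lemma height_le1 x : height x <= 1. Proof. by have /andP[] := I01P (repr x).2. Qed.

Lemma height_continuous : continuous height.
Proof.
apply/quotient_continuous.
have -> : height \o \pi_X = (fun a : cyl => set_val a.2).
  by apply/funext => a; exact: height_proj.
by apply: cts_comp; [exact: snd_cts|exact: set_val_continuous].
Qed.

Lemma mk_I01_proof (t : RR) : I01 (Num.max 0 (Num.min 1 t)).
Proof. by rewrite /= in_itv /= le_max lexx /= ge_max ler01 ge_min lexx. Qed.
Definition mk_I01 (t : RR) : I01 := SigSub (mem_set (mk_I01_proof t)).

Lemma mk_I01E t : 0 <= t <= 1 -> set_val (mk_I01 t) = t.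
Proof. by case/andP => t0 t1; change (Num.max 0 (Num.min 1 t) = t); rewrite (min_idPr t1) (max_idPr t0). Qed.

Lemma mk_I01_continuous : continuous mk_I01.
Proof. by apply: to_sub_continuous; exact: clamp_continuous. Qed.

(** Out of the unit interval, [t] is moved to the nearest end point. *)
Definition pnt (y : Y) (t : RR) : X := proj (y, mk_I01 t).

Lemma height_pnt y t : 0 <= t <= 1 -> height (pnt y t) = t.
Proof. by move=> h; rewrite height_proj mk_I01E. Qed.

Lemma pntE a : pnt a.1 (set_val a.2) = proj a.
Proof.
case: a => y t; congr (proj (y, _)); apply: val_inj.
exact: mk_I01E (I01P t).
Qed.

(** An arbitrary choice at the two poles. *)
Definition base (x : X) : Y := (repr x).1.

Lemma pnt_base x : pnt (base x) (height x) = x.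
Proof. by rewrite pntE proj_repr. Qed.

Lemma base_pnt y t : 0 < t < 1 -> base (pnt y t) = y.
Proof.
case/andP => t0 t1; have := repr_proj (y, mk_I01 t); rewrite /base /pnt.
have e : set_val (mk_I01 t) = t by rewrite mk_I01E // !ltW.
case/or3P => [/eqP ->//|/andP[_]|/andP[_]]; rewrite [(_, _).2]/= e.
  by rewrite gt_eqF.
by rewrite lt_eqF.
Qed.

Lemma pnt0 y y' : pnt y 0 = pnt y' 0.
Proof.
apply/projP/or3P; apply: Or32; apply/andP.
by split; apply/eqP; apply: mk_I01E; rewrite lexx ler01.
Qed.

Lemma pnt1 y y' : pnt y 1 = pnt y' 1.
Proof.
apply/projP/or3P; apply: Or33; apply/andP.
by split; apply/eqP; apply: mk_I01E; rewrite lexx ler01.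
Qed.

(** A self-map [rho] of the unit interval that fixes the end points acts on the
    suspension, and is homotopic to the identity through such maps. *)
Section Reparam.
Variable rho : RR -> RR.
Hypothesis rho_cts : continuous rho.
Hypothesis rho01 : forall t, 0 <= t <= 1 -> 0 <= rho t <= 1.
Hypotheses (rho0 : rho 0 = 0) (rho1 : rho 1 = 1).

Definition interp (t r : RR) : RR := (1 - clamp r) * t + clamp r * rho t.

Lemma interp_between t r a b : a <= t <= b -> a <= rho t <= b -> a <= interp t r <= b.
Proof.
move=> /andP[at_ tb] /andP[ar rb]; rewrite /interp.
have c0 := clamp_ge0 r; have c1 : 0 <= 1 - clamp r by rewrite subr_ge0 clamp_le1.
have e x : x = (1 - clamp r) * x + clamp r * x by ring.
by rewrite {1}(e a) {1}(e b); apply/andP; split; apply: lerD; apply: ler_wpM2l.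
Qed.

Lemma interp01 t r : 0 <= t <= 1 -> 0 <= interp t r <= 1.
Proof. by move=> h; apply: interp_between => //; apply: rho01. Qed.

Definition repar (x : X) (r : RR) : X := pnt (base x) (interp (height x) r).

Lemma height_repar x r : height (repar x r) = interp (height x) r.
Proof. by rewrite height_pnt // interp01 // height_ge0 height_le1. Qed.

Lemma repar0 x : repar x 0 = x.
Proof. by rewrite /repar /interp clamp0 subr0 mul1r mul0r addr0 pnt_base. Qed.

Lemma repar1 x : repar x 1 = pnt (base x) (rho (height x)).
Proof. by rewrite /repar /interp clamp1 subrr mul1r mul0r add0r. Qed.

Lemma repar_proj a r : repar (proj a) r = pnt a.1 (interp (set_val a.2) r).
Proof.
rewrite /repar height_proj; have := repr_proj a; rewrite /base.
case/or3P => [/eqP -> //|/andP[_ /eqP ->]|/andP[_ /eqP ->]].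
  by rewrite /interp rho0 !mulr0 addr0; exact: pnt0.
by rewrite /interp rho1 !mulr1 subrK; exact: pnt1.
Qed.

Lemma repar_homotopy U : homotopy_on repar U.
Proof.
move=> k s _.
apply: (@tube_continuous RR X X (simp k) unit (fun _ => cyl) (fun _ => proj) setT
  repar s) => //.
- by move=> x _; exists tt, (repr x); exact: proj_repr.
- move=> B _ /(_ tt); rewrite -[closed B]openC -openC => h.
  exact: h.
- move=> _.
  have -> : (fun p : cyl * RR => repar (proj p.1) p.2) =
      (fun p => proj (p.1.1, mk_I01 (interp (set_val p.1.2) p.2))).
    by apply/funext => p; rewrite repar_proj.
  apply: cts_comp proj_continuous; apply: pair_cts.
    by apply: cts_comp; exact: fst_cts.
  apply: cts_comp mk_I01_continuous.
  have c1 : continuous (fun p : cyl * RR => set_val p.1.2 : RR).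
    apply: cts_comp (@set_val_continuous _ _).
    by apply: cts_comp; [exact: fst_cts|exact: snd_cts].
  have c2 : continuous (fun p : cyl * RR => clamp p.2).
    by apply: clamp_cts; exact: snd_cts.
  apply: addr_cts; apply: mulr_cts => //.
    by apply: subr_cts => //; exact: cst_cts.
  exact: cts_comp c1 rho_cts.
- exact: cts_fun.
Qed.

End Reparam.

Definition lower (x : X) : Prop := height x < 2 / 3.
Definition upper (x : X) : Prop := 1 / 3 < height x.
Definition middle (x : X) : Prop := lower x /\ upper x.

Lemma open_lower : open (lower : set X).
Proof.
apply: (@open_comp _ _ height [set t | t < 2 / 3]); last exact: open_lt.
by move=> x _; exact: height_continuous.
Qed.

Lemma open_upper : open (upper : set X).
Proof.
apply: (@open_comp _ _ height [set t | 1 / 3 < t]); last exact: open_gt.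
by move=> x _; exact: height_continuous.
Qed.

Lemma cover_height x : lower x \/ upper x.
Proof. by rewrite /lower /upper; case: (ltP (height x) (2 / 3)) => h; [left|right]; lra. Qed.

(** The quotient map is injective on the open set between the two poles. *)
Lemma base_cts_on : cts_on RR middle base.
Proof.
move=> k s Ms; apply/continuousP => O oO.
have oM : open [set x | middle x /\ O (base x)].
  rewrite -[open _]/(open (\pi_X @^-1` _)).
  rewrite (_ : _ @^-1` _ = [set a : cyl | 1 / 3 < set_val a.2 < 2 / 3] `&` fst @^-1` O).
    apply: openI; last by apply: open_comp => // a _; exact: fst_cts.
    rewrite (_ : [set _ | _] = [set a : cyl | 1 / 3 < set_val a.2] `&`
       [set a : cyl | set_val a.2 < 2 / 3]); last first.
      by apply/seteqP; split=> a /=; [move/andP|move=> [-> ->]].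
    have c : continuous (fun a : cyl => set_val a.2 : RR).
      by apply: cts_comp; [exact: snd_cts|exact: set_val_continuous].
    apply: openI.
      by apply: (@open_comp _ _ (fun a : cyl => set_val a.2 : RR) [set t | 1 / 3 < t]) => [x _|]; [exact: c|exact: open_gt].
    by apply: (@open_comp _ _ (fun a : cyl => set_val a.2 : RR) [set t | t < 2 / 3]) => [x _|]; [exact: c|exact: open_lt].
  apply/seteqP; split=> a.
    move=> [[]]; rewrite -[\pi a]/(proj a) /lower /upper height_proj => h1 h2.
    rewrite -{1}(pntE a) base_pnt; last lra.
    by move=> Oa; split => //=; rewrite h1 h2.
  move=> [/= /andP[h1 h2] Oa]; rewrite -[\pi a]/(proj a).
  split; first by rewrite /middle /lower /upper height_proj.
  by rewrite -(pntE a) base_pnt //; lra.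
rewrite (_ : _ @^-1` _ = s @^-1` [set x | middle x /\ O (base x)]).
  by apply: open_comp => // x _; exact: cts_fun.
by apply/seteqP; split=> t /=; [split|case].
Qed.

Definition mid (y : Y) : X := pnt y (1 / 2).

Lemma mid_continuous : continuous mid.
Proof.
apply: cts_comp proj_continuous; apply: pair_cts; first by move=> x; exact: cvg_id.
by apply: cst_continuous.
Qed.

Lemma base_mid y : base (mid y) = y. Proof. by rewrite base_pnt //; lra. Qed.

Lemma height_mid y : height (mid y) = 1 / 2.
Proof. by rewrite height_pnt //; lra. Qed.

Lemma middle_mid y : middle (mid y).
Proof. by rewrite /middle /lower /upper height_mid; lra. Qed.

End Suspension.

Arguments lower {RR Y}.
Arguments upper {RR Y}.

(** ** Homology of the suspension *)

Section SuspensionHomology.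
Variables (RR : realType) (R : nzRingType) (Y : topologicalType) (y0 : Y).
Local Notation simp := (@simp RR).
Local Notation Ch := (@Ch RR R).
Local Notation simplex k X := (continuousType (simp k) X).
Local Notation X := (suspension RR Y).
Local Notation middle := (@middle RR Y).
Local Notation mid := (@mid RR Y).
Local Notation base := (@base RR Y).

(** Reparametrisations of the unit interval that contract the lower, the upper and
    the middle part of the suspension to height 0, 1 and 1/2 respectively. *)
Definition to_bottom (t : RR) : RR := Num.max 0 (3 * t - 2).
Definition to_top (t : RR) : RR := Num.min 1 (3 * t).
Definition to_middle (t : RR) : RR :=
  Num.min (1 / 2) (3 / 2 * t) + Num.max 0 ((3 * t - 2) / 2).

Let affine_cts (a b : RR) : continuous (fun t : RR => a * t + b).
Proof.
apply: addr_cts; last exact: cst_cts.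
by apply: mulr_cts; [exact: cst_cts|move=> x; exact: cvg_id].
Qed.

Lemma to_bottom_cts : continuous to_bottom.
Proof. by apply: maxr_cts; [exact: cst_cts|exact: affine_cts]. Qed.

Lemma to_top_cts : continuous to_top.
Proof.
apply: minr_cts; first exact: cst_cts.
by have := @affine_cts 3 0; under eq_fun do rewrite addr0.
Qed.

Lemma to_middle_cts : continuous to_middle.
Proof.
apply: addr_cts.
  apply: minr_cts; first exact: cst_cts.
  by have := @affine_cts (3 / 2) 0; under eq_fun do rewrite addr0.
apply: maxr_cts; first exact: cst_cts.
by apply: mulr_cts; [exact: affine_cts|exact: cst_cts].
Qed.

Lemma lower_bounds k (c : Ch k.+1 X) : bd k c = 0 -> chain_in lower c ->
  exists2 e, chain_in lower e & c = bd _ e.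
Proof.
have r01 t : 0 <= t <= 1 -> 0 <= to_bottom t <= 1.
  by move=> /andP[t0 t1]; rewrite /to_bottom; case: (leP 0 (3 * _ - 2)); lra.
have r0 : to_bottom 0 = 0 by rewrite /to_bottom; case: (leP 0 (3 * _ - 2)); lra.
have r1 : to_bottom 1 = 1 by rewrite /to_bottom; case: (leP 0 (3 * _ - 2)); lra.
move=> bc Uc.
apply: (contract_bounds (h := repar to_bottom) (p := pnt y0 0) _ _ _ _ _ bc Uc).
- exact: repar_homotopy to_bottom_cts r0 r1 _.
- move=> x r; rewrite /lower height_repar // => hx.
  have h0 := height_ge0 x; have h1 := height_le1 x.
  have /andP[_] : 0 <= interp to_bottom (height x) r <= height x.
    by apply: interp_between; rewrite ?h0 ?lexx //= /to_bottom; case: (leP 0 (3 * _ - 2)); lra.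
  by move=> h; apply: le_lt_trans h hx.
- by move=> x _; exact: repar0.
- move=> x hx; rewrite repar1 (_ : to_bottom _ = 0); first exact: pnt0.
  by move: hx; rewrite /lower /to_bottom; case: (leP 0 (3 * _ - 2)); lra.
- by rewrite /lower height_pnt; lra.
Qed.

Lemma upper_bounds k (c : Ch k.+1 X) : bd k c = 0 -> chain_in upper c ->
  exists2 e, chain_in upper e & c = bd _ e.
Proof.
have r01 t : 0 <= t <= 1 -> 0 <= to_top t <= 1.
  by move=> /andP[t0 t1]; rewrite /to_top; case: (leP 1 (3 * _)); lra.
have r0 : to_top 0 = 0 by rewrite /to_top; case: (leP 1 (3 * _)); lra.
have r1 : to_top 1 = 1 by rewrite /to_top; case: (leP 1 (3 * _)); lra.
move=> bc Uc.
apply: (contract_bounds (h := repar to_top) (p := pnt y0 1) _ _ _ _ _ bc Uc).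
- exact: repar_homotopy to_top_cts r0 r1 _.
- move=> x r; rewrite /upper height_repar // => hx.
  have h0 := height_le1 x; have h1 := height_ge0 x.
  have /andP[h _] : height x <= interp to_top (height x) r <= 1.
    apply: interp_between; first by rewrite h0 lexx.
    by rewrite /to_top; case: (leP 1 (3 * _)); lra.
  exact: lt_le_trans hx h.
- by move=> x _; exact: repar0.
- move=> x hx; rewrite repar1 (_ : to_top _ = 1); first exact: pnt1.
  by move: hx; rewrite /upper /to_top; case: (leP 1 (3 * _)); lra.
- by rewrite /upper height_pnt; lra.
Qed.

(** The suspension isomorphism in terms of cycles. A cycle of the suspension
    splits, up to a boundary, into a chain of the lower and a chain of the upper
    cone, whose common boundary can be moved into the middle copy of [Y]. It is
    stated as a relation because the splitting involves choices. *)
Definition susp_class k (z : Ch k.+2 X) (y : Ch k.+1 Y) : Prop :=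
  exists u w e, [/\ chain_in lower u, chain_in upper w, z = u + w + bd _ e &
                    bd _ u = push mid _ y].

Lemma susp_class_linear k a (z z' : Ch k.+2 X) y y' :
  susp_class z y -> susp_class z' y' -> susp_class (a *: z + z') (a *: y + y').
Proof.
move=> [u [w [e [Uu Ww -> bu]]]] [u' [w' [e' [Uu' Ww' -> bu']]]].
exists (a *: u + u'), (a *: w + w'), (a *: e + e'); split.
- by apply: onD => //; apply: onZ.
- by apply: onD => //; apply: onZ.
- by rewrite linearP !scalerDr addrACA (addrACA (a *: u)).
- by rewrite !linearP bu bu'.
Qed.

Lemma chain_in_middle k (c : Ch k X) : chain_in lower c -> chain_in upper c -> chain_in middle c.
Proof. by move=> h1 h2; apply: sub_on (on_and h1 h2) => s [a b] t; split. Qed.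

Lemma all_cover (x : X) : True -> lower x \/ upper x.
Proof. by move=> _; exact: cover_height. Qed.

(** The splitting comes from subdivision; the reparametrisation [to_middle] then
    moves its common boundary to height 1/2 while preserving both cones. *)
Lemma susp_class_total k (z : Ch k.+2 X) : bd _ z = 0 ->
  exists2 y, bd _ y = 0 & susp_class z y.
Proof.
move=> bz.
have Tz : chain_in (fun _ => True) z by [].
have [N [u [w [e Uu Ww]]]] := small2 (@open_lower RR Y) (@open_upper RR Y)
  all_cover (fun _ _ h => h) (fun _ _ h => h) Tz.
have [e0 _ he0] := sdN_hlg N bz Tz.
have bw : bd _ w = - bd _ u.
  by apply/eqP; rewrite -addr_eq0 addrC -linearD /= -e bd_sdN bz linear0.
have Mu : chain_in middle (bd _ u).
  apply: chain_in_middle; first exact: chain_in_bd.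
  by rewrite -[bd _ u]opprK -bw; apply: onN; apply: chain_in_bd.
have r01 t : 0 <= t <= 1 -> 0 <= to_middle t <= 1.
  by move=> /andP[t0 t1]; rewrite /to_middle; case: (leP (1 / 2) (3 / 2 * _)); case: (leP 0 ((3 * _ - 2) / 2)); lra.
have r0 : to_middle 0 = 0 by rewrite /to_middle; case: (leP (1 / 2) (3 / 2 * _)); case: (leP 0 ((3 * _ - 2) / 2)); lra.
have r1 : to_middle 1 = 1 by rewrite /to_middle; case: (leP (1 / 2) (3 / 2 * _)); case: (leP 0 ((3 * _ - 2) / 2)); lra.
have hom (U : X -> Prop) : homotopy_on (@repar RR Y to_middle) U.
  exact: repar_homotopy to_middle_cts r0 r1 _.
pose psi := (@repar RR Y to_middle)^~ 1.
have psi_cts U : cts_on RR U psi.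
  move=> l s Us.
  have -> : psi \o s = hmap (repar to_middle) s \o (fun t => (t, 1)) by [].
  apply: (@cts_comp _ (prod_cvx (simp_cvx RR l) (real_cvx RR)) _
    (fun t => (t, 1)) (hmap (repar to_middle) s) _ (hom U l s Us)).
  apply: pair_cts; first by move=> t; exact: cvg_id.
  exact: cst_cts.
exists (push base _ (bd _ u)).
  by rewrite (bd_push (@base_cts_on RR Y) Mu) bd_bd linear0.
exists (push psi _ u), (push psi _ w), (push psi _ e0 - prism (repar to_middle) _ z); split.
- apply: chain_in_push Uu _ => x; rewrite /lower /psi height_repar // /interp clamp1.
  by rewrite subrr mul0r mul1r add0r /to_middle; have := height_le1 x;
  have := height_ge0 x; case: (leP (1 / 2) (3 / 2 * _)); case: (leP 0 ((3 * _ - 2) / 2)); lra.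
- apply: chain_in_push Ww _ => x; rewrite /upper /psi height_repar // /interp clamp1.
  by rewrite subrr mul0r mul1r add0r /to_middle; have := height_le1 x;
  have := height_ge0 x; case: (leP (1 / 2) (3 / 2 * _)); case: (leP 0 ((3 * _ - 2) / 2)); lra.
- have h := bd_prism (hom (fun _ => True)) Tz.
  rewrite linearB /= h bz linear0 subr0 (bd_push (psi_cts (fun _ => True))) //.
  have e1 : push ((@repar RR Y to_middle)^~ 0) _ z = z.
    by rewrite (eq_push (g := id) Tz) ?push_id // => x _; exact: repar0.
  rewrite e1 -linearD /= -e -he0 [push psi _ (z - _)]linearB /=.
  by rewrite addrA [X in X - _]addrC subrK subKr.
- rewrite (bd_push (psi_cts lower)) // (push_comp _ (@base_cts_on RR Y) Mu).
  apply: (eq_push Mu) => x [hl hu]; rewrite /psi repar1; congr pnt.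
  move: hl hu; rewrite /lower /upper /to_middle.
  by case: (leP (1 / 2) (3 / 2 * _)); case: (leP 0 ((3 * _ - 2) / 2)); lra.
Qed.

Lemma mid_cts_on U : cts_on RR U mid.
Proof. by apply: continuous_cts_on; exact: mid_continuous. Qed.

Lemma chain_in_mid k (y : Ch k Y) : chain_in middle (push mid k y).
Proof. by apply: (@chain_in_push _ _ _ _ (fun _ => True)) => // x _; exact: middle_mid. Qed.

(** The two cones over [y], glued along it. *)
Lemma susp_class_surj k (y : Ch k.+1 Y) : bd _ y = 0 ->
  exists2 z : Ch k.+2 X, bd _ z = 0 & susp_class z y.
Proof.
move=> by0; have Mm : chain_in middle (push mid _ y) by exact: chain_in_mid.
have b0 : bd _ (push mid _ y) = 0.
  by rewrite (@bd_push _ _ _ _ (fun _ => True)) ?by0 ?linear0 //; exact: mid_cts_on.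
have [|u Uu hu] := lower_bounds b0; first by apply: sub_on Mm => s h t; have [] := h t.
have [|w Ww hw] := upper_bounds b0; first by apply: sub_on Mm => s h t; have [] := h t.
exists (u - w); first by rewrite linearB /= -hu -hw subrr.
exists u, (- w), 0; split => //; first exact: onN.
by rewrite linear0 addr0.
Qed.

(** If the cycle [z] bounds a chain [c], splitting [c] shows that the common
    boundary of the two parts of [z] bounds in the intersection of the cones, hence
    in [Y] after projection. If [y] bounds [f], then [f], placed at height 1/2,
    turns both parts into cycles of contractible sets. *)
Lemma susp_class_bound k (z : Ch k.+2 X) (y : Ch k.+1 Y) :
  bd _ z = 0 -> bd _ y = 0 -> susp_class z y ->
  (exists e, z = bd _ e) <-> (exists f, y = bd _ f).
Proof.
move=> bz by0 [u [w [e [Uu Ww ze bu]]]]; split=> [[e' ze']|[f yf]].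
  have euw : u + w = bd _ (e' - e) by rewrite linearB /= -ze' ze addrK.
  have Tc : chain_in (fun _ => True) (e' - e) by [].
  have [N [c1 [c2 [ec Uc1 Wc2]]]] := small2 (@open_lower RR Y) (@open_upper RR Y)
    all_cover (fun _ _ h => h) (fun _ _ h => h) Tc.
  pose a := sdN N u - bd _ c1.
  have aE : a = bd _ c2 - sdN N w.
    apply/eqP; rewrite /a subr_eq addrAC -subr_eq opprK -linearD /= euw -bd_sdN ec.
    by rewrite linearD /= addrC.
  have Ma : chain_in middle a.
    apply: chain_in_middle; first by apply: onB; [exact: chain_in_sdN|exact: chain_in_bd].
    by rewrite aE; apply: onB; [exact: chain_in_bd|exact: chain_in_sdN].
  have Ty : chain_in (fun _ => True) y by [].
  have [e1 _ he1] := sdN_hlg N by0 Ty.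
  exists (e1 + push base _ a); rewrite linearD /= -he1.
  rewrite (bd_push (@base_cts_on RR Y) Ma) /a linearB /= bd_bd subr0 bd_sdN bu.
  rewrite -(@sdN_push _ _ _ _ (fun _ => True)) //; last exact: mid_cts_on.
  rewrite (@push_comp _ _ _ _ _ (fun _ => True)) //; last exact: mid_cts_on.
  rewrite (@eq_push _ _ _ _ (fun _ => True) _ id) ?push_id ?subrK // => x _.
  exact: base_mid.
have bm : bd _ (push mid _ f) = bd _ u.
  by rewrite bu yf (@bd_push _ _ _ _ (fun _ => True)) //; exact: mid_cts_on.
have bw : bd _ w = - bd _ u.
  apply/eqP; rewrite -addr_eq0 addrC -linearD /=.
  by have := bz; rewrite ze [X in X = _ -> _](linearD _ (u + w)) /= bd_bd addr0 => ->.
have Mf : chain_in middle (push mid _ f) by exact: chain_in_mid.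
have [|//|e1 _ he1] := @lower_bounds _ (u - push mid _ f).
  by rewrite linearB /= bm subrr.
  by apply: onB => //; apply: sub_on Mf => s h t; have [] := h t.
have [|//|e2 _ he2] := @upper_bounds _ (w + push mid _ f).
  by rewrite linearD /= bm bw addNr.
  by apply: onD => //; apply: sub_on Mf => s h t; have [] := h t.
exists (e1 + e2 + e); rewrite !linearD /= -he1 -he2 ze.
by rewrite [u - _ + _]addrACA addNr addr0.
Qed.

End SuspensionHomology.

(** * Disks *)

Section Disk.
Variables (RR : realType) (R : nzRingType) (n : nat).
Local Notation E := 'rV[RR]_n.
Local Notation disk := (@disk RR n).
Local Notation Ch := (@Ch RR R).

Implicit Types (x : E) (u : disk).

Definition enorm (x : E) : RR := Num.sqrt (\sum_i x ord0 i ^+ 2).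

Lemma enorm_ge0 x : 0 <= enorm x. Proof. exact: sqrtr_ge0. Qed.

Lemma enorm_continuous : continuous enorm.
Proof.
apply: cts_comp (@sqrt_continuous RR).
apply: sum_continuous => i.
have c : continuous (fun x : E => x ord0 i) by exact: coord_continuous.
have := mulr_cts c c.
by rewrite (_ : (fun x : E => x ord0 i * x ord0 i) = (fun x => x ord0 i ^+ 2)).
Qed.

Lemma enormZ a x : enorm (a *: x) = `|a| * enorm x.
Proof.
rewrite /enorm -sqrtr_sqr -sqrtrM ?sqr_ge0 // mulr_sumr.
by congr Num.sqrt; apply: eq_bigr => i _; rewrite mxE exprMn.
Qed.

Lemma enorm_gt0 x i : x ord0 i != 0 -> 0 < enorm x.
Proof.
move=> xi; rewrite sqrtr_gt0 (bigD1 i) //= ltr_pwDl ?sumr_ge0 // => [|j _].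
  by rewrite exprn_even_gt0.
exact: sqr_ge0.
Qed.

Lemma enorm_nonzero x : enorm x != 0 -> nonzero_below n x.
Proof.
move=> h; apply: contrapT => nz; move: h; rewrite /enorm big1 ?sqrtr0 ?eqxx // => i _.
have [->|xi] := eqVneq (x ord0 i) 0; first by rewrite expr0n.
by case: nz; exists i.
Qed.

Lemma diskE (x : E) : @Defs.disk RR n x <-> enorm x <= 1.
Proof.
suff -> : (enorm x <= 1) = (\sum_i x ord0 i ^+ 2 <= 1) by [].
by rewrite /enorm -{1}(@sqrtr1 RR) ler_sqrt ?ler01.
Qed.

Lemma disk_interiorE (x : disk) : disk_interior x <-> enorm (set_val x) < 1.
Proof.
rewrite /disk_interior.
suff -> : (enorm (set_val x) < 1) = (\sum_i (set_val x) ord0 i ^+ 2 < 1) by [].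
by rewrite /enorm -{1}(@sqrtr1 RR) ltr_sqrt ?ltr01.
Qed.

Lemma disk_le1 (x : disk) : enorm (set_val x) <= 1.
Proof. by apply/diskE; exact: (set_valP x). Qed.

Definition mk_disk (x : E) (h : enorm x <= 1) : disk := SigSub (mem_set ((diskE x).2 h)).

Lemma disk_compact : compact [set: disk].
Proof.
apply: compact_sub.
apply: (subclosed_compact _
  (@rV_compact _ _ (fun=> `[-1 : RR, 1]%classic) (fun=> @segment_compact _ _ _))).
  rewrite (_ : @Defs.disk RR n = [set x : E | enorm x <= 1]).
    by apply: closed_fle; exact: enorm_continuous.
  by apply/seteqP; split=> x /diskE.
move=> x /= dx i; rewrite /= in_itv /= -ler_norml.
rewrite -(@ler_pXn2r _ 2) ?nnegrE ?normr_ge0 ?ler01 // real_normK ?num_real // expr1n.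
apply: le_trans dx; rewrite (bigD1 i) //= lerDl.
by apply: sumr_ge0 => j _; apply: sqr_ge0.
Qed.

Lemma disk_nonint_closed : closed [set u : disk | ~ disk_interior u].
Proof.
rewrite (_ : [set _ | _] = [set u : disk | 1 <= enorm (set_val u)]).
  apply: closed_fge; apply: cts_comp enorm_continuous; exact: set_val_continuous.
by apply/seteqP; split=> u /=; rewrite disk_interiorE leNgt => /negP.
Qed.

Lemma disk_core_closed (a : RR) : closed [set u : disk | enorm (set_val u) <= a].
Proof. by apply: closed_fle; apply: cts_comp enorm_continuous; exact: set_val_continuous. Qed.

(** Radial expansion. The denominator is at least [1/3], hence positive also at
    the centre; at time 1 it is the norm of [u] as soon as that is at least [1/3],
    so that [u] is moved to the boundary sphere. *)
Definition expand_fun (u : disk) (r : RR) : E :=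
  (Num.max (1 - 2 / 3 * clamp r) (enorm (set_val u)))^-1 *: set_val u.

Lemma expand_den_gt0 (u : disk) r : 0 < Num.max (1 - 2 / 3 * clamp r) (enorm (set_val u)).
Proof. by rewrite lt_max; apply/orP; left; have := clamp_le1 r; lra. Qed.

Lemma enorm_expand (u : disk) r : enorm (expand_fun u r) =
  enorm (set_val u) / Num.max (1 - 2 / 3 * clamp r) (enorm (set_val u)).
Proof.
have d0 := expand_den_gt0 u r.
by rewrite enormZ ger0_norm ?invr_ge0 ?(ltW d0) // mulrC.
Qed.

Lemma expand_le1 (u : disk) r : enorm (expand_fun u r) <= 1.
Proof.
by rewrite enorm_expand ler_pdivrMr ?expand_den_gt0 // mul1r le_max lexx orbT.
Qed.

Definition expand (u : disk) (r : RR) : disk := mk_disk (expand_le1 u r).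

Lemma expand_continuous : continuous (fun p : disk * RR => expand p.1 p.2).
Proof.
apply: to_sub_continuous; apply: row_continuous => i.
have -> : (fun p : disk * RR => (set_val \o (fun p => expand p.1 p.2)) p ord0 i) =
  (fun p => (Num.max (1 - 2 / 3 * clamp p.2) (enorm (set_val p.1)))^-1 * set_val p.1 ord0 i).
  by apply/funext => p; rewrite /= /expand_fun mxE.
have c1 : continuous (fun p : disk * RR => set_val p.1).
  by apply: cts_comp; [exact: fst_cts|exact: set_val_continuous].
apply: mulr_cts; last exact: coord_cts.
apply: invr_cts => [|p]; last by rewrite gt_eqF ?expand_den_gt0.
apply: maxr_cts; last exact: cts_comp c1 enorm_continuous.
apply: subr_cts; first exact: cst_cts.
apply: mulr_cts; first exact: cst_cts.
by apply: clamp_cts; exact: snd_cts.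
Qed.

Lemma expand_boundary (u : disk) r : ~ disk_interior u -> expand u r = u.
Proof.
move=> /disk_interiorE/negP; rewrite -leNgt => h; apply: val_inj.
have e : enorm (set_val u) = 1 by apply/eqP; rewrite eq_le disk_le1.
rewrite [LHS]/= /expand_fun e (max_idPr _) ?invr1 ?scale1r //.
by have := clamp_ge0 r; lra.
Qed.

Lemma expand0 (u : disk) : expand u 0 = u.
Proof.
apply: val_inj; rewrite [LHS]/= /expand_fun clamp0 mulr0 subr0.
by rewrite (max_idPl _) ?disk_le1 // invr1 scale1r.
Qed.

Lemma expand1 (u : disk) : 1 / 3 <= enorm (set_val u) -> ~ disk_interior (expand u 1).
Proof.
move=> h; rewrite disk_interiorE -[set_val _]/(expand_fun u 1) enorm_expand clamp1.
have e0 : enorm (set_val u) != 0 by rewrite gt_eqF //; lra.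
by rewrite (max_idPr _) ?divff ?ltxx //; lra.
Qed.

(** Radial retraction of the complement of the origin onto a closed annulus. *)
Definition annulus_fun (x : E) : E :=
  (Num.max (1 / 3) (Num.min 1 (enorm x)) / enorm x) *: x.

Lemma enorm_annulus x : enorm x != 0 ->
  enorm (annulus_fun x) = Num.max (1 / 3) (Num.min 1 (enorm x)).
Proof.
move=> h; rewrite enormZ ger0_norm ?divfK //.
by rewrite divr_ge0 ?enorm_ge0 // le_max; apply/orP; left; lra.
Qed.

Lemma annulus_le1 x : enorm (annulus_fun x) <= 1.
Proof.
have [h|h] := eqVneq (enorm x) 0.
  by rewrite /annulus_fun h invr0 mulr0 enormZ normr0 mul0r ler01.
by rewrite enorm_annulus // ge_max ge_min lexx andbT; lra.
Qed.

Definition annulus (x : E) : disk := mk_disk (annulus_le1 x).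

Lemma annulus_ge x : nonzero_below n x -> 1 / 3 <= enorm (set_val (annulus x)).
Proof.
move=> [i _ xi]; rewrite -[set_val _]/(annulus_fun x) enorm_annulus ?le_max ?lexx //.
by rewrite gt_eqF // (enorm_gt0 xi).
Qed.

Lemma annulus_id (u : disk) : 1 / 3 <= enorm (set_val u) -> annulus (set_val u) = u.
Proof.
move=> h; apply: val_inj; rewrite [LHS]/= /annulus_fun.
rewrite (min_idPr _) ?disk_le1 // (max_idPr _) // divff ?scale1r //.
by rewrite gt_eqF //; lra.
Qed.

Lemma annulus_cts_on : cts_on RR (nonzero_below n) annulus.
Proof.
move=> k s Us; apply: to_sub_continuous; apply: row_continuous => i.
have -> : (fun t => (set_val \o (annulus \o s)) t ord0 i) =
  (fun t => Num.max (1 / 3) (Num.min 1 (enorm (s t))) / enorm (s t) * s t ord0 i).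
  by apply/funext => t; rewrite /= /annulus_fun mxE.
have sc : continuous s by exact: cts_fun.
have ec := cts_comp sc enorm_continuous.
apply: mulr_cts; last exact: coord_cts.
apply: mulr_cts.
  apply: maxr_cts; first exact: cst_cts.
  by apply: minr_cts; first exact: cst_cts.
apply: invr_cts => // t; have [j _ xj] := Us t.
by rewrite gt_eqF // (enorm_gt0 xj).
Qed.

Lemma disk0_proof : enorm 0 <= 1.
Proof. by rewrite -(scale0r 0) enormZ normr0 mul0r ler01. Qed.

Lemma shrink_proof (u : disk) r : enorm ((1 - clamp r) *: set_val u) <= 1.
Proof.
rewrite enormZ ger0_norm ?subr_ge0 ?clamp_le1 //.
by rewrite mulr_ile1 ?enorm_ge0 ?disk_le1 ?subr_ge0 ?clamp_le1 // gerBl clamp_ge0.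
Qed.

Lemma disk_bounds k (c : Ch k.+1 disk) : bd k c = 0 -> exists e, c = bd _ e.
Proof.
move=> bc; pose h (u : disk) r := mk_disk (shrink_proof u r).
have Tc : chain_in (fun _ => True) c by [].
have [||||//|e _ ->] := contract_bounds (U' := fun _ => True) (h := h)
  (p := mk_disk disk0_proof) _ _ _ _ _ bc Tc => //; last by exists e.
- move=> l s _; apply: to_sub_continuous; apply: row_continuous => i.
  have -> : (fun p : prod_cvx (simp_cvx RR l) (real_cvx RR) =>
     (set_val \o hmap h s) p ord0 i) =
    (fun p => (1 - clamp p.2) * set_val (s p.1) ord0 i).
    by apply/funext => p; rewrite /= mxE.
  apply: mulr_cts.
    apply: subr_cts; first exact: cst_cts.
    by apply: clamp_cts; exact: snd_cts.
  apply: coord_cts; apply: cts_comp (@set_val_continuous _ _).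
  by apply: cts_comp; [exact: fst_cts|exact: cts_fun].
- by move=> x _; apply: val_inj; rewrite /= clamp0 subr0 scale1r.
- by move=> x _; apply: val_inj; rewrite /= clamp1 subrr scale0r.
Qed.

End Disk.

(** * Vanishing of the homology of CW complexes *)

Section CW.
Variables (RR : realType) (R : nzRingType) (X : topologicalType) (K : cw_structure RR X).
Local Notation simp := (@simp RR).
Local Notation Ch := (@Ch RR R).
Local Notation simplex k X := (continuousType (simp k) X).
Local Notation disk n := (@disk RR n).
Local Notation cell := (cw_cell K).
Local Notation Phi := (@cw_char _ _ K _).

Definition open_cell n (e : cell n) (x : X) : Prop :=
  exists2 u : disk n, disk_interior u & Phi e u = x.

(** Indexed by the strict bound, so that [skel 0] is empty and induction can start
    there. *)
Definition skel k (x : X) : Prop :=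
  exists n, exists2 e : cell n, (n < k)%N & open_cell e x.

Lemma cell_dim m n (e : cell m) (f : cell n) x :
  open_cell e x -> open_cell f x -> m = n.
Proof. by move=> [u iu <-] [v iv /esym/(cw_disjoint iu iv)/(congr1 (@projT1 _ _))]. Qed.

Lemma char_inj n (e f : cell n) (u v : disk n) :
  disk_interior u -> disk_interior v -> Phi e u = Phi f v -> e = f /\ u = v.
Proof.
move=> iu iv /(cw_disjoint iu iv) h.
by have [-> ->] := @eq_from_Tagged nat (fun l => cell l * disk l)%type n (e, u) (f, v) h.
Qed.

Lemma cell_eq n (e f : cell n) x : open_cell e x -> open_cell f x -> e = f.
Proof. by move=> [u iu <-] [v iv /esym/(char_inj iu iv)[]]. Qed.

Lemma char_boundary n (e : cell n) (u : disk n) : ~ disk_interior u -> skel n (Phi e u).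
Proof.
move=> nu; have [k [c hc]] := cw_closure_finite e.
have [j [v [dj iv ->]]] := hc u nu.
by exists (tag (c j)), (tagged (c j)) => //; exists v.
Qed.

Lemma skelS k x : skel k x -> skel k.+1 x.
Proof. by move=> [n [e nk ex]]; exists n, e => //; apply: ltnW. Qed.

Lemma sub_skel k l x : (k <= l)%N -> skel k x -> skel l x.
Proof. by move=> kl [n [e nk ex]]; exists n, e => //; apply: leq_trans kl. Qed.

Lemma char_skel n (e : cell n) (u : disk n) : skel n.+1 (Phi e u).
Proof.
have [iu|/(char_boundary e)/skelS//] := pselect (disk_interior u).
by exists n, e => //; exists u.
Qed.

Lemma skel_not_open k (e : cell k) x : skel k x -> ~ open_cell e x.
Proof. by move=> [n [f nk fx]] ex; move: nk; rewrite (cell_dim fx ex) ltnn. Qed.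

Lemma open_cell_char n (e : cell n) (u : disk n) :
  open_cell e (Phi e u) -> disk_interior u.
Proof.
by move=> h; apply: contrapT => /(char_boundary e) /skel_not_open; apply; exact: h.
Qed.

(** Images of closed sets are compact, and the complex is Hausdorff; this makes the
    coordinates in an open cell continuous. *)
Lemma char_image_closed n (e : cell n) (C : set (disk n)) : closed C -> closed (Phi e @` C).
Proof.
move=> cC; apply: compact_closed; first exact: cw_hausdorff K.
apply: continuous_compact.
  by apply: continuous_subspaceT => u; exact: cw_char_continuous.
by apply: (subclosed_compact cC (@disk_compact RR n)).
Qed.

(** A skeleton has the weak topology of its own cells: by closure finiteness,
    the part of a set [B] in the boundary of a higher cell lies in finitely many
    compact images of lower cells. *)
Lemma skel_closed k (B : set X) : B `<=` skel k ->
  (forall n (e : cell n), (n < k)%N -> closed (Phi e @^-1` B)) -> closed B.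
Proof.
move=> Bk hB; apply: (@cw_weak _ _ K) => n; have [m] := ubnP n.
elim: m n => // m IH n /ltnSE nm e; have [nk|kn] := ltnP n k; first exact: hB.
have [l [c hc]] := cw_closure_finite e.
pose B' := \bigcup_(j in [set j : 'I_l | (tag (c j) < n)%N])
  (Phi (tagged (c j)) @` (Phi (tagged (c j)) @^-1` B)).
have cB' : closed B'.
  apply: closed_bigcup; first exact: finite_finset.
  move=> j jn; apply: char_image_closed; apply: IH.
  exact: leq_trans jn nm.
have -> : Phi e @^-1` B = [set u | ~ disk_interior u] `&` Phi e @^-1` B'.
  apply/seteqP; split=> u /=.
    move=> Bu; have nu : ~ disk_interior u.
      move=> iu; have [p [f pk fx]] := Bk _ Bu.
      have ex : open_cell e (Phi e u) by exists u.
      by move: pk; rewrite (cell_dim fx ex) ltnNge kn.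
    split=> //; have [j [v [dj iv E]]] := hc u nu.
    by exists j => //; exists v => //=; rewrite -E.
  by move=> [_ [j _ [v Bv <-]]].
apply: closedI; first exact: disk_nonint_closed.
by apply: preimage_closed => // u _; exact: cw_char_continuous.
Qed.

Section Step.
Variable k : nat.
Local Notation kcell := (cell k).

Lemma skelSP x : skel k.+1 x -> skel k x \/ exists e : kcell, open_cell e x.
Proof.
move=> [n [e]]; rewrite ltnS leq_eqVlt => /orP[/eqP nk|nk ex]; last by left; exists n, e.
by case: _ / nk in e * => ex; right; exists e.
Qed.

(** The centre of the disk serves as a default value outside of the cell. *)
Definition coord (e : kcell) (x : X) : disk k :=
  if pselect (open_cell e x) is left h then projT1 (cid2 h) else mk_disk (disk0_proof RR k).

Lemma coordP (e : kcell) x : open_cell e x ->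
  disk_interior (coord e x) /\ Phi e (coord e x) = x.
Proof.
rewrite /coord; case: pselect => // h _.
by case: (cid2 h).
Qed.

Lemma coord_char (e : kcell) (u : disk k) : disk_interior u -> coord e (Phi e u) = u.
Proof.
move=> iu; have [|iv E] := @coordP e (Phi e u); first by exists u.
by have [_] := char_inj iv iu E.
Qed.

Lemma coord_cts_on (e : kcell) : cts_on RR (open_cell e) (coord e).
Proof.
move=> l s es; apply/continuous_closedP => C cC.
rewrite (_ : _ @^-1` C = s @^-1` (Phi e @` C)).
  apply: preimage_closed; last exact: char_image_closed.
  by move=> t _; exact: cts_fun.
have sE t : Phi e (coord e (s t)) = s t by have [] := coordP (es t).
apply/seteqP; split=> t /=; first by move=> Ct; exists (coord e (s t)).
move=> [u Cu us]; rewrite -us coord_char //.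
by apply: (@open_cell_char _ e); rewrite us; exact: es.
Qed.

Lemma skelS_closed (B : set X) : B `<=` skel k.+1 ->
  (forall n (e : cell n), (n < k)%N -> closed (Phi e @^-1` B)) ->
  (forall e : kcell, closed (Phi e @^-1` B)) -> closed B.
Proof.
move=> Bk Bn Be; apply: (skel_closed Bk) => n f.
rewrite ltnS leq_eqVlt => /orP[/eqP nk|]; last exact: Bn.
by move: f; rewrite nk => f; apply: Be.
Qed.

Lemma lower_char_not_open n (e : cell n) (u : disk n) (f : kcell) :
  (n < k)%N -> ~ open_cell f (Phi e u).
Proof. by move=> nk; apply: skel_not_open; apply: sub_skel nk (char_skel e u). Qed.

(** Concentric parts of all the [k]-cells. *)
Definition core (P : pred RR) (x : X) : Prop :=
  exists e : kcell, exists2 u, P (enorm (set_val u)) & Phi e u = x.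

Section Core.
Variable P : pred RR.
Hypothesis P1 : forall r, P r -> r < 1.

Lemma core_open_cell (e : kcell) u : P (enorm (set_val u)) -> open_cell e (Phi e u).
Proof. by move=> /P1 h; exists u => //; apply/disk_interiorE. Qed.

Lemma core_char (e : kcell) u : core P (Phi e u) -> P (enorm (set_val u)).
Proof.
move=> [f [v Pv E]]; have fv := core_open_cell f Pv.
have iv : disk_interior v by exact: open_cell_char fv.
have [iu|nu] := pselect (disk_interior u).
  by have [_ <-] := char_inj iv iu E.
by have := skel_not_open (char_boundary e nu); rewrite -E => /(_ _ fv).
Qed.

End Core.

Lemma core_closed (a : RR) : a < 1 -> closed (core (fun r => r <= a)).
Proof.
move=> a1; have P1 r : r <= a -> r < 1 by move=> h; exact: le_lt_trans h a1.
apply: skelS_closed => [x [e [u _ <-]]|n f nk|e]; first exact: char_skel.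
  rewrite (_ : _ @^-1` _ = set0); first exact: closed0.
  rewrite -subset0 => u [e [v Pv E]]; apply: (lower_char_not_open nk (e := f) (u := u)).
  by rewrite -E; exact: (core_open_cell P1 e Pv).
rewrite (_ : _ @^-1` _ = [set u | enorm (set_val u) <= a]).
  exact: disk_core_closed.
apply/seteqP; split=> u /=; first exact: (core_char P1).
by move=> h; exists e, u.
Qed.

Lemma skel_minus_closed (e : kcell) : closed [set x | skel k.+1 x /\ ~ open_cell e x].
Proof.
apply: skelS_closed => [x []//|n f nk|f].
  rewrite (_ : _ @^-1` _ = setT); first exact: closedT.
  apply/seteqP; split=> // u _; split; last exact: lower_char_not_open.
  exact: sub_skel (leq_trans nk (leqnSn _)) (char_skel f u).
have [ef|ef] := pselect (e = f).
  rewrite (_ : _ @^-1` _ = [set u | ~ disk_interior u]); first exact: disk_nonint_closed.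
  apply/seteqP; split=> u /=; rewrite -ef.
    by move=> [_ h] iu; apply: h; exists u.
  by move=> h; split; [exact: char_skel|move=> /open_cell_char].
rewrite (_ : _ @^-1` _ = setT); first exact: closedT.
apply/seteqP; split=> // u _; split; first exact: char_skel.
move=> eu; have iu : disk_interior u.
  apply: contrapT => nu; exact: skel_not_open (char_boundary f nu) eu.
by apply: ef; apply: (cell_eq eu); exists u.
Qed.

(** The points that radial expansion moves into the lower skeleton. *)
Definition outer (x : X) : Prop := skel k.+1 x /\ ~ core (fun r => r < 1 / 3) x.

Lemma third_lt1 (r : RR) : r < 1 / 3 -> r < 1. Proof. by lra. Qed.

Lemma outer_char (e : kcell) u : 1 / 3 <= enorm (set_val u) -> outer (Phi e u).
Proof.
move=> h; split; first exact: char_skel.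
by move=> /(core_char third_lt1); rewrite ltNge h.
Qed.

Lemma outer_coord (e : kcell) x : open_cell e x -> outer x ->
  1 / 3 <= enorm (set_val (coord e x)).
Proof.
move=> ex [_ nc]; rewrite leNgt; apply/negP => h; apply: nc.
by exists e, (coord e x) => //; have [] := coordP ex.
Qed.

(** ** Pushing a cycle out of the cells *)

Definition in_cell (e : kcell) m (s : simplex m X) : Prop := forall t, open_cell e (s t).
Definition is_outer m (s : simplex m X) : Prop := forall t, outer (s t).

(** The cover consists of the open [k]-cells and of the complement of the closed
    cores of radius [1/3]. These sets are open in the skeleton only, hence the
    ambient open sets obtained by complementing closed subsets of the skeleton. *)
Lemma outer_subdivision m (c : Ch m.+1 X) : chain_in (skel k.+1) c ->
  exists N, on (fun s : simplex m.+1 X => is_outer s \/ exists e, in_cell e s) (sdN N c).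
Proof.
move=> Sc.
pose U (i : option kcell) : set X := if i is Some e
  then ~` [set x | skel k.+1 x /\ ~ open_cell e x]
  else ~` core (fun r => r <= 1 / 3).
have oU i : open (U i).
  case: i => [e|]; rewrite openC; first exact: skel_minus_closed.
  by apply: core_closed; lra.
have [|N sN] := @small_chains RR R X _ U oU m c.
  apply: sub_on Sc => s ss t.
  have [[e et]|ne] := pselect (exists e : kcell, open_cell e (s t)).
    by exists (Some e) => -[].
  exists None => -[e [u hu us]]; apply: ne; exists e, u => //.
  by apply/disk_interiorE; lra.
exists N; apply: sub_on (on_and sN (chain_in_sdN Sc)) => s [[[e|] hs] ss].
  right; exists e => t; apply: contrapT => h; apply: (hs t); split=> //; exact: ss.
left=> t; split; first exact: ss.
by move=> [e [u hu us]]; apply: (hs t); exists e, u => //; exact: ltW.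
Qed.

(** The part of a cycle in one open cell can be replaced by a chain in the outer
    part of that cell: its boundary lies in an annulus, and bounds there for
    reasons of dimension. *)
Lemma cell_replace d (e : kcell) (w : Ch d.+2 X) : (k <= d)%N ->
  on (in_cell e (m := d.+2)) w -> on (is_outer (m := d.+1)) (bd _ w) ->
  exists2 v, on (is_outer (m := d.+2)) v & exists f, w = v + bd _ f.
Proof.
move=> kd ew oa.
have cw : chain_in (open_cell e) w by [].
have ca : chain_in (fun x => open_cell e x /\ outer x) (bd _ w).
  by apply: sub_on (on_and (chain_in_bd cw) oa) => s [h1 h2] t; split.
have cc := @coord_cts_on e.
have b0 : bd _ (push (coord e) _ w) = push (coord e) _ (bd _ w).
  by rewrite (bd_push cc cw).
pose a' := push (set_val : disk k -> 'rV[RR]_k) _ (push (coord e) _ (bd _ w)).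
have vc U : cts_on RR U (set_val : disk k -> 'rV[RR]_k).
  by apply: continuous_cts_on; exact: set_val_continuous.
have ea : chain_in (fun u : disk k => 1 / 3 <= enorm (set_val u)) (push (coord e) _ (bd _ w)).
  by apply: chain_in_push ca _ => x [ex ox]; exact: outer_coord.
have [||||e' ne' he'] := @punctured_bounds RR R k k d a'.
- exact: leqnn.
- exact: kd.
- rewrite /a' (bd_push (vc _) ea) -b0.
  have Tb : chain_in (fun _ => True) (push (coord e) _ w) by [].
  by rewrite bd_bd linear0.
- apply: chain_in_push ea _ => u h; apply: enorm_nonzero.
  by rewrite gt_eqF //; apply: lt_le_trans h; lra.
have annc := @annulus_cts_on RR k.
pose v' := push (@annulus RR k) _ e'.
have hv' : bd _ v' = push (coord e) _ (bd _ w).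
  rewrite /v' (bd_push annc ne') -he' /a' (push_comp _ (vc _) ea).
  rewrite (eq_push (g := id) ea) ?push_id // => u; exact: annulus_id.
have Pc U : cts_on RR U (Phi e).
  by apply: continuous_cts_on; exact: cw_char_continuous.
have Tv : chain_in (fun u : disk k => 1 / 3 <= enorm (set_val u)) v'.
  by apply: chain_in_push ne' _ => x; exact: annulus_ge.
exists (push (Phi e) _ v').
  by apply: (@chain_in_push _ _ _ _ _ outer _ _ _ Tv) => u; exact: outer_char.
have [|f hf] := @disk_bounds RR R k _ (push (coord e) _ w - v').
  by rewrite linearB /= hv' b0 subrr.
exists (push (Phi e) _ f).
rewrite (@bd_push _ _ _ _ (fun _ => True)) // -hf linearB /= addrC subrK.
rewrite (push_comp _ cc cw) (eq_push (g := id) cw) ?push_id // => x ex /=.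
by have [] := coordP ex.
Qed.

(** The cells are treated one at a time, by induction on the number of simplices
    that are not yet outer. The boundary of the part [w] of the cycle in the cell
    [e] is outer: it is opposite to the boundary of the rest, and a simplex of the
    rest that is not outer lies in another cell. *)
Lemma push_outer d (z : Ch d.+2 X) : (k <= d)%N -> bd _ z = 0 ->
  on (fun s : simplex d.+2 X => is_outer s \/ exists e, in_cell e s) z ->
  exists z', [/\ bd _ z' = 0, chain_in outer z' & exists f, z = z' + bd _ f].
Proof.
move=> kd.
pose bad (s : simplex d.+2 X) := ~~ `[< is_outer s >].
have [n] := ubnP (size [seq s <- supp z | bad s]).
elim: n z => // n IH z /ltnSE hn bz oz.
have [[s sz bs]|nbad] := pselect (exists2 s, s \in supp z & bad s); last first.
  exists z; split=> //; last by exists 0; rewrite linear0 addr0.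
  move=> s sz; apply: contrapT => ns; apply: nbad; exists s => //.
  by apply/asboolPn.
have [e es] : exists e, in_cell e s.
  by case: (oz s sz) => // os; move/asboolPn: bs.
pose w := restr R (in_cell e (m := d.+2)) z; pose r := z - w.
have rw : z = r + w by rewrite subrK.
have coefr b : fcoef r b = if `[< in_cell e b >] then 0 else fcoef z b.
  rewrite /r fcoefD fcoefN fcoef_restr; case: ifP => _; first by rewrite subrr.
  by rewrite subr0.
have or : on (fun b => is_outer b \/ exists2 e', e' <> e & in_cell e' b) r.
  move=> b; rewrite suppE coefr; case: asboolP => [_|ne h]; first by rewrite eqxx.
  have zb : b \in supp z by rewrite suppE.
  case: (oz b zb) => [ob|[e' ib]]; first by left.
  by right; exists e' => // ee'; apply: ne; rewrite -ee'.
have ow : on (is_outer (m := d.+1)) (bd _ w).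
  have h1 : chain_in (open_cell e) (bd _ w) by apply: chain_in_bd; exact: on_restr.
  have bwr : bd _ w = - bd _ r.
    by apply/eqP; rewrite -addr_eq0 addrC -linearD /= -rw bz.
  have h2 : on (fun b : simplex d.+1 X => is_outer b \/ exists2 e', e' <> e & in_cell e' b)
      (bd _ w).
    rewrite bwr; apply: onN; apply: on_linext or _ => b hb.
    apply: on_sum => i _; apply: onZ; case: hb => [ob|[e' ne' ib]].
      have h : chain_in outer (sx R (b \o cof i)) by apply: chain_in_sx => t; exact: ob.
      by apply: sub_on h => b' ob'; left.
    have h : chain_in (open_cell e') (sx R (b \o cof i)) by apply: chain_in_sx => t; exact: ib.
    by apply: sub_on h => b' ib'; right; exists e'.
  apply: sub_on (on_and h1 h2) => b [eb [//|[e' ne' ib]]].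
  by case: ne'; apply: cell_eq (ib (unif RR d)) (eb (unif RR d)).
have [v ov [f wf]] : exists2 v, on (is_outer (m := d.+2)) v & exists f, w = v + bd _ f.
  exact: (cell_replace kd (@on_restr _ _ _ z) ow).
have zf : z = (r + v) + bd _ f by rewrite -addrA -wf.
have bv : bd _ (r + v) = 0.
  by have := bz; rewrite {1}zf linearD /= bd_bd addr0.
have [||z' [bz' oz' [f' zf']]] := IH (r + v) _ bv.
- apply: leq_trans hn.
  rewrite -[X in (X < _)%N]/(size _) -[X in (X <= _)%N]/(size (s :: [seq s <- supp (r + v) | bad s])).
  apply: uniq_leq_size => [|b].
    rewrite /= filter_uniq ?supp_uniq // andbT mem_filter bs /= suppE fcoefD coefr.
    rewrite (asboolT es) add0r -suppE; apply/negP => /ov os.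
    by move/asboolPn: bs.
  rewrite inE => /orP[/eqP ->|]; rewrite !mem_filter ?bs //.
  move=> /andP[bb bs']; rewrite bb /=; move/asboolPn: bb => bb.
  move: bs'.
  have b0 : fcoef v b = 0.
    have [//|nb] := eqVneq (fcoef v b) 0; case: (bb).
    have bv' : b \in supp v by rewrite suppE.
    exact: ov bv'.
  by rewrite !suppE fcoefD b0 addr0 coefr; case: ifP => // _; rewrite eqxx.
- move=> b; rewrite suppE fcoefD => h.
  have [b0|/negP b0] := boolP (b \in supp v); first by left; apply: ov.
  have [|ob|[e' _ ib]] := or b; [|by left|by right; exists e'].
  move: b0; rewrite suppE => /negP; rewrite negbK => /eqP b0.
  by rewrite suppE; move: h; rewrite b0 addr0.
exists z'; split=> //; exists (f' + f).
by rewrite linearD /= addrA -zf'.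
Qed.

(** Radial expansion fixes the boundary spheres, so that the expansions of all the
    [k]-cells fit together with the identity of the lower skeleton. *)
Definition blow (x : X) (r : RR) : X :=
  if pselect (exists e : kcell, open_cell e x) is left h then
    let e := projT1 (cid h) in Phi e (expand (coord e x) r)
  else x.

Lemma blow_char (e : kcell) u r : blow (Phi e u) r = Phi e (expand u r).
Proof.
rewrite /blow; case: pselect => [h|ne].
  case: (cid h) => f /= fu; have [iu|nu] := pselect (disk_interior u).
    have ef : f = e by apply: (cell_eq fu); exists u.
    by rewrite ef coord_char.
  by case: (skel_not_open (char_boundary e nu) fu).
have nu : ~ disk_interior u by move=> iu; apply: ne; exists e, u.
by rewrite expand_boundary.
Qed.

Lemma blow_lower n (e : cell n) u r : (n < k)%N -> blow (Phi e u) r = Phi e u.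
Proof.
move=> nk; rewrite /blow; case: pselect => // h.
by have [f /(lower_char_not_open nk)] := h.
Qed.

Lemma blow_skel x r : skel k x -> blow x r = x.
Proof. by move=> [n [e nk [u _ <-]]]; exact: blow_lower. Qed.

Lemma blow_homotopy U : (forall x, U x -> skel k.+1 x) -> homotopy_on blow U.
Proof.
move=> Uk l s Us.
pose I := {n & {e : cell n | (n < k.+1)%N}}.
apply: (@tube_continuous RR X X (simp l) I (fun i => disk (projT1 i))
  (fun i => Phi (proj1_sig (projT2 i))) (skel k.+1) blow s).
- by move=> [n [e nk]] u /=; exact: sub_skel nk (char_skel e u).
- move=> x [n [e nk [u _ <-]]].
  by exists (existT _ n (exist _ e nk)), u.
- move=> B Bk hB; apply: (skel_closed Bk) => n e nk.
  exact: (hB (existT _ n (exist _ e nk))).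
- move=> [n [e nk]] /=; have Pc m (f : cell m) : continuous (Phi f).
    exact: cw_char_continuous.
  move: nk; rewrite ltnS leq_eqVlt => /orP[/eqP nk'|nk'].
    move: e; rewrite nk' => e.
    rewrite (_ : (fun _ => _) = (fun p : disk k * RR => Phi e (expand p.1 p.2))); last first.
      by apply/funext => p; rewrite blow_char.
    exact: cts_comp (@expand_continuous RR k) (Pc _ e).
  rewrite (_ : (fun _ => _) = (fun p : disk n * RR => Phi e p.1)); last first.
    by apply/funext => p; rewrite blow_lower.
  by apply: cts_comp (Pc _ e); exact: fst_cts.
- exact: cts_fun.
- by move=> t; apply: Uk.
Qed.

Lemma blow0 x : skel k.+1 x -> blow x 0 = x.
Proof.
move=> /skelSP[|[e ex]]; first exact: blow_skel.
by have [_ <-] := coordP ex; rewrite blow_char expand0.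
Qed.

Lemma blow1 x : outer x -> skel k (blow x 1).
Proof.
move=> ox; have [|[e ex]] := skelSP ox.1; first by move=> h; rewrite blow_skel.
have [_ <-] := coordP ex; rewrite blow_char.
by apply/char_boundary/expand1/outer_coord.
Qed.

(** Stated relative to the vanishing for [skel k], which is the induction
    hypothesis of the theorem that follows. *)
Lemma outer_bounds d (z : Ch d.+2 X) :
  (forall c : Ch d.+2 X, bd _ c = 0 -> chain_in (skel k) c -> exists e, c = bd _ e) ->
  bd _ z = 0 -> chain_in outer z -> exists e, z = bd _ e.
Proof.
move=> H bz oz.
have hom : homotopy_on blow outer by apply: blow_homotopy => x [].
have c1 : cts_on RR outer (blow^~ 1).
  move=> l s Us.
  apply: (@cts_comp _ (prod_cvx (simp_cvx RR l) (real_cvx RR)) _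
    (fun t => (t, 1)) (hmap blow s) _ (hom l s Us)).
  by apply: pair_cts; [move=> t; exact: cvg_id|exact: cst_cts].
have [||e he] := H (push (blow^~ 1) _ z).
- by rewrite (bd_push c1 oz) bz linear0.
- by apply: chain_in_push oz _ => x; exact: blow1.
exists (e - prism blow _ z).
rewrite linearB /= -he (bd_prism hom oz) bz linear0 subr0.
rewrite (eq_push (f := blow^~ 0) (g := id) oz) ?push_id ?subKr // => x [sx _].
exact: blow0.
Qed.

End Step.

(** Subdivision, replacement inside the cells and radial expansion bring a cycle
    into the next lower skeleton, without changing its class. *)
Theorem skel_bounds k m (c : Ch m.+1 X) : (k <= m)%N -> bd _ c = 0 ->
  chain_in (skel k) c -> exists e, c = bd _ e.
Proof.
elim: k m c => [|k IH] m c km bc Sc.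
  exists 0; rewrite linear0; apply: chain_in_False.
  by apply: sub_on Sc => s h t; have [n [e]] := h t.
case: m c km bc Sc => // m c; rewrite ltnS => km bc Sc.
have [N oN] := outer_subdivision Sc.
have [e _ he] := sdN_hlg N bc Sc.
have bN : bd _ (sdN N c) = 0 by rewrite bd_sdN bc linear0.
have [z [bz oz [f hf]]] := push_outer km bN oN.
have [|g hg] := outer_bounds _ bz oz.
  by move=> c' bc' Sc'; apply: IH Sc' => //; exact: leq_trans km (leqnSn m).
by exists (e + (g + f)); rewrite !linearD /= -he -hg -hf subrK.
Qed.

Lemma all_skel d : (forall n, cell n -> (n <= d)%N) -> forall x : X, skel d.+1 x.
Proof.
by move=> hd x; have [n [e [u [iu <-]]]] := cw_cover K x; exists n, e; [apply: hd|exists u].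
Qed.

End CW.

(** * The reduced homology modules *)

(* The comparison with the given complex of malg chains relies on conversion. *)
Transparent fm bas linext.

Section QuotientIso.
Variables (R : nzRingType) (M N : lmodType R) (A : submodule M) (B : submodule N).

(** Stated for a correspondence, since [susp_class] does not choose the cycle that
    it assigns to another one. *)
Lemma quot_iso (r : M -> N -> Prop) :
  (forall a x x' y y', r x y -> r x' y' -> r (a *: x + x') (a *: y + y')) ->
  (forall x, exists y, r x y) -> (forall y, exists x, r x y) ->
  (forall x y, r x y -> A x <-> B y) ->
  exists (f : quot_of A -> quot_of B) (g : quot_of B -> quot_of A),
    [/\ (forall a u v, f (a *: u + v) = a *: f u + f v), cancel f g & cancel g f].
Proof.
move=> rL rT rS rAB.
have subM x y x' y' : r x y -> r x' y' -> r (x - x') (y - y') by move=> h h';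
  rewrite -[x - _]addrC -[y - _]addrC -!scaleN1r; apply: rL.
have quotD (L : lmodType R) (C : submodule L) a (x y : L) :
    a *: \pi_(quot_of C) x + \pi_(quot_of C) y = \pi_(quot_of C) (a *: x + y).
  by rewrite -quot_addE -quot_scaleE.
pose f (u : quot_of A) := \pi_(quot_of B) (projT1 (cid (rT (repr u)))).
pose g (v : quot_of B) := \pi_(quot_of A) (projT1 (cid (rS (repr v)))).
have fE x y : r x y -> f (\pi_(quot_of A) x) = \pi_(quot_of B) y.
  move=> rxy; rewrite /f; case: cid => y' /= ry'; apply/quot_eqP.
  apply/(rAB _ _ (subM _ _ _ _ ry' rxy)); apply/quot_eqP.
  by rewrite reprK.
have gE x y : r x y -> g (\pi_(quot_of B) y) = \pi_(quot_of A) x.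
  move=> rxy; rewrite /g; case: cid => x' /= rx'; apply/quot_eqP.
  apply/(rAB _ _ (subM _ _ _ _ rx' rxy)); apply/quot_eqP.
  by rewrite reprK.
exists f, g; split.
- move=> a; elim/quot_ofW => x; elim/quot_ofW => x'.
  have [y rxy] := rT x; have [y' rxy'] := rT x'.
  by rewrite quotD (fE _ _ (rL a _ _ _ _ rxy rxy')) (fE _ _ rxy) (fE _ _ rxy') quotD.
- by elim/quot_ofW => x; have [y rxy] := rT x; rewrite (fE _ _ rxy) (gE _ _ rxy).
- by elim/quot_ofW => y; have [x rxy] := rS y; rewrite (gE _ _ rxy) (fE _ _ rxy).
Qed.

Lemma quot_trivial : (forall x : M, A x) -> forall u : quot_of A, u = 0.
Proof.
move=> hA; elim/quot_ofW => x.
by rewrite -[RHS]/(\pi_(quot_of A) 0); apply/quot_eqP.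
Qed.

End QuotientIso.

Section Bridge.
Variables (RR : realType) (R : comNzRingType).
Local Notation simp := (@simp RR).
Local Notation Ch := (@Ch RR R).
Implicit Types X Y : topologicalType.

Lemma face_sx X n (s : sing_simplex RR X n.+1) (i : 'I_n.+2) :
  bas (face i s) = sx R (k := n.+1) ((s : simp n.+2 -> X) \o @cof RR n.+1 i) :> Ch n.+1 X.
Proof.
rewrite -(sxE R (face i s : continuousType (simp n.+1) X)); congr sx.
by apply/funext => t; rewrite /=; congr (s _); apply: val_inj.
Qed.

Lemma boundaryE X n (c : chains RR R X n.+1) :
  boundary c = bd n.+1 (c : Ch n.+2 X).
Proof.
apply: (fm_ext (f := linext (fun s : sing_simplex RR X n.+1 =>
   \sum_(i < n.+2) (-1) ^+ i *: bas (face i s) : Ch n.+1 X)) (g := bd n.+1)) => s.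
rewrite linext_bas bdU; apply: eq_bigr => i _.
by rewrite face_sx.
Qed.

Lemma simp0_empty : simp 0 -> False.
Proof. by move=> t; have := simp_sum t; rewrite big_ord0 => /esym/eqP; rewrite oner_eq0. Qed.

(** In degree 0 the augmentation is the coefficient of the boundary on the only
    map from the empty simplex. *)
Lemma is_cycleE X n (c : chains RR R X n) :
  is_cycle c <-> bd n (c : Ch n.+1 X) = 0.
Proof.
case: n c => [|n] c; last by rewrite /is_cycle boundaryE.
pose g (t : simp 0) : X := False_rect X (simp0_empty t).
have gc : continuous g by move=> t; case: (simp0_empty t).
have [s sg _] := sx_cts R gc.
have bE : bd 0 (c : Ch 1 X) = augmentation c *: bas s.
  rewrite [in LHS](fm_expand (c : Ch 1 X)) linear_sum /=.
  rewrite /augmentation -/(linext_fun (fun=> 1) c) -/(linext (M := R^o) (fun=> 1) c).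
  rewrite linextE scaler_suml; apply: eq_bigr => b _.
  rewrite linearZ /= bdU big_ord1 expr0 scale1r -[_ *: (1 : R^o)]/(_ * 1) mulr1 -sxE.
  by congr (_ *: sx R _); apply/funext => t; case: (simp0_empty t).
rewrite bE /=; split=> [->|/(congr1 (fun d => fcoef d s))]; first by rewrite scale0r.
by rewrite fcoefZ fcoef_bas eqxx mulr1 fcoef0.
Qed.

Lemma cycleP X n (z : cycles RR R X n) : bd n (submod_val z : Ch n.+1 X) = 0.
Proof. by apply/is_cycleE; exact/asboolP/(submod_valP z). Qed.

Lemma cycle_of X n (c : Ch n.+1 X) : bd n c = 0 ->
  exists z : cycles RR R X n, submod_val z = c.
Proof.
move=> /is_cycleE/asboolP h.
by exists (@SubmodOf _ _ (Submodule (@is_cycle0 _ _ _ _) (@Defs.is_cycleP _ _ _ _)) c h).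
Qed.

Lemma is_boundaryE X n (z : cycles RR R X n) :
  is_boundary z <-> exists e, (submod_val z : Ch n.+1 X) = bd _ e.
Proof. by split=> -[e he]; exists e; move: he; rewrite boundaryE => ->. Qed.

Theorem suspension_iso Y (y0 : Y) n :
  exists (f : reduced_homology RR R (suspension RR Y) n.+1 -> reduced_homology RR R Y n) g,
    [/\ is_linear f, cancel f g & cancel g f].
Proof.
apply: (quot_iso (r := fun (z : cycles RR R (suspension RR Y) n.+1) (y : cycles RR R Y n) =>
   susp_class (submod_val z : Ch n.+2 _) (submod_val y : Ch n.+1 Y))).
- by move=> a z z' y y'; exact: susp_class_linear.
- move=> z; have [c bc zc] := susp_class_total (cycleP z).
  by have [y yE] := cycle_of bc; exists y; rewrite yE.
- move=> y; have [c bc zc] := susp_class_surj y0 (cycleP y).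
  by have [z zE] := cycle_of bc; exists z; rewrite zE.
- move=> z y h; apply: (iff_trans (is_boundaryE z)).
  apply: (iff_trans _ (iff_sym (is_boundaryE y))).
  exact: (susp_class_bound y0 (cycleP z) (cycleP y) h).
Qed.

(** Transported from the suspension, whose homology vanishes above its dimension. *)
Theorem homology_above_dimension Y (y0 : Y) q n :
  has_dimension RR (suspension RR Y) q.+1 -> (q < n)%N ->
  forall u : reduced_homology RR R Y n, u = 0.
Proof.
move=> [K [hK _]] qn; apply: quot_trivial => y; apply/is_boundaryE.
have [z bz zy] := susp_class_surj y0 (cycleP y).
apply/(susp_class_bound y0 bz (cycleP y) zy).
apply: (@skel_bounds RR R _ K q.+2 n.+1 z) => //.
by move=> s _ t; exact: all_skel hK _.
Qed.

(** A choice of paths to [y0] defines a homotopy from the identity of the 0-chains to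
    the augmentation. *)
Theorem homology0_connected Y :
  simply_connected RR Y -> forall u : reduced_homology RR R Y 0, u = 0.
Proof.
move=> [[y0 _] pc _]; apply: quot_trivial => z; apply/is_boundaryE.
pose path y := projT1 (cid (pc y y0)).
have pathP y : [/\ {within `[0, 1], continuous (path y)}, path y 0 = y & path y 1 = y0].
  by rewrite /path; case: cid.
pose sigma y (t : simp 2) : Y := path y (set_val t ord0 ord0).
have sigma_cts y : continuous (sigma y).
  have [/subspace_continuousP pcts _ _] := pathP y.
  move=> t U /=; set a := set_val t ord0 ord0 => hU.
  have aI (u : simp 2) : `[0, 1]%classic (set_val u ord0 ord0).
    rewrite /= in_itv /= simp_ge0 -(simp_sum u) big_ord_recl lerDl.
    by apply: sumr_ge0 => i _; exact: simp_ge0.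
  have /= hn := pcts a (aI t) U hU.
  have ct : continuous (fun u : simp 2 => set_val u ord0 ord0).
    exact/coord_cts/set_val_continuous.
  have hu : nbhs t (fun u : simp 2 => `[0, 1]%classic (set_val u ord0 ord0) ->
      U (path y (set_val u ord0 ord0))) by exact: (ct t _ hn).
  by apply: (filterS _ hu) => u /= h; exact/h/aI.
pose D : {linear Ch 1 Y -> Ch 2 Y} :=
  linext (fun s : continuousType (simp 1) Y => sx R (sigma (s (unif RR 0)))).
pose A : {linear Ch 0 Y -> Ch 1 Y} := linext (fun _ => sx R (cst y0)).
have h (c : Ch 1 Y) : c = bd 1 (D c) + A (bd 0 c).
  apply: (fm_ext (f := idfun) (g := (bd 1 \o D) \+ (A \o bd 0))) => s /=.
  have [_ p0 p1] := pathP (s (unif RR 0)).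
  rewrite /D linext_bas bd_sx // bdU big_ord1 expr0 scale1r.
  have -> : A (sx R (s \o cof ord0)) = sx R (cst y0).
    have [|s' -> _] := @sx_cts RR R Y 0 (s \o cof ord0); last by rewrite /A linext_bas.
    by move=> t; case: (simp0_empty t).
  rewrite big_ord_recl big_ord1 expr0 expr1 scale1r scaleN1r.
  have <- : sx R (cst y0) = sx R (sigma (s (unif RR 0)) \o cof (lift ord0 ord0)).
    congr sx; apply/funext => t; rewrite /= /sigma /=.
    rewrite mxE; have -> : ord0 = lift (lift ord0 ord0) ord0 :> 'I_2 by apply: val_inj.
    by rewrite liftK /= -p1 -(simp_sum t) big_ord1.
  rewrite subrK -(sxE R s).
  congr sx; apply/funext => t; rewrite /= /sigma /= mxE unlift_none p0.
  congr (s _); apply: simp_inj; apply/rowP => i; rewrite !mxE [i]ord1 invr1.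
  by rewrite -(simp_sum t) big_ord1.
exists (D (submod_val z)).
by rewrite {1}(h (submod_val z)) cycleP linear0 addr0.
Qed.

End Bridge.

(** * Tensor algebras *)

Section AlgebraMorphisms.
Variables (R : comNzRingType) (V : nat -> lmodType R).
Local Notation T := (tens V).

(** Elements of the tensor algebra are classes of terms; this hides the terms. *)
Lemma tens_ind (K : T -> Prop) :
  (forall a, K a%:A) -> (forall n (v : V n), K (tens_gen v)) ->
  (forall x y, K x -> K y -> K (x + y)) -> (forall x y, K x -> K y -> K (x * y)) ->
  forall x, K x.
Proof.
move=> Ks Kg KD KM; elim/tensW; elim=> [a|n v|x IHx y IHy|x IHx y IHy].
- have -> : \pi_T (TScal V a) = a%:A by rewrite -[RHS]/(tens_mul _ _) tens_mulr1.
  exact: Ks.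
- exact: Kg.
- have -> : \pi_T (TAdd x y) = \pi_T x + \pi_T y by rewrite -[RHS]/(tens_add _ _) tens_addE.
  exact: KD.
- have -> : \pi_T (TMul x y) = \pi_T x * \pi_T y by rewrite -[RHS]/(tens_mul _ _) tens_mulE.
  exact: KM.
Qed.

Lemma is_linearD (M N : lmodType R) (f : M -> N) x y : is_linear f -> f (x + y) = f x + f y.
Proof. by move=> fL; have := fL 1 x y; rewrite !scale1r. Qed.

Lemma is_linearZ (M N : lmodType R) (f : M -> N) a x : is_linear f -> f (a *: x) = a *: f x.
Proof. by move=> fL; have := fL a x 0; rewrite !addr0 (is_linear_0 fL) addr0. Qed.

Lemma is_linearB (M N : lmodType R) (f : M -> N) x y : is_linear f -> f (x - y) = f x - f y.
Proof. by move=> fL; rewrite -!scaleN1r is_linearD // is_linearZ. Qed.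

Lemma is_linear_compose (M N P : lmodType R) (f : N -> P) (g : M -> N) :
  is_linear f -> is_linear g -> is_linear (f \o g).
Proof. by move=> fL gL a x y /=; rewrite gL fL. Qed.

Lemma alg_scal (C C' : algType R) (f : C -> C') a :
  is_linear f -> monoid_morphism f -> f a%:A = a%:A.
Proof. by move=> fL [f1 _]; rewrite is_linearZ // f1. Qed.

Lemma alg_ext (C : algType R) (f g : T -> C) :
  is_linear f -> monoid_morphism f -> is_linear g -> monoid_morphism g ->
  (forall n (v : V n), f (tens_gen v) = g (tens_gen v)) -> f =1 g.
Proof.
move=> fL fM gL gM fg; apply: tens_ind => [a||x y hx hy|x y hx hy].
- by rewrite !alg_scal.
- exact: fg.
- by rewrite !is_linearD // hx hy.
- by case: fM gM => [_ fM] [_ gM]; rewrite fM gM hx hy.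
Qed.

Lemma monoid_comp (C D E : pzRingType) (f : D -> E) (g : C -> D) :
  monoid_morphism f -> monoid_morphism g -> monoid_morphism (f \o g).
Proof. by move=> [f1 fM] [g1 gM]; split=> [|x y] /=; rewrite ?g1 ?f1 // gM fM. Qed.

Lemma scalRE (a : R) : a *: (1 : R^o) = a.
Proof. exact: mulr1. Qed.

Definition aug_term : tterm V -> R^o := tterm_lift (A := R^o) (fun n (_ : V n) => 0).
Definition aug : T -> R^o := tens_lift (A := R^o) (fun n (_ : V n) => 0).

Fact aug_family n : is_linear (fun _ : V n => 0 : R^o).
Proof. by move=> a x y; rewrite scaler0 addr0. Qed.

Lemma aug_term_cong x y : tcong x y -> aug_term x = aug_term y.
Proof. exact: (tterm_lift_cong aug_family). Qed.

Lemma aug_pi x : aug (\pi_T x) = aug_term x.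
Proof. exact: (tens_lift_pi aug_family). Qed.

Lemma aug_linear : is_linear aug. Proof. exact/tens_lift_linear/aug_family. Qed.
Lemma aug_monoid : monoid_morphism aug. Proof. exact/tens_lift_monoid/aug_family. Qed.
Lemma aug_gen n (v : V n) : aug (tens_gen v) = 0.
Proof. exact/tens_lift_gen/aug_family. Qed.

Lemma aug_homog n x : homog n x -> (0 < n)%N -> aug x = 0.
Proof.
elim=> [//|{}n v _|{}n {}x y _ IHx _ IHy n0|m {}n {}x y _ IHx _ IHy].
- exact: aug_gen.
- by rewrite (is_linearD _ _ aug_linear) IHx // IHy // addr0.
- rewrite addn_gt0 aug_monoid.2 => /orP[h|h]; first by rewrite IHx // mul0r.
  by rewrite IHy // mulr0.
Qed.

(** The derivation along the augmentation that extends [f] reads off the linear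
    part of an element. It vanishes on the decomposables, and takes the place of a
    direct sum decomposition of the tensor algebra by length. *)
Section LinearPart.
Variables (W : lmodType R) (f : forall n, V n -> W).
Hypothesis f_linear : forall n, is_linear (@f n).

Fixpoint tterm_lin (x : tterm V) : W :=
  match x with
  | TScal _ => 0
  | TGen _ v => f v
  | TAdd x y => tterm_lin x + tterm_lin y
  | TMul x y => aug_term x *: tterm_lin y + aug_term y *: tterm_lin x
  end.

Lemma tterm_lin_cong x y : tcong x y -> tterm_lin x = tterm_lin y.
Proof.
elim=> //= {x y}.
- by move=> *; congruence.
- by move=> x x' y y' _ -> _ ->.
- by move=> x x' y y' /aug_term_cong -> -> /aug_term_cong -> ->.
- by move=> *; rewrite addrA.
- by move=> *; rewrite addrC.
- by move=> *; rewrite add0r.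
- by move=> x; rewrite scaler0 addr0 scalRE scaleN1r addNr.
- move=> x y z; rewrite !scalerDr !scalerA addrA.
  by congr (_ + _ *: _ + _ *: _); rewrite mulrC.
- by move=> x; rewrite scaler0 addr0 scalRE scale1r.
- by move=> x y z; rewrite scalerDl scalerDr addrACA.
- by move=> x y z; rewrite scalerDr scalerDl addrACA.
- by move=> *; rewrite addr0.
- by move=> *; rewrite !scaler0 addr0.
- by move=> a x; rewrite scaler0 addr0 add0r.
- by move=> n a v w; rewrite f_linear scalRE scaler0 addr0.
Qed.

Definition tens_lin (u : T) : W := tterm_lin (repr u).

Lemma tens_lin_pi x : tens_lin (\pi_T x) = tterm_lin x.
Proof. by apply: tterm_lin_cong; apply/tens_eqP; rewrite reprK. Qed.

Lemma tens_lin_gen n (v : V n) : tens_lin (tens_gen v) = f v.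
Proof. exact: tens_lin_pi. Qed.

Lemma tens_linD x y : tens_lin (x + y) = tens_lin x + tens_lin y.
Proof.
elim/tensW: x => x; elim/tensW: y => y.
by rewrite -[_ + _]/(tens_add _ _) tens_addE !tens_lin_pi.
Qed.

Lemma tens_linM x y : tens_lin (x * y) = aug x *: tens_lin y + aug y *: tens_lin x.
Proof.
elim/tensW: x => x; elim/tensW: y => y.
by rewrite -[_ * _]/(tens_mul _ _) tens_mulE !tens_lin_pi !aug_pi.
Qed.

Lemma tens_lin_scal a : tens_lin a%:A = 0.
Proof.
have -> : a%:A = \pi_T (TScal V a) by rewrite -[LHS]/(tens_mul _ _) tens_mulr1.
by rewrite tens_lin_pi.
Qed.

Lemma tens_lin_linear : is_linear tens_lin.
Proof.
move=> a x y; rewrite tens_linD -mulr_algl tens_linM tens_lin_scal scaler0 addr0.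
by rewrite (alg_scal _ aug_linear aug_monoid) scalRE.
Qed.

Lemma tens_pos_aug (x : T) : tens_pos _ x -> aug x = 0.
Proof.
elim=> [|a y z [n hy] _ IH]; first exact: is_linear_0 aug_linear.
by rewrite aug_linear IH addr0 (aug_homog hy) // scaler0.
Qed.

Lemma tens_lin_decomp (x : T) : tens_decomp _ x -> tens_lin x = 0.
Proof.
elim=> [|a u z [y [y' [py py' ->]]] _ IH]; first exact: is_linear_0 tens_lin_linear.
by rewrite tens_lin_linear IH tens_linM !tens_pos_aug // !scale0r !addr0 scaler0.
Qed.

End LinearPart.

Lemma homog_pos n (x : T) : (0 < n)%N -> homog n x -> tens_pos _ x.
Proof.
case: n => // n _ hx; rewrite -[x]scale1r -[_ *: x]addr0.
by apply: in_spanD; [exists n|exact: in_span0].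
Qed.

Lemma decompM (x y : T) : tens_pos _ x -> tens_pos _ y -> tens_decomp _ (x * y).
Proof.
move=> px py; rewrite -[_ * _]scale1r -[_ *: (x * y)]addr0.
by apply: in_spanD; [exists x, y|exact: in_span0].
Qed.

Lemma submD (M : lmodType R) (W : submodule M) x y : W x -> W y -> W (x + y).
Proof. by rewrite -{2}[x]scale1r; exact: submoduleP. Qed.

Lemma submZ (M : lmodType R) (W : submodule M) a x : W x -> W (a *: x).
Proof. by move=> Wx; rewrite -[_ *: _]addr0; apply: submoduleP => //; exact: submodule0. Qed.

Lemma submB (M : lmodType R) (W : submodule M) x y : W x -> W y -> W (x - y).
Proof. by move=> Wx Wy; rewrite -scaleN1r; apply/submD/submZ. Qed.

End AlgebraMorphisms.

Section GradedMorphisms.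
Variables (R : comNzRingType) (V W : nat -> lmodType R).

(** Generalises [graded_alg_morph] to two different modules, in order to cover the
    inclusion of a subalgebra and the projection onto it. *)
Definition gmorph (f : tens V -> tens W) :=
  [/\ is_linear f, monoid_morphism f & forall n x, homog n x -> homog n (f x)].

Lemma lift_gmorph (f : forall n, V n -> tens W) :
  (forall n, is_linear (@f n)) -> (forall n v, homog n (@f n v)) -> gmorph (tens_lift f).
Proof.
move=> fL fH; have lL := tens_lift_linear fL; have lM := tens_lift_monoid fL.
split=> // n x; elim=> {n x} [a|n v|n x y _ hx _ hy|m n x y _ hx _ hy].
- by rewrite alg_scal //; exact: homog_scal.
- by rewrite tens_lift_gen.
- by rewrite is_linearD //; exact: homog_add.
- by rewrite lM.2; exact: homog_mul.
Qed.

Lemma gmorph_pos f x : gmorph f -> tens_pos _ x -> tens_pos _ (f x).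
Proof.
move=> [fL _ fH]; elim=> [|a y z [n hy] _ IH]; first by rewrite is_linear_0 //; exact: in_span0.
by rewrite fL; apply: in_spanD IH; exists n; exact: fH.
Qed.

Lemma gmorph_decomp f x : gmorph f -> tens_decomp _ x -> tens_decomp _ (f x).
Proof.
move=> fG; have [fL fM _] := fG.
elim=> [|a u z [y [y' [py py' ->]]] _ IH]; first by rewrite is_linear_0 //; exact: in_span0.
rewrite fL fM.2; apply: submoduleP IH; apply: decompM; exact: gmorph_pos.
Qed.

End GradedMorphisms.

Lemma gmorph_comp (R : comNzRingType) (U V W : nat -> lmodType R)
    (f : tens V -> tens W) (g : tens U -> tens V) :
  gmorph f -> gmorph g -> gmorph (f \o g).
Proof.
move=> [fL fM fH] [gL gM gH]; split; first exact: is_linear_compose.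
  exact: monoid_comp.
by move=> n x /gH/fH.
Qed.

Section Connected.
Variables (R : comNzRingType) (V : nat -> lmodType R).
Hypothesis V0 : forall v : V 0, v = 0.

Lemma homog0_scal x : homog 0 x -> exists a, x = a%:A :> tens V.
Proof.
move Em : 0%N => m hx; elim: hx Em => {m x} [a _|n v Em|n x y _ IHx _ IHy Em|m n x y _ IHx _ IHy].
- by exists a.
- move: v; rewrite -Em => v; rewrite (V0 v); exists 0.
  by rewrite scale0r is_linear_0 //; exact: tens_gen_is_linear.
- have [a ->] := IHx Em; have [b ->] := IHy Em; exists (a + b); by rewrite scalerDl.
- move=> /esym/eqP; rewrite addn_eq0 => /andP[/eqP m0 /eqP n0].
  have [a ->] := IHx (esym m0); have [b ->] := IHy (esym n0); exists (a * b).
  by rewrite mulr_algl scalerA.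
Qed.

(** Without generators in degree 0 or from degree [n] on, an element of degree [n]
    can only be a sum of products of elements of positive degree. *)
Lemma decomp_above n x : (0 < n)%N -> (forall m, (n <= m)%N -> forall v : V m, v = 0) ->
  homog n x -> tens_decomp _ (x : tens V).
Proof.
move=> n0 Vn hx; suff : (n <= n)%N -> tens_decomp V x by exact.
elim: {2}n x / hx => [a h|m v nm|m x y _ IHx _ IHy nm|m k x y hx IHx hy IHy nm].
- by move: n0; rewrite leqn0 in h; rewrite (eqP h).
- rewrite (Vn _ nm v) is_linear_0; [exact: in_span0|exact: tens_gen_is_linear].
- by apply: submD; [exact: IHx|exact: IHy].
- have [m0|m0] := posnP m.
    move: hx; rewrite m0 => /homog0_scal[a ->]; rewrite mulr_algl; apply: submZ.
    by apply: IHy; rewrite m0 in nm.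
  have [k0|k0] := posnP k.
    move: hy; rewrite k0 => /homog0_scal[a ->]; rewrite mulr_algr; apply: submZ.
    by apply: IHx; rewrite k0 addn0 in nm.
  by apply: decompM; [exact: homog_pos m0 hx|exact: homog_pos k0 hy].
Qed.

(** Acting trivially on the indecomposables can be tested on generators, by the
    Leibniz rule modulo decomposables. *)
Lemma star_of_gen f : graded_alg_morph f ->
  (forall n (v : V n), (0 < n)%N -> tens_decomp _ (f (tens_gen v) - tens_gen v)) ->
  graded_alg_morph_star f.
Proof.
move=> fG fgen; split=> // x.
have [fL fM fH] := fG.
have fh n y : homog n y -> (0 < n)%N -> tens_decomp _ (f y - y).
  elim=> {n y} [//|n v|n y z _ IHy _ IHz n0|m n y z hy IHy hz IHz].
  - exact: fgen.
  - by rewrite (is_linearD _ _ fL) opprD addrACA; apply: submD; [exact: IHy|exact: IHz].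
  - have [m0|m0] := posnP m.
      move: hy; rewrite m0 => /homog0_scal[a ->] n0.
      by rewrite mulr_algl (is_linearZ _ _ fL) -scalerBr; apply/submZ/IHz.
    have [n0|n0 _] := posnP n.
      move: hz; rewrite n0 addn0 => /homog0_scal[a ->] _.
      by rewrite mulr_algr (is_linearZ _ _ fL) -scalerBr; apply/submZ/IHy.
    have py := homog_pos m0 hy; have pz := homog_pos n0 hz.
    by rewrite fM.2; apply: submB; apply: decompM => //; exact: gmorph_pos.
elim=> [|a y z [n hy] _ IH]; first by rewrite is_linear_0 // subrr; exact: in_span0.
rewrite fL opprD addrACA -scalerBr; apply: submoduleP IH.
exact: fh hy _.
Qed.

End Connected.

(** * Graded endomorphisms as triangular matrices *)

Section Truncation.
Variables (R : comNzRingType) (V : nat -> lmodType R) (q : nat).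

Definition b_in n : below V q n -> V n :=
  (if (n < q)%N as b return (if b then V n else 'rV[R]_0 : lmodType R) -> V n
   then id else fun=> 0).

Definition b_out n : V n -> below V q n :=
  (if (n < q)%N as b return V n -> (if b then V n else 'rV[R]_0 : lmodType R)
   then id else fun=> 0).

Lemma b_in_linear n : is_linear (@b_in n).
Proof. by rewrite /b_in /below; case: (n < q)%N => a x y //; rewrite scaler0 addr0. Qed.

Lemma b_out_linear n : is_linear (@b_out n).
Proof. by rewrite /b_out /below; case: (n < q)%N => a x y //; rewrite scaler0 addr0. Qed.

Lemma b_inK n : cancel (@b_in n) (@b_out n).
Proof.
rewrite /b_in /b_out /below; case: (n < q)%N => w //.
by rewrite [w]thinmx0.
Qed.

Lemma b_outK n : (n < q)%N -> cancel (@b_out n) (@b_in n).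
Proof. by rewrite /b_in /b_out /below => nq; case: (n < q)%N nq => //. Qed.

Lemma below_trivial n : (q <= n)%N -> forall w : below V q n, w = 0.
Proof. by rewrite /below leqNgt; case: (n < q)%N => // _ w; rewrite [w]thinmx0. Qed.

(** Confines the transport along [n = q] that is needed to single out degree [q]. *)
Definition at_deg (T : Type) (h : V q -> T) (g : forall n, V n -> T) n : V n -> T :=
  match n =P q with
  | ReflectT e => fun v => h (ecast m (V m) e v)
  | ReflectF _ => @g n
  end.

Lemma at_deg_eq T h g v : @at_deg T h g q v = h v.
Proof. by rewrite /at_deg; case: eqP => // e; rewrite eq_axiomK. Qed.

Lemma at_deg_neq T h g n v : n != q -> @at_deg T h g n v = g n v.
Proof. by rewrite /at_deg; case: eqP. Qed.

Lemma at_deg_linear (M : lmodType R) (h : V q -> M) g n :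
  is_linear h -> (forall m, is_linear (@g m)) -> is_linear (@at_deg M h g n).
Proof.
move=> hL gL; have [->|nq] := eqVneq n q => a x y; first by rewrite !at_deg_eq hL.
by rewrite !at_deg_neq // gL.
Qed.

Local Notation A := (tens V).
Local Notation B := (tens (below V q)).

Definition tincl : B -> A := tens_lift (fun n (w : below V q n) => tens_gen (b_in w)).
Definition tproj : A -> B := tens_lift (fun n (v : V n) => tens_gen (b_out v)).

Fact tincl_family n : is_linear (fun w : below V q n => tens_gen (b_in w)).
Proof. exact: is_linear_compose (@tens_gen_is_linear _ _ _) (@b_in_linear n). Qed.
Fact tproj_family n : is_linear (fun v : V n => tens_gen (b_out v)).
Proof. exact: is_linear_compose (@tens_gen_is_linear _ _ _) (@b_out_linear n). Qed.

Lemma tincl_gmorph : gmorph tincl.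
Proof. by apply: lift_gmorph tincl_family _ => n w; exact: homog_gen. Qed.
Lemma tproj_gmorph : gmorph tproj.
Proof. by apply: lift_gmorph tproj_family _ => n w; exact: homog_gen. Qed.

Lemma tincl_gen n (w : below V q n) : tincl (tens_gen w) = tens_gen (b_in w).
Proof. exact: (tens_lift_gen tincl_family). Qed.
Lemma tproj_gen n (v : V n) : tproj (tens_gen v) = tens_gen (b_out v).
Proof. exact: (tens_lift_gen tproj_family). Qed.

Lemma tincl_linear : is_linear tincl. Proof. by case: tincl_gmorph. Qed.
Lemma tproj_linear : is_linear tproj. Proof. by case: tproj_gmorph. Qed.
Lemma tincl_monoid : monoid_morphism tincl. Proof. by case: tincl_gmorph. Qed.
Lemma tproj_monoid : monoid_morphism tproj. Proof. by case: tproj_gmorph. Qed.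

Lemma tinclK : cancel tincl tproj.
Proof.
apply: (alg_ext (f := tproj \o tincl) (g := id)) => //.
- exact: is_linear_compose tproj_linear tincl_linear.
- exact: monoid_comp tproj_monoid tincl_monoid.
- by move=> n w; rewrite /= tincl_gen tproj_gen b_inK.
Qed.

Lemma gen0 (W : nat -> lmodType R) n : tens_gen (0 : W n) = 0.
Proof. exact: is_linear_0 (@tens_gen_is_linear _ _ _). Qed.

(** Below degree [q] there is no room for generators of degree [q]. *)
Lemma tprojK n x : homog n x -> (n < q)%N -> tincl (tproj x) = x.
Proof.
have iL := tincl_linear; have pL := tproj_linear.
have iM := tincl_monoid; have pM := tproj_monoid.
elim=> {n x} [a _|n v nq|n x y _ IHx _ IHy nq|m n x y _ IHx _ IHy mnq].
- by rewrite (alg_scal _ pL pM) (alg_scal _ iL iM).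
- by rewrite tproj_gen tincl_gen b_outK.
- by rewrite (is_linearD _ _ pL) (is_linearD _ _ iL) IHx ?IHy.
- rewrite pM.2 iM.2 IHx ?IHy //; first exact: leq_ltn_trans (leq_addl _ _) mnq.
  exact: leq_ltn_trans (leq_addr _ _) mnq.
Qed.

(** The coordinate on the generators of degree [q]. *)
Definition topq : A -> V q := tens_lin (at_deg id (fun _ _ => 0)).

Fact topq_family n : is_linear (@at_deg (V q) id (fun _ _ => 0) n).
Proof. by apply: at_deg_linear => // m a x y; rewrite scaler0 addr0. Qed.

Lemma topq_linear : is_linear topq. Proof. exact: tens_lin_linear topq_family. Qed.

Lemma topq_gen (v : V q) : topq (tens_gen v) = v.
Proof. by rewrite /topq (tens_lin_gen topq_family) at_deg_eq. Qed.

Lemma topqM x y : topq (x * y) = aug x *: topq y + aug y *: topq x.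
Proof. exact: tens_linM topq_family _ _. Qed.

Lemma topq_scal a : topq a%:A = 0.
Proof. exact: tens_lin_scal topq_family _. Qed.

Lemma topq_tincl b : topq (tincl b) = 0.
Proof.
have iL := tincl_linear; have iM := tincl_monoid; have tL := topq_linear.
elim/tens_ind: b => [a|n w|x y hx hy|x y hx hy].
- by rewrite (alg_scal _ iL iM) topq_scal.
- rewrite tincl_gen; have [e|nq] := eqVneq n q; last first.
    by rewrite /topq (tens_lin_gen topq_family) at_deg_neq.
  have -> : w = 0 by apply: below_trivial; rewrite e.
  by rewrite (is_linear_0 (@b_in_linear n)) gen0 is_linear_0.
- by rewrite (is_linearD _ _ iL) (is_linearD _ _ tL) hx hy addr0.
- by rewrite iM.2 topqM hx hy !scaler0 addr0.
Qed.

Hypothesis V0 : forall v : V 0, v = 0.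
Hypothesis Vbig : forall n, (q < n)%N -> forall v : V n, v = 0.

(** A product of elements of positive degree only involves generators of degree
    less than [q], so that generators of degree [q] can only occur linearly. This
    makes graded endomorphisms triangular. *)
Lemma homog_split n x : homog n x -> n = q -> x = tens_gen (topq x) + tincl (tproj x).
Proof.
have iL := tincl_linear; have pL := tproj_linear.
have iM := tincl_monoid; have pM := tproj_monoid; have tL := topq_linear.
have gL := @tens_gen_is_linear R V q.
have scalH a y : y = tens_gen (topq y) + tincl (tproj y) ->
    a *: y = tens_gen (topq (a *: y)) + tincl (tproj (a *: y)).
  move=> {1}->.
  by rewrite (is_linearZ _ _ tL) (is_linearZ _ _ gL) (is_linearZ _ _ pL)
             (is_linearZ _ _ iL) scalerDr.
elim=> {n x} [a _|n v nq|n x y _ IHx _ IHy nq|m n x y hx IHx hy IHy mnq].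
- by rewrite topq_scal gen0 add0r (alg_scal _ pL pM) (alg_scal _ iL iM).
- move: v; rewrite nq => v; rewrite topq_gen tproj_gen.
  by rewrite [b_out v]below_trivial // gen0 is_linear_0 // addr0.
- rewrite {1}(IHx nq) {1}(IHy nq) (is_linearD _ _ tL) (is_linearD _ _ gL).
  by rewrite (is_linearD _ _ pL) (is_linearD _ _ iL) addrACA.
- have [m0|m0] := posnP m.
    move: hx; rewrite m0 => /(homog0_scal V0)[a ->]; rewrite mulr_algl.
    by apply/scalH/IHy; rewrite m0 in mnq.
  have [n0|n0] := posnP n.
    move: hy; rewrite n0 => /(homog0_scal V0)[a ->]; rewrite mulr_algr.
    by apply/scalH/IHx; rewrite n0 addn0 in mnq.
  rewrite topqM (aug_homog hx m0) (aug_homog hy n0) !scale0r addr0 gen0 add0r.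
  rewrite pM.2 iM.2 (tprojK hx) ?(tprojK hy) // -mnq.
    by rewrite -{1}[n]add0n ltn_add2r.
  by rewrite -{1}[m]addn0 ltn_add2l.
Qed.

(** ** The three components of a graded endomorphism *)

(** With respect to the decomposition into the generators of degree [q] and the
    subalgebra generated below, [comp_top] and [comp_low] are the diagonal entries of
    [f] and [comp_mid] is the remaining one; the subalgebra is stable
    ([endo_tincl]). The three lemmas on compositions are the multiplication of
    triangular matrices. *)
Definition comp_top (f : A -> A) (v : V q) : V q := topq (f (tens_gen v)).
Definition comp_mid (f : A -> A) (v : V q) : B := tproj (f (tens_gen v)).
Definition comp_low (f : A -> A) : B -> B := tproj \o f \o tincl.

Lemma endo_gen f v : gmorph f ->
  f (tens_gen v) = tens_gen (comp_top f v) + tincl (comp_mid f v).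
Proof. by move=> [_ _ fH]; apply: homog_split => //; apply: fH; exact: homog_gen. Qed.

Lemma endo_tincl f b : gmorph f -> f (tincl b) = tincl (comp_low f b).
Proof.
move=> [fL fM fH]; have iL := tincl_linear; have pL := tproj_linear.
have iM := tincl_monoid; have pM := tproj_monoid.
apply: (alg_ext (f := f \o tincl) (g := tincl \o comp_low f)).
- exact: is_linear_compose.
- exact: monoid_comp.
- by do 3?apply: is_linear_compose.
- by do 3?apply: monoid_comp.
- move=> n w; rewrite /comp_low /=; have [nq|qn] := ltnP n q.
    by rewrite (tprojK (n := n)) //; apply: fH; rewrite tincl_gen; exact: homog_gen.
  by rewrite (below_trivial qn w) gen0 !is_linear_0.
Qed.

Lemma comp_top_linear f : gmorph f -> is_linear (comp_top f).
Proof.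
move=> [fL _ _]; apply: is_linear_compose topq_linear _.
exact: is_linear_compose fL (@tens_gen_is_linear _ _ _).
Qed.

Lemma comp_mid_linear f : gmorph f -> is_linear (comp_mid f).
Proof.
move=> [fL _ _]; apply: is_linear_compose tproj_linear _.
exact: is_linear_compose fL (@tens_gen_is_linear _ _ _).
Qed.

Lemma comp_mid_homog f v : gmorph f -> homog q (comp_mid f v).
Proof. by move=> [_ _ fH]; case: tproj_gmorph => _ _; apply; apply: fH; exact: homog_gen. Qed.

Lemma comp_low_gmorph f : gmorph f -> gmorph (comp_low f).
Proof.
move=> fG; apply: gmorph_comp (gmorph_comp tproj_gmorph fG) tincl_gmorph.
Qed.

Lemma comp_topM f g v : gmorph f -> gmorph g ->
  comp_top (f \o g) v = comp_top f (comp_top g v).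
Proof.
move=> fG gG; have [fL _ _] := fG.
rewrite {1}/comp_top /= (endo_gen v gG) (is_linearD _ _ fL) (endo_tincl _ fG).
by rewrite (is_linearD _ _ topq_linear) topq_tincl addr0.
Qed.

Lemma comp_midM f g v : gmorph f -> gmorph g ->
  comp_mid (f \o g) v = comp_mid f (comp_top g v) + comp_low f (comp_mid g v).
Proof.
move=> fG gG; have [fL _ _] := fG.
rewrite {1}/comp_mid /= (endo_gen v gG) (is_linearD _ _ fL) (endo_tincl _ fG).
by rewrite (is_linearD _ _ tproj_linear) tinclK.
Qed.

Lemma comp_lowM f g b : gmorph f -> gmorph g ->
  comp_low (f \o g) b = comp_low f (comp_low g b).
Proof. by move=> fG gG; rewrite {1}/comp_low /= (endo_tincl _ gG) (endo_tincl _ fG) tinclK. Qed.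

Lemma comp_top_id v : comp_top id v = v. Proof. exact: topq_gen. Qed.
Lemma comp_mid_id v : comp_mid id v = 0.
Proof. by rewrite /comp_mid tproj_gen [b_out v]below_trivial // gen0. Qed.
Lemma comp_low_id b : comp_low id b = b. Proof. exact: tinclK. Qed.

Lemma endo_ext f g : gmorph f -> gmorph g -> comp_top f =1 comp_top g ->
  comp_mid f =1 comp_mid g -> comp_low f =1 comp_low g -> f =1 g.
Proof.
move=> fG gG et em el; have [fL fM fH] := fG; have [gL gM gH] := gG.
apply: alg_ext => // n v; case: (ltngtP n q) => [nq|qn|nq].
- have -> : tens_gen v = tincl (tens_gen (b_out v)) by rewrite tincl_gen b_outK.
  by rewrite (endo_tincl _ fG) (endo_tincl _ gG) el.
- by rewrite (Vbig qn v) gen0 !is_linear_0.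
- by move: v; rewrite nq => v; rewrite (endo_gen _ fG) (endo_gen _ gG) et em.
Qed.

(** ** Endomorphisms with given components *)

Section Assemble.
Variables (a : V q -> V q) (h : V q -> B) (g : B -> B).

Definition assemble : A -> A :=
  tens_lift (at_deg (fun v => tens_gen (a v) + tincl (h v))
                    (fun n v => tincl (g (tens_gen (b_out v))))).

Hypotheses (aL : is_linear a) (hL : is_linear h) (hH : forall v, homog q (h v)).
Hypothesis gG : gmorph g.

Fact assemble_family n : is_linear (@at_deg A (fun v => tens_gen (a v) + tincl (h v))
                    (fun n v => tincl (g (tens_gen (b_out v)))) n).
Proof.
apply: at_deg_linear => [c x y|m c x y].
  by rewrite aL hL tens_gen_is_linear tincl_linear scalerDr addrACA.
have [gL _ _] := gG.
by rewrite b_out_linear tens_gen_is_linear gL tincl_linear.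
Qed.

Lemma assemble_top v : assemble (tens_gen v) = tens_gen (a v) + tincl (h v).
Proof. by rewrite /assemble (tens_lift_gen assemble_family) at_deg_eq. Qed.

Lemma assemble_neq n (v : V n) : n != q ->
  assemble (tens_gen v) = tincl (g (tens_gen (b_out v))).
Proof. by move=> nq; rewrite /assemble (tens_lift_gen assemble_family) at_deg_neq. Qed.

Lemma assemble_gmorph : gmorph assemble.
Proof.
have [_ _ iH] := tincl_gmorph; have [_ _ gH] := gG.
apply: lift_gmorph assemble_family _ => n v; have [e|nq] := eqVneq n q.
  move: v; rewrite e => v; rewrite at_deg_eq.
  by apply: homog_add; [exact: homog_gen|exact: iH].
by rewrite at_deg_neq //; apply/iH/gH/homog_gen.
Qed.

Lemma comp_assemble_top v : comp_top assemble v = a v.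
Proof.
by rewrite /comp_top assemble_top (is_linearD _ _ topq_linear) topq_tincl addr0 topq_gen.
Qed.

Lemma comp_assemble_mid v : comp_mid assemble v = h v.
Proof.
rewrite /comp_mid assemble_top (is_linearD _ _ tproj_linear) tinclK tproj_gen.
by rewrite [b_out _]below_trivial // gen0 add0r.
Qed.

Lemma comp_assemble_low b : comp_low assemble b = g b.
Proof.
have [gL gM _] := gG; have [cL cM _] := comp_low_gmorph assemble_gmorph.
apply: alg_ext => // n w; rewrite /comp_low /= tincl_gen.
have [nq|qn] := ltnP n q; first by rewrite assemble_neq ?ltn_eqF // b_inK tinclK.
rewrite (below_trivial qn w) (is_linear_0 (@b_in_linear n)) !gen0.
by rewrite !is_linear_0 //; [exact: tproj_linear|case: assemble_gmorph].
Qed.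

End Assemble.
End Truncation.

(** * The two exact sequences *)

Section Sequences.
Variables (R : comNzRingType) (V : nat -> lmodType R) (q : nat) (top : lmodType R).
Variables (theta : top -> V q) (theta' : V q -> top).
Hypotheses (theta_linear : is_linear theta).
Hypotheses (thetaK : cancel theta theta') (theta'K : cancel theta' theta).
Hypothesis V0 : forall v : V 0, v = 0.
Hypothesis Vbig : forall n, (q < n)%N -> forall v : V n, v = 0.

Local Notation A := (tens V).
Local Notation B := (tens (below V q)).
Local Notation ctop := (@comp_top R V q).
Local Notation cmid := (@comp_mid R V q).
Local Notation clow := (@comp_low R V q).
Local Notation L := (lin_hom top (submod_of (tens_deg (below V q) q))).

Lemma theta'_linear : is_linear theta'.
Proof. by move=> a x y; apply: (can_inj thetaK); rewrite theta_linear !theta'K. Qed.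

Lemma gmorph_id (W : nat -> lmodType R) : gmorph (@id (tens W)).
Proof. by split. Qed.

(** Two triangular matrices with product one. *)
Lemma assembleK (a a' : V q -> V q) (h h' : V q -> B) (g g' : B -> B) :
  is_linear a -> is_linear h -> (forall v, homog q (h v)) -> gmorph g ->
  is_linear a' -> is_linear h' -> (forall v, homog q (h' v)) -> gmorph g' ->
  cancel a a' -> cancel g g' -> (forall v, h' (a v) + g' (h v) = 0) ->
  cancel (assemble a h g) (assemble a' h' g').
Proof.
move=> aL hL hH gG a'L h'L h'H g'G aK gK hh'.
have fG := assemble_gmorph aL hL hH gG; have f'G := assemble_gmorph a'L h'L h'H g'G.
apply: (endo_ext V0 Vbig (gmorph_comp f'G fG) (@gmorph_id _)).

- by move=> v; rewrite comp_topM // !comp_assemble_top // aK comp_top_id.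
- move=> v; rewrite comp_midM // comp_assemble_top // !comp_assemble_mid //.
  by rewrite comp_assemble_low // hh' comp_mid_id.
- by move=> b; rewrite comp_lowM // !comp_assemble_low // gK comp_low_id.
Qed.

(** The kernel consists of the unipotent matrices. *)
Section Shear.
Implicit Type x : L.

Definition shear_map x (v : V q) : B := submod_val (submod_val x (theta' v)).

Lemma shear_map_linear x : is_linear (shear_map x).
Proof.
have xL : is_linear (submod_val x) by exact/asboolP/(submod_valP x).
by move=> a u v; rewrite /shear_map theta'_linear xL.
Qed.

Lemma shear_map_homog x v : homog q (shear_map x v).
Proof. exact/asboolP/(submod_valP (submod_val x (theta' v))). Qed.

Lemma shear_mapN x v : shear_map (- x) v = - shear_map x v.
Proof. by []. Qed.

Definition shear x : A -> A := assemble id (shear_map x) id.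

Lemma id_linear (M : lmodType R) : is_linear (@id M). Proof. by []. Qed.

Lemma shear_gmorph x : gmorph (shear x).
Proof.
exact: assemble_gmorph (@id_linear _) (shear_map_linear x) (shear_map_homog x) (@gmorph_id _).
Qed.

Lemma shearK x : cancel (shear x) (shear (- x)).
Proof.
apply: assembleK => //; try exact: shear_map_linear; try exact: shear_map_homog.
by move=> v; rewrite shear_mapN addNr.
Qed.

Lemma shearNK x : cancel (shear (- x)) (shear x).
Proof. by rewrite -{2}[x]opprK; exact: shearK. Qed.

Lemma shear_top x v : ctop (shear x) v = v.
Proof. exact: comp_assemble_top (@id_linear _) (shear_map_linear x) (@gmorph_id _) _. Qed.

Lemma shear_mid x v : cmid (shear x) v = shear_map x v.
Proof. exact: comp_assemble_mid (@id_linear _) (shear_map_linear x) (@gmorph_id _) _. Qed.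

Lemma shear_low x b : clow (shear x) b = b.
Proof.
exact: comp_assemble_low (@id_linear _) (shear_map_linear x) (shear_map_homog x) (@gmorph_id _) _.
Qed.

Lemma shearD x y : shear (x + y) =1 shear x \o shear y.
Proof.
have xG := shear_gmorph x; have yG := shear_gmorph y.
apply: (endo_ext V0 Vbig (shear_gmorph _) (gmorph_comp xG yG)) => [v|v|b].
- by rewrite comp_topM // !shear_top.
- by rewrite comp_midM // !shear_mid shear_top shear_low.
- by rewrite comp_lowM // !shear_low.
Qed.

Lemma shear_inj x y : shear x =1 shear y -> x = y.
Proof.
move=> /funext xy; apply: val_inj; apply/funext => t; apply: val_inj.
have := shear_mid x (theta t); rewrite xy shear_mid /shear_map thetaK.
by move/esym.
Qed.

Lemma shear_onto f : gmorph f -> (forall v, ctop f v = v) -> (forall b, clow f b = b) ->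
  exists x, f =1 shear x.
Proof.
move=> fG ft fl.
have hH t : cmid f (theta t) \in submodule_pred (tens_deg (below V q) q).
  by apply/asboolP; exact: comp_mid_homog.
pose h t : submod_of (tens_deg (below V q) q) := SubmodOf (hH t).
have hL : is_linear h.
  move=> a t u; apply: val_inj => /=; rewrite theta_linear.
  exact: (comp_mid_linear fG).
have hL' : h \in submodule_pred (Submodule (@is_linear0 R top _) (@is_linearP R top _)).
  exact/asboolP.
exists (SubmodOf hL').
apply: (endo_ext V0 Vbig fG (shear_gmorph _)) => [v|v|b].
- by rewrite ft shear_top.
- by rewrite shear_mid /shear_map /= theta'K.
- by rewrite fl shear_low.
Qed.

Definition shear_aut x : tens_aut V :=
  Aut (P := MapClass (@graded_alg_morph_id R V) (@graded_alg_morph_comp R V))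
    (shearK x) (shearNK x) (shear_gmorph x) (shear_gmorph (- x)).

End Shear.

Lemma comp_lowK (f g : A -> A) : gmorph f -> gmorph g -> cancel f g ->
  cancel (clow f) (clow g).
Proof.
move=> fG gG /funext fg b.
by rewrite -[LHS]comp_lowM // [_ \o _]fg comp_low_id.
Qed.

Lemma comp_topK (f g : A -> A) : gmorph f -> gmorph g -> cancel f g ->
  cancel (ctop f) (ctop g).
Proof.
move=> fG gG /funext fg b.
by rewrite -[LHS]comp_topM // [_ \o _]fg comp_top_id.
Qed.

Definition low_aut (f : tens_aut V) : tens_aut (below V q) :=
  Aut (P := MapClass (@graded_alg_morph_id R _) (@graded_alg_morph_comp R _))
    (comp_lowK (aut_funP f) (aut_invP f) (@aut_funK _ _ f))
    (comp_lowK (aut_invP f) (aut_funP f) (@aut_invK _ _ f))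
    (comp_low_gmorph q (aut_funP f)) (comp_low_gmorph q (aut_invP f)).

Definition conj_top (f : A -> A) (t : top) : top := theta' (ctop f (theta t)).

Lemma conj_top_linear f : gmorph f -> is_linear (conj_top f).
Proof.
move=> fG; apply: is_linear_compose theta'_linear _.
exact: is_linear_compose (comp_top_linear fG) theta_linear.
Qed.

Lemma conj_topK (f g : A -> A) : gmorph f -> gmorph g -> cancel f g ->
  cancel (conj_top f) (conj_top g).
Proof. by move=> fG gG fgK t; rewrite /conj_top theta'K (comp_topK fG gG fgK) thetaK. Qed.

Definition top_aut (f : tens_aut V) : module_aut top :=
  Aut (P := MapClass (@is_linear_id R top) (@is_linear_comp R top))
    (conj_topK (aut_funP f) (aut_invP f) (@aut_funK _ _ f))
    (conj_topK (aut_invP f) (aut_funP f) (@aut_invK _ _ f))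
    (conj_top_linear (aut_funP f)) (conj_top_linear (aut_invP f)).

Lemma zero_linear : is_linear (fun _ : V q => 0 : B).
Proof. by move=> a x y; rewrite scaler0 addr0. Qed.

Theorem aut_short_exact :
  exists (i : L -> tens_aut V) (p : tens_aut V -> (module_aut top * tens_aut (below V q))%type),
    short_exact i p.
Proof.
exists shear_aut, (fun f => (top_aut f, low_aut f)); split.
- by move=> x y; apply: aut_eq => a; exact: shearD.
- move=> f g; congr pair; apply: aut_eq => t /=.
    rewrite /conj_top theta'K; congr theta'.
    exact: (comp_topM V0 _ (aut_funP f) (aut_funP g)).
  exact: (comp_lowM _ (aut_funP f) (aut_funP g)).
- move=> x y xy; apply: shear_inj => a.
  by rewrite -[LHS]/(shear_aut x a) xy.
- move=> f; split=> [e|[x <-]].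
    have fG : gmorph f := aut_funP f.
    have [] := @shear_onto f fG.
    + move=> v; apply: (can_inj theta'K).
      by have := congr1 (fun k => (k.1 : module_aut top) (theta' v)) e; rewrite /= /conj_top theta'K.
    + by move=> b; have := congr1 (fun k => (k.2 : tens_aut (below V q)) b) e.
    by move=> x fx; exists x; apply: aut_eq => a; rewrite fx.
  congr pair; apply: aut_eq => t /=; last exact: shear_low.
  by rewrite /conj_top shear_top thetaK.
- move=> [k u].
  have uG : gmorph u := aut_funP u; have u'G : gmorph (aut_inv u) := aut_invP u.
  pose a v := theta (k (theta' v)); pose a' v := theta (aut_inv k (theta' v)).
  have aL : is_linear a.
    apply: is_linear_compose theta_linear _.
    exact: is_linear_compose (aut_funP k) theta'_linear.
  have a'L : is_linear a'.
    apply: is_linear_compose theta_linear _.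
    exact: is_linear_compose (aut_invP k) theta'_linear.
  have aK : cancel a a' by move=> v; rewrite /a /a' thetaK aut_funK theta'K.
  have a'K : cancel a' a by move=> v; rewrite /a /a' thetaK aut_invK theta'K.
  have zH (v : V q) : homog q (0 : B) by exact: homog0.
  have u0 : u 0 = 0 by case: uG => uL _ _; exact: is_linear_0.
  have u'0 : aut_inv u 0 = 0 by case: u'G => uL _ _; exact: is_linear_0.
  have gK := assembleK aL zero_linear zH uG a'L zero_linear zH u'G aK (@aut_funK _ _ u).
  have g'K := assembleK a'L zero_linear zH u'G aL zero_linear zH uG a'K (@aut_invK _ _ u).
  have {}gK := gK (fun v => etrans (add0r _) u'0).
  have {}g'K := g'K (fun v => etrans (add0r _) u0).
  exists (Aut (P := MapClass (@graded_alg_morph_id R V) (@graded_alg_morph_comp R V)) gK g'K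
    (assemble_gmorph aL zero_linear zH uG) (assemble_gmorph a'L zero_linear zH u'G)).
  congr pair; apply: aut_eq => t /=.
    rewrite /conj_top (comp_assemble_top aL zero_linear uG).
    by rewrite /a !thetaK.
  exact: comp_assemble_low aL zero_linear zH uG _.
Qed.

(** ** Automorphisms acting trivially on the indecomposables *)

(** In degree [q] and above, the subalgebra has decomposable elements only, having no
    generators there. *)
Lemma tincl_decomp n (b : B) : (0 < n)%N -> (q <= n)%N -> homog n b -> tens_decomp V (tincl b).
Proof.
move=> n0 qn hb; apply: gmorph_decomp (tincl_gmorph V q) _.
apply: (decomp_above _ n0 _ hb) => [|m nm]; last exact: below_trivial (leq_trans qn nm).
rewrite /below; case: (0 < q)%N => [v|w]; first exact: V0.
by rewrite [w]thinmx0.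
Qed.

Lemma comp_low_star f : graded_alg_morph_star f -> graded_alg_morph_star (clow f).
Proof.
move=> [fG fS]; split; first exact: comp_low_gmorph.
move=> x px; rewrite /comp_low /=.
have := fS _ (gmorph_pos (tincl_gmorph V q) px).
move/(gmorph_decomp (tproj_gmorph V q)).
by rewrite (is_linearB _ _ (@tproj_linear R V q)) tinclK.
Qed.

(** The linear part vanishes on decomposables. *)
Lemma comp_top_star f v : graded_alg_morph_star f -> ctop f v = v.
Proof.
move=> [fG fS]; move: v; have [e|q0] := posnP q => v.
  have all0 (w : V q) : w = 0 by move: w; rewrite e; exact: V0.
  by rewrite [v]all0 [LHS]all0.
have := tens_lin_decomp (@topq_family R V q) (fS _ (homog_pos q0 (homog_gen v))).
rewrite -/(topq _) (is_linearB _ _ (@topq_linear R V q)) topq_gen => /eqP.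
by rewrite subr_eq0 => /eqP.
Qed.

Lemma assemble_star (h : V q -> B) (g : B -> B) : is_linear h -> (forall v, homog q (h v)) -> graded_alg_morph_star g ->
  graded_alg_morph_star (assemble id h g).
Proof.
move=> hL hH [gG gS].
apply: star_of_gen => // [|n v n0]; first exact: assemble_gmorph.
have [e|nq] := eqVneq n q.
  move: v; rewrite e => v; rewrite assemble_top // [tens_gen _ + _]addrC addrK.
  by apply: tincl_decomp (hH v) => //; rewrite -e.
rewrite assemble_neq //; case: (ltngtP n q) nq => // [nq _|qn _]; last first.
  have [gL _ _] := gG; rewrite (Vbig qn v) (is_linear_0 (@b_out_linear R V q n)) !gen0.
  by rewrite (is_linear_0 gL) (is_linear_0 (@tincl_linear R V q)) subrr; exact: submodule0.
have -> : tens_gen v = tincl (tens_gen (b_out q v)) by rewrite tincl_gen b_outK.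
rewrite -(is_linearB _ _ (@tincl_linear R V q)).
apply: gmorph_decomp (tincl_gmorph V q) _; apply: gS.
exact: homog_pos n0 (homog_gen _).
Qed.

Lemma shear_star x : graded_alg_morph_star (shear x).
Proof.
apply: assemble_star; [exact: shear_map_linear|exact: shear_map_homog|].
exact: graded_alg_morph_star_id.
Qed.

Definition shear_aut_star x : tens_aut_star V :=
  Aut (P := MapClass (@graded_alg_morph_star_id R V) (@graded_alg_morph_star_comp R V))
    (shearK x) (shearNK x) (shear_star x) (shear_star (- x)).

Definition low_aut_star (f : tens_aut_star V) : tens_aut_star (below V q) :=
  Aut (P := MapClass (@graded_alg_morph_star_id R _) (@graded_alg_morph_star_comp R _))
    (comp_lowK (aut_funP f).1 (aut_invP f).1 (@aut_funK _ _ f))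
    (comp_lowK (aut_invP f).1 (aut_funP f).1 (@aut_invK _ _ f))
    (comp_low_star (aut_funP f)) (comp_low_star (aut_invP f)).

Theorem aut_star_short_exact :
  exists (i : L -> tens_aut_star V) (p : tens_aut_star V -> tens_aut_star (below V q)),
    short_exact i p.
Proof.
exists shear_aut_star, low_aut_star; split.
- by move=> x y; apply: aut_eq => a; exact: shearD.
- move=> f g; apply: aut_eq => b.
  exact: (comp_lowM _ (aut_funP f).1 (aut_funP g).1).
- move=> x y xy; apply: shear_inj => a.
  by rewrite -[LHS]/(shear_aut_star x a) xy.
- move=> f; split=> [fl|[x <-]]; last by apply: aut_eq => b; exact: shear_low.
  have [fG _] := aut_funP f.
  have [|b|x fx] := @shear_onto f fG.
  + by move=> v; apply: comp_top_star; exact: aut_funP f.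
  + by have := congr1 (fun k : tens_aut_star (below V q) => k b) fl.
  by exists x; apply: aut_eq => a; rewrite fx.
- move=> u.
  have uS := aut_funP u; have u'S := aut_invP u.
  have uG : gmorph u := uS.1; have u'G : gmorph (aut_inv u) := u'S.1.
  have zH (v : V q) : homog q (0 : B) by exact: homog0.
  have u0 : u 0 = 0 by case: uG => uL _ _; exact: is_linear_0.
  have u'0 : aut_inv u 0 = 0 by case: u'G => uL _ _; exact: is_linear_0.
  have iL := @id_linear (V q).
  have gK := assembleK iL zero_linear zH uG iL zero_linear zH u'G
    (fun v => erefl) (@aut_funK _ _ u) (fun v => etrans (add0r _) u'0).
  have g'K := assembleK iL zero_linear zH u'G iL zero_linear zH uG
    (fun v => erefl) (@aut_invK _ _ u) (fun v => etrans (add0r _) u0).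
  exists (Aut (P := MapClass (@graded_alg_morph_star_id R V) (@graded_alg_morph_star_comp R V))
    gK g'K (assemble_star zero_linear zH uS) (assemble_star zero_linear zH u'S)).
  by apply: aut_eq => b; exact: comp_assemble_low iL zero_linear zH uG _.
Qed.

End Sequences.

(** * The theorem *)

Theorem theorem3 (RR : realType) (R : idomainType) (Y : topologicalType)
    (q : nat) :
  is_PID R ->
  cw_complex RR Y ->
  simply_connected RR Y ->
  (forall n, is_free (reduced_homology RR R Y n)) ->
  has_dimension RR (suspension RR Y) q.+1 ->
  let V := reduced_homology RR R Y in
  let top := reduced_homology RR R (suspension RR Y) q.+1 in
  let L := lin_hom top (submod_of (tens_deg (below V q) q)) in
  (exists (i : L -> tens_aut V)
          (p : tens_aut V -> (module_aut top * tens_aut (below V q))%type),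
     short_exact i p) /\
  (exists (i : L -> tens_aut_star V)
          (p : tens_aut_star V -> tens_aut_star (below V q)),
     short_exact i p).
Proof.
move=> _ _ Ysc _ dimY V top L.
have [[y0 _] _ _] := Ysc.
have V0 : forall v : V 0, v = 0 := homology0_connected Ysc.
have Vbig n : (q < n)%N -> forall v : V n, v = 0.
  by move=> qn; exact: (homology_above_dimension y0 dimY qn).
have [theta [theta' [thetaL thetaK theta'K]]] := @suspension_iso RR R Y y0 q.
split; first exact: aut_short_exact thetaL thetaK theta'K V0 Vbig.
exact: aut_star_short_exact thetaL thetaK theta'K V0 Vbig.
Qed.
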